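(* Fix $q\in[1,2]$. For each $n\in\mathbb N$ let $X^{(n)}$ be a random vector in $\mathbb R^n$, let $1\le k_n\le n$ be an integer, and let $\mathbf A_{n,k_n}$ be a random $n\times k_n$ matrix distributed according to the Haar measure on the Stiefel manifold $\mathbb V_{n,k_n}$, independent of $X^{(n)}$. Assume $k_n\to\infty$ and $k_n/n\to0$. Assume that $\{\|X^{(n)}\|_2/\sqrt n\}_n$ satisfies an LDP in $\mathbb R$ at speed $s_n$ with GRF $J_X:\mathbb R\to[0,\infty]$, and that $J_X$ has a unique minimum at some $m>0$. Let $Y^n_{q,k_n}:=\|\mathbf A_{n,k_n}^TX^{(n)}\|_q$. Then, in each of the cases $s_n\gg k_n$, $s_n=k_n$, $s_n\ll k_n$, the sequence $\{k_n^{-1/q}Y^n_{q,k_n}\}_n$ satisfies an LDP in $\mathbb R$ at speed $s_n\wedge k_n$ with GRF $\widehat{\mathbb J}_q^{\mathsf{sub}}:\mathbb R\to[0,\infty]$ given, for $x\ge0$, by $$\widehat{\mathbb J}_q^{\mathsf{sub}}(x)=\begin{cases}\Lambda_q^*(x^q/m^q),&s_n\gg k_n,\\ \inf_{c>0}\{\Lambda_q^*(c^q)+J_X(x/c)\},&s_n=k_n,\\ J_X(x/\mathcal M_q^{1/q}),&s_n\ll k_n,\end{cases}$$ and $\widehat{\mathbb J}_q^{\mathsf{sub}}(x)=+\infty$ for $x<0$.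
   Context: Stiefel manifold: $\mathbb V_{n,k}=\{A\in\mathbb R^{n\times k}:A^TA=I_k\}$; its Haar measure is the unique probability measure on it invariant under orthogonal transformations. $\|\cdot\|_q$ is the $\ell_q$ norm; $a\wedge b=\min(a,b)$; $a_n\ll b_n$ (equivalently $b_n\gg a_n$) means $a_n/b_n\to0$. $\Lambda_q(t)=\log\int_{\mathbb R}\frac1{\sqrt{2\pi}}\exp(t|x|^q-\frac12x^2)\,dx$ for $t\in\mathbb R$ (finite for all $t$ if $q\in[1,2)$; if $q=2$, finite for $t<1/2$ and $+\infty$ for $t\ge 1/2$), and $\Lambda_q^*(x)=\sup_{t\in\mathbb R}\{xt-\Lambda_q(t)\}$. $\mathcal M_q=\int_{\mathbb R}\frac1{\sqrt{2\pi}}|x|^qe^{-x^2/2}dx=\frac{2^{q/2}}{\sqrt\pi}\Gamma(\frac{q+1}2)$. LDP: a sequence of random variables $\{\eta_n\}$ with values in a regular topological space $\mathcal X$ satisfies a large deviation principle (LDP) at speed $s_n$ (positive reals with $s_n\to\infty$) with rate function $I:\mathcal X\to[0,\infty]$ if $I$ is lower semicontinuous and for every Borel set $\Gamma$, $-\inf_{\Gamma^\circ}I\le\liminf_n\frac1{s_n}\log\mathbb P(\eta_n\in\Gamma)\le\limsup_n\frac1{s_n}\log\mathbb P(\eta_n\in\Gamma)\le-\inf_{\bar\Gamma}I$. It is a good rate function (GRF) if moreover its level sets are compact. *)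

(* Defs.v *)
From HB Require Import structures.
From mathcomp Require Import all_boot all_order all_algebra.
From mathcomp Require Import all_classical all_reals all_analysis.

Set Implicit Arguments.
Unset Strict Implicit.
Unset Printing Implicit Defensive.

Import Order.TTheory GRing.Theory Num.Theory.
Import numFieldNormedType.Exports.

Local Open Scope classical_set_scope.
Local Open Scope ring_scope.

(* A copy of [V] carrying its Borel sigma-algebra; the library puts no
   measurable structure on matrices. *)
Notation borel V := (g_sigma_algebraType (@open V)).

(* Here and below sequences are indexed by n >= 1: the value at n = 0, which
   exists only because the index type is [nat], is never constrained. *)
Definition is_speed (R : realType) (s : nat -> R) : Prop :=
  (forall n, (0 < n)%N -> 0 < s n) /\ s n @[n --> \oo] --> +oo.

(* [eta n] lives on its own probability space [(T n, P n)], so that a common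
   probability space is a special case.  [lne] is log with log 0 = -oo, and
   [ereal_inf set0 = +oo]. *)
Definition LDP (R : realType) (d : nat -> measure_display)
    (T : forall n, measurableType (d n)) (P : forall n, probability (T n) R)
    (eta : forall n, T n -> R) (s : nat -> R) (I : R -> \bar R) : Prop :=
  [/\ is_speed s,
      forall x, (0 <= I x)%E,
      lower_semicontinuous I &
      forall G : set R, measurable G ->
        let u n := (((s n)^-1)%R%:E * lne (P n (eta n @^-1` G)))%E in
        [/\ (- ereal_inf (I @` interior G) <= limn_einf u)%E,
            (limn_einf u <= limn_esup u)%E &
            (limn_esup u <= - ereal_inf (I @` closure G))%E]].

Definition LDP_GRF (R : realType) (d : nat -> measure_display)
    (T : forall n, measurableType (d n)) (P : forall n, probability (T n) R)
    (eta : forall n, T n -> R) (s : nat -> R) (I : R -> \bar R) : Prop :=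
  LDP P eta s I /\ forall a : R, compact [set x | (I x <= a%:E)%E].

Definition lqnorm (R : realType) (q : R) (n : nat) (v : 'cV[R]_n) : R :=
  (\sum_(i < n) `|v i 0| `^ q) `^ q^-1.

Definition stiefel (R : realType) (n k : nat) : set 'M[R]_(n, k) :=
  [set A | A^T *m A = 1%:M].

(* The Haar measure is seen as a probability on all n x k matrices that is
   concentrated on the Stiefel manifold; [stiefel n n] is the orthogonal
   group. *)
Definition is_haar_stiefel (R : realType) (n k : nat)
    (mu : probability (borel 'M[R]_(n, k)) R) : Prop :=
  mu (@stiefel R n k) = 1%E /\
  forall O : 'M[R]_n, stiefel O ->
    forall B : set (borel 'M[R]_(n, k)), measurable B ->
      mu [set A | B (O *m A)] = mu B.

Definition independent_rv (R : realType) (d d1 d2 : measure_display)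
    (T : measurableType d) (T1 : measurableType d1) (T2 : measurableType d2)
    (P : probability T R) (X : T -> T1) (Y : T -> T2) : Prop :=
  forall (B : set T1) (C : set T2), measurable B -> measurable C ->
    P (X @^-1` B `&` Y @^-1` C) = (P (X @^-1` B) * P (Y @^-1` C))%E.

(* a_n << b_n *)
Definition much_less (R : realType) (a b : nat -> R) : Prop :=
  a n / b n @[n --> \oo] --> (0 : R).

Definition Lambda (R : realType) (q t : R) : \bar R :=
  lne (\int[lebesgue_measure]_(x in [set: R])
    ((Num.sqrt (2 * pi))^-1 * expR (t * `|x| `^ q - x ^+ 2 / 2))%R%:E)%E.

Definition Lambda_star (R : realType) (q x : R) : \bar R :=
  ereal_sup [set ((x * t)%R%:E - Lambda q t)%E | t in [set: R]].

Definition gauss_moment (R : realType) (q : R) : R :=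
  \int[lebesgue_measure]_(x in [set: R])
    ((Num.sqrt (2 * pi))^-1 * `|x| `^ q * expR (- (x ^+ 2 / 2))).

Definition rate_fast (R : realType) (q m x : R) : \bar R :=
  if 0 <= x then Lambda_star q (x `^ q / m `^ q) else +oo%E.

Definition rate_critical (R : realType) (q : R) (J : R -> \bar R) (x : R)
    : \bar R :=
  if 0 <= x then
    ereal_inf [set (Lambda_star q (c `^ q)%R + J (x / c)%R)%E
              | c in [set c : R | 0 < c]]
  else +oo%E.

Definition rate_slow (R : realType) (q : R) (J : R -> \bar R) (x : R)
    : \bar R :=
  if 0 <= x then J (x / gauss_moment q `^ q^-1) else +oo%E.

(* Main.v *)
(* By invariance of the Haar measure, [Y n / k^(1/q)] has the law of a product
   [V * W] of independent factors: the radius [V = |X|_2 / sqrt n], whose large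
   deviations are given, and [W = sqrt n * k^(-1/q) * |A^T e_1|_q].  A standard
   Gaussian [g] in dimension [n] is rotation invariant and [A^T g] is standard
   Gaussian in dimension [k]; hence [(|g|_2 / sqrt n) * W] has the law of the
   power mean [(k^-1 * sum |g_i|^q)^(1/q)] of [k] standard Gaussians, for which
   Cramer's theorem holds at speed [k].  As [k << n], the factor [|g|_2 / sqrt n]
   is superexponentially close to 1 at speed [k] and can be divided out.  If
   the two speeds differ, only the factor with the slower one fluctuates in
   [V * W], the other one sticking to the zero of its rate function; if they
   agree, the two rates add up. *)
Require Import Defs.
From HB Require Import structures.
From mathcomp Require Import all_boot all_order all_algebra.
From mathcomp Require Import ring lra.
From mathcomp Require Import all_classical all_reals all_analysis.
From mathcomp Require Import measurable_realfun.

Set Implicit Arguments.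
Unset Strict Implicit.
Unset Printing Implicit Defensive.

Import Order.TTheory GRing.Theory Num.Theory.
Import numFieldNormedType.Exports.

Local Open Scope classical_set_scope.
Local Open Scope ring_scope.

(** * Large deviations through small balls *)

(** The obstacle is that [W] is seen only through its product with an independent factor, and that
    the identities in law hold for one [n] at a time between different probability spaces. The
    principle is therefore traded for [local_ldp]. Bounds on small balls depend only on
    one-dimensional laws, multiply under independence, and survive division by a factor close to 1.
    A candidate rate [I] for [V * W] then has to meet two conditions: [I (v * w)] is at most
    [IV v + IW w], and such sums over factorizations of [z] come arbitrarily close to [I z]. The
    infimum over [c > 0] in the critical case fits because [Lambda_star q 0 = +oo]: a vanishing [W]
    has infinite cost.

    That [|g|_2 / sqrt n] is close to 1 comes from the same Cramer theorem with exponent 2, valid at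
    speed [n] and read at the slower speed [k n].

    In Cramer's theorem the delicate exponent is [q = 2], whose moment generating function is
    infinite from 1/2 on. The lower bound uses neither tilted measures nor derivatives: a
    second-difference bound at a minimizer replaces both. Rotation invariance of the Gaussian is
    reduced to plane rotations, each treated by one-variable substitutions. *)

Lemma compact_ideal (S : topologicalType) (K : set S) (Id : set S -> Prop) :
  compact K -> Id set0 -> (forall A B, A `<=` B -> Id B -> Id A) ->
  (forall A B, Id A -> Id B -> Id (A `|` B)) ->
  (forall x, K x -> exists2 N, nbhs x N & Id N) -> Id K.
Proof.
move=> cK Id0 IdS IdU Idloc; apply: contrapT => nIdK.
(* If [Id K] fails, the sets [B] filling [K] up to a member of the ideal form a proper filter
   containing [K]. At a cluster point of it, a neighbourhood in the ideal would have to meet its own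
   complement. *)
pose F (B : set S) := Id (K `\` B).
have PF : ProperFilter F.
  apply: Build_ProperFilter_ex.
    move=> B FB; apply: contrapT => B0; apply: nIdK.
    apply: IdS FB => x Kx; split=> // Bx; apply: B0; by exists x.
  split.
  - by rewrite /F setDT.
  - move=> A B FA FB; apply: IdS (IdU _ _ FA FB) => x [Kx /not_andP[]].
    + by left.
    + by right.
  - by move=> A B AB; apply: IdS => x [Kx nB]; split=> // /AB.
have FK : F K by rewrite /F setDv.
have [x [Kx clx]] := cK F PF FK.
have [N Nx IdN] := Idloc x Kx.
have FN : F (~` N) by rewrite /F; apply: IdS IdN => y [_ /contrapT].
by have [y [nNy Ny]] := clx _ _ FN Nx.
Qed.

Lemma limn_esup_le (R : realType) (u : (\bar R)^nat) (l : \bar R) :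
  (\forall n \near \oo, u n <= l)%E -> (limn_esup u <= l)%E.
Proof.
move=> ul; apply: (@le_trans _ _ (ereal_sup (u @` [set n | (u n <= l)%E]))).
  by apply: ereal_inf_lbound; exists [set n | (u n <= l)%E].
by apply: ge_ereal_sup => _ [n /= un <-].
Qed.

Lemma limn_esup_lt (R : realType) (u : (\bar R)^nat) (l : \bar R) :
  (limn_esup u < l)%E -> (\forall n \near \oo, u n < l)%E.
Proof.
move=> /ereal_inf_lt[_ [A FA <-]] supA; apply: filterS FA => n An.
by apply: le_lt_trans supA; apply: ereal_sup_ubound; exists n.
Qed.

Lemma limn_einf_ge (R : realType) (u : (\bar R)^nat) (l : \bar R) :
  (\forall n \near \oo, l <= u n)%E -> (l <= limn_einf u)%E.
Proof.
move=> ul; rewrite /limn_einf leeNr; apply: limn_esup_le.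
by apply: filterS ul => n; rewrite leeN2.
Qed.

Lemma limn_einf_gt (R : realType) (u : (\bar R)^nat) (l : \bar R) :
  (l < limn_einf u)%E -> (\forall n \near \oo, l < u n)%E.
Proof.
rewrite /limn_einf lteNr => /limn_esup_lt.
by apply: filterS => n; rewrite lteN2.
Qed.

Lemma ereal_between (R : realType) (x y : \bar R) : (x < y)%E ->
  exists a : R, (x < a%:E)%E /\ (a%:E < y)%E.
Proof.
case: x y => [x| |] [y| |] //= xy.
- exists ((x + y) / 2); rewrite !lte_fin in xy *; lra.
- by exists (x + 1); rewrite lte_fin ltry; split=> //; lra.
- by exists (y - 1); rewrite lte_fin ltNyr; split=> //; lra.
- by exists 0; rewrite ltry ltNyr.
Qed.

(** The case [p = 0] is included through [lne 0 = -oo], so that events of probability zero never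
    need separate treatment. *)
Lemma scaled_lne_le (R : realType) (s a : R) (p : \bar R) : 0 < s -> (0 <= p)%E ->
  ((s^-1)%:E * lne p <= (- a)%:E)%E = (p <= (expR (- (s * a)))%:E)%E.
Proof.
case: p => [r| |] s0 // p0.
- have s1 : 0 < s^-1 by rewrite invr_gt0.
  rewrite lee_fin in p0; case: (ltrgtP r 0) p0 => // [r0 _|-> _].
    rewrite lne_EFin// -EFinM !lee_fin ler_pdivrMl// mulrN.
    by rewrite -[in RHS](lnK r0) ler_expR.
  by rewrite /= lexx mulrNy gtr0_sg// mul1e leNye lee_fin expR_ge0.
- by rewrite /= mulry gtr0_sg ?invr_gt0// mul1e !leye_eq.
Qed.

Lemma scaled_lne_ge (R : realType) (s a : R) (p : \bar R) : 0 < s -> (0 <= p)%E ->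
  ((- a)%:E <= (s^-1)%:E * lne p)%E = ((expR (- (s * a)))%:E <= p)%E.
Proof.
case: p => [r| |] s0 // p0.
- have s1 : 0 < s^-1 by rewrite invr_gt0.
  rewrite lee_fin in p0; case: (ltrgtP r 0) p0 => // [r0 _|-> _].
    rewrite lne_EFin// -EFinM !lee_fin ler_pdivlMl// mulrN.
    by rewrite -[in RHS](lnK r0) ler_expR.
  rewrite /= lexx mulrNy gtr0_sg// mul1e leeNy_eq lee_fin.
  by rewrite leNgt expR_gt0.
- by rewrite /= mulry gtr0_sg ?invr_gt0// mul1e !leey.
Qed.

(* On the line, an LDP with a good rate function amounts to exponential bounds for
   small balls, which are stable under products, plus exponential tightness. *)
Definition local_ldp (R : realType) (d : nat -> measure_display)
    (T : forall n, measurableType (d n)) (P : forall n, probability (T n) R)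
    (eta : forall n, T n -> R) (s : nat -> R) (I : R -> \bar R) : Prop :=
  [/\ forall x r a : R, 0 < r -> (I x < a%:E)%E -> \forall n \near \oo,
        ((expR (- (s n * a)))%:E <= P n [set w | (`|eta n w - x| < r)%R])%E,
      forall x a : R, (a%:E < I x)%E -> exists2 r : R, 0 < r &
        \forall n \near \oo,
        (P n [set w | (`|eta n w - x| < r)%R] <= (expR (- (s n * a)))%:E)%E &
      forall a : R, exists K : R, \forall n \near \oo,
        (P n [set w | (K <= `|eta n w|)%R] <= (expR (- (s n * a)))%:E)%E].

(** Constant factors, such as those produced by finite unions, cost an arbitrarily small loss in the
    rate because the speed diverges. *)
Lemma expR_absorb (R : realType) (s : nat -> R) (C a b : R) :
  s n @[n --> \oo] --> +oo -> a < b ->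
  \forall n \near \oo, C * expR (- (s n * b)) <= expR (- (s n * a)).
Proof.
move=> sy ab; have /cvgryPge/(_ (C / (b - a))) := sy.
apply: filterS => n; rewrite ler_pdivrMr ?subr_gt0// => Cs.
have -> : - (s n * a) = s n * (b - a) + - (s n * b) by ring.
rewrite expRD ler_wpM2r ?expR_ge0//.
by apply: (le_trans Cs); apply: le_trans (expR_ge1Dx _); lra.
Qed.

Section exp_small.
Context (R : realType) (d : nat -> measure_display).
Context (T : forall n, measurableType (d n)) (P : forall n, probability (T n) R).

(** The free constant [C] makes these families stable under finite unions, hence an ideal fit for
    [compact_ideal]. The measurable cover [B] allows preimages of arbitrary sets of reals, over
    which that ideal ranges. *)
Definition exp_small (s : nat -> R) (a : R) (E : forall n, set (T n)) : Prop :=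
  exists C (B : forall n, set (T n)), [/\ forall n, measurable (B n),
    forall n, E n `<=` B n &
    \forall n \near \oo, (P n (B n) <= (C * expR (- (s n * a)))%:E)%E].

Lemma exp_small_sub s a (E F : forall n, set (T n)) :
  (forall n, E n `<=` F n) -> exp_small s a F -> exp_small s a E.
Proof.
by move=> EF [C [B [mB FB PB]]]; exists C, B; split=> // n x /EF/FB.
Qed.

Lemma exp_small0 s a : exp_small s a (fun n => set0).
Proof.
exists 0, (fun n => set0); split=> //; first by move=> n x.
by exists 0%N => // n _ /=; rewrite measure0 mul0r.
Qed.

Lemma exp_smallU s a (E F : forall n, set (T n)) :
  exp_small s a E -> exp_small s a F -> exp_small s a (fun n => E n `|` F n).
Proof.
move=> [C [B [mB EB PB]]] [C' [B' [mB' FB' PB']]].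
exists (C + C'), (fun n => B n `|` B' n); split.
- by move=> n; exact: measurableU.
- by move=> n; exact: setUSS.
- near=> n; apply: (@le_trans _ _ (P n (B n) + P n (B' n))%E).
    exact: measureU2.
  rewrite mulrDl EFinD; apply: leeD; by near: n.
Unshelve. all: by end_near. Qed.

Lemma exp_small_measurable s a (E : forall n, set (T n)) :
  (forall n, measurable (E n)) ->
  (\forall n \near \oo, (P n (E n) <= (expR (- (s n * a)))%:E)%E) ->
  exp_small s a E.
Proof.
move=> mE PE; exists 1, E; split=> //; first by move=> n x.
by apply: filterS PE => n; rewrite mul1r.
Qed.

Lemma exp_small_le s a b (E : forall n, set (T n)) :
  s n @[n --> \oo] --> +oo -> (forall n, measurable (E n)) -> b < a ->
  exp_small s a E ->
  \forall n \near \oo, (P n (E n) <= (expR (- (s n * b)))%:E)%E.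
Proof.
move=> sy mE ba [C [B [mB EB PB]]]; have := expR_absorb C sy ba.
apply: filterS2 PB => n PB Cab.
apply: (@le_trans _ _ (P n (B n))); first by apply: le_measure; rewrite ?inE//; exact: EB.
by apply: (le_trans PB); rewrite lee_fin.
Qed.

End exp_small.

Section local_ldp_theory.
Context (R : realType) (d : nat -> measure_display).
Context (T : forall n, measurableType (d n)) (P : forall n, probability (T n) R).
Implicit Types (eta : forall n, T n -> R) (s : nat -> R) (I : R -> \bar R).

Lemma near_contra (p q : nat -> Prop) : (\forall n \near \oo, p n) ->
  (\forall n \near \oo, q n) -> (forall n, p n -> q n -> False) -> False.
Proof.
move=> pn qn pq; have [n [pn' qn']] : exists n, p n /\ q n.
  by apply: (@filter_ex _ \oo); near=> n; split; near: n.
exact: pq pn' qn'.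
Unshelve. all: by end_near. Qed.

Lemma speed_gt0 s : s n @[n --> \oo] --> +oo -> \forall n \near \oo, 0 < s n.
Proof. by move=> /cvgryPgt/(_ 0). Qed.

Lemma measurable_ballE eta n x r : measurable_fun setT (eta n) ->
  measurable [set w | (`|eta n w - x| < r)%R].
Proof.
move=> me; have -> : [set w | (`|eta n w - x| < r)%R] =
    (fun w => `|eta n w - x|) @^-1` `]-oo, r[.
  by apply/seteqP; split=> w /=; rewrite in_itv.
rewrite -[X in measurable X]setTI.
have : measurable_fun setT (fun w => `|eta n w - x|).
  by apply: measurableT_comp => //; exact: measurable_funB.
by apply => //; exact: measurable_itv.
Qed.

Lemma measurable_tailE eta n K : measurable_fun setT (eta n) ->
  measurable [set w | (K <= `|eta n w|)%R].
Proof.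
move=> me; have -> : [set w | (K <= `|eta n w|)%R] =
    (fun w => `|eta n w|) @^-1` `[K, +oo[.
  by apply/seteqP; split=> w /=; rewrite in_itv/= andbT.
rewrite -[X in measurable X]setTI.
have : measurable_fun setT (fun w => `|eta n w|).
  by apply: measurableT_comp.
by apply => //; exact: measurable_itv.
Qed.

Lemma local_ldp_ge0 eta s I : s n @[n --> \oo] --> +oo ->
  (forall n, measurable_fun setT (eta n)) ->
  local_ldp P eta s I -> forall x, (0 <= I x)%E.
Proof.
move=> sy me [L _ _] x; rewrite leNgt; apply/negP => /ereal_between[a [Ia a0]].
have sp := speed_gt0 sy.
apply: (near_contra sp (L x 1 a ltr01 Ia)) => n sn.
apply/negP; rewrite -ltNge; apply: le_lt_trans (probability_le1 _ _) _.
  exact: measurable_ballE.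
by rewrite lte_fin expR_gt1 oppr_gt0 pmulr_rlt0// -lte_fin.
Qed.

(** A point [y] near [x] with a rate below [b] would force, on a ball around [y] contained in the
    ball around [x], a probability larger than the upper bound allows. *)
Lemma local_ldp_lsc eta s I : s n @[n --> \oo] --> +oo ->
  (forall n, measurable_fun setT (eta n)) ->
  local_ldp P eta s I -> lower_semicontinuous I.
Proof.
move=> sy me [L U _] x a /ereal_between[b [ab bI]].
have [r r0 Ur] := U x b bI.
exists (ball x (r / 2)) => [|y xy]; first by apply: nbhsx_ballx; rewrite divr_gt0.
rewrite ltNge; apply/negP => Iya.
have [c [Iyc cb]] : exists c, (I y < c%:E)%E /\ (c%:E < b%:E)%E.
  exact/ereal_between/(le_lt_trans Iya).
have sp := speed_gt0 sy.
have r2 : 0 < r / 2 by rewrite divr_gt0.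
have Ly := L y _ c r2 Iyc.
have {}Ur : \forall n \near \oo, (P n [set w | (`|eta n w - y| < r / 2)%R]
    <= (expR (- (s n * b)))%:E)%E.
  apply: filterS Ur => n; apply: le_trans.
  apply: le_measure; rewrite ?inE; [exact: measurable_ballE..|].
  move=> w /= etay; rewrite /ball/= in xy.
  have -> : eta n w - x = (eta n w - y) - (x - y) by ring.
  by apply: le_lt_trans (ler_normB _ _) _; lra.
apply: (near_contra sp) => [|n sn]; first exact: (filterI Ly Ur).
move=> [/le_trans] /[apply]; rewrite lee_fin ler_expR.
by rewrite lte_fin in cb; rewrite lerN2 leNgt ltr_pM2l ?cb.
Qed.

(** A point of the level set far out would carry a unit ball inside the tail event; the lower bound
    at rate [a + 1] on this ball contradicts tightness at rate [a + 2]. *)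
Lemma local_ldp_level_bounded eta s I : s n @[n --> \oo] --> +oo ->
  (forall n, measurable_fun setT (eta n)) ->
  local_ldp P eta s I -> forall a : R, exists K : R,
    forall x, (I x <= a%:E)%E -> `|x| < K.
Proof.
move=> sy me [L _ Ti] a; have [K TK] := Ti (a + 2).
exists (K + 1) => x Ixa; rewrite ltNge; apply/negP => Kx.
have Ix1 : (I x < (a + 1)%:E)%E by apply: le_lt_trans Ixa _; rewrite lte_fin; lra.
apply: (near_contra (speed_gt0 sy) (filterI (L x 1 _ ltr01 Ix1) TK)) => n sn [Ln Tn].
have : (expR (- (s n * (a + 1))) <= expR (- (s n * (a + 2))))%R.
  rewrite -lee_fin; apply: (le_trans Ln); apply: le_trans Tn.
  apply: le_measure; rewrite ?inE; [exact: measurable_ballE|exact: measurable_tailE|].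
  move=> w /= etax.
  have : `|x| <= `|eta n w| + `|eta n w - x|.
    have -> : x = eta n w - (eta n w - x) by ring.
    by rewrite [X in _ + `|X|](_ : _ = eta n w - x); [exact: ler_normB|ring].
  lra.
by rewrite ler_expR lerN2 ler_pM2l//; lra.
Qed.

(** For the upper bound, the part of the closure of [G] in a segment is covered by finitely many
    balls of small probability, and the rest is the tail. For the lower bound, a single ball inside
    the interior suffices. *)
Lemma local_ldp_LDP_GRF eta s I : is_speed s ->
  (forall n, measurable_fun setT (eta n)) ->
  local_ldp P eta s I -> LDP_GRF P eta s I.
Proof.
move=> [s0 sy] me ldp; have lsc := local_ldp_lsc sy me ldp.
split; last first.
  move=> a; have [K IK] := local_ldp_level_bounded sy me ldp a.
  apply: (@subclosed_compact _ _ `[- K, K]%classic).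
  - rewrite (_ : mkset _ = ~` (I @^-1` [set y | (a%:E < y)%E])).
      apply: open_closedC; rewrite openE => x /= aIx.
      by have [V Vx VI] := lsc x a aIx; exact: filterS Vx.
    by apply/seteqP; split => x /=; rewrite leNgt => /negP.
  - exact: segment_compact.
  - by move=> x /IK; rewrite /= in_itv/= ltr_norml => /andP[/ltW-> /ltW->].
split=> //; first exact: local_ldp_ge0 ldp.
case: ldp => L U Ti G mG u; have mE n : measurable (eta n @^-1` G).
  by rewrite -[X in measurable X]setTI; exact: me.
have su : \forall n \near \oo, forall a : R,
    (((- a)%:E <= u n)%E = ((expR (- (s n * a)))%:E <= P n (eta n @^-1` G))%E) *
    ((u n <= (- a)%:E)%E = (P n (eta n @^-1` G) <= (expR (- (s n * a)))%:E)%E).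
  apply: filterS (speed_gt0 sy) => n sn a.
  by rewrite /u scaled_lne_ge// scaled_lne_le.
split; last 2 first.
- exact: limn_einf_sup.
- rewrite leNgt; apply/negP => /ereal_between[a []].
  rewrite lteNl -EFinN => /ereal_between[b [ab bI]] aL.
  have [K TK] := Ti b.
  have small : exp_small P s b (fun n => eta n @^-1` (closure G `&` `[- K, K])).
    apply: (@compact_ideal _ _ (fun N => exp_small P s b (fun n => eta n @^-1` N))).
    - apply: (@subclosed_compact _ _ `[- K, K]%classic) => //.
      + by apply: closedI; [exact: closed_closure|exact: itv_closed].
      + exact: segment_compact.
    - by apply: exp_small_sub (exp_small0 P s b) => n x.
    - by move=> A B AB; apply: exp_small_sub => n x /AB.
    - by move=> A B sA sB; apply: exp_small_sub (exp_smallU sA sB) => n x.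
    - move=> x [Gx _].
      have /U[r r0 Pr] : (b%:E < I x)%E.
        by apply: lt_le_trans bI _; apply: ereal_inf_lbound; exists x.
      exists (ball x r); first exact: nbhsx_ballx.
      apply: exp_small_sub (exp_small_measurable _ Pr) => [n w|n].
        by rewrite /ball/= distrC.
      exact: measurable_ballE.
  have smallG : exp_small P s b (fun n => eta n @^-1` G).
    have mT n : measurable [set w | (K <= `|eta n w|)%R] by exact: measurable_tailE.
    apply: exp_small_sub (exp_smallU small (exp_small_measurable mT TK)) => n w Gw.
    have [wK|Kw] := ltP `|eta n w| K; [left|by right].
    split; first exact: subset_closure.
    by move: wK; rewrite /= in_itv/= ltr_norml => /andP[/ltW-> /ltW->].
  move: aL; apply/negP; rewrite -leNgt; apply: limn_esup_le.
  have ab' : - a < b by rewrite -lte_fin.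
  have := exp_small_le sy mE ab' smallG.
  by apply: filterS2 su => n /(_ (- a))[_]; rewrite opprK => ->.
- rewrite leeNl; apply: le_ereal_inf_tmp => _ [x Gx <-].
  rewrite leNgt; apply/negP => /ereal_between[a [Ia]].
  rewrite lteNr; apply/negP; rewrite -leNgt.
  apply: limn_einf_ge; rewrite -EFinN.
  have [r /= r0 xrG] : nbhs x G by [].
  have := L x r a r0 Ia.
  apply: filterS2 su => n /(_ a)[-> _] /le_trans; apply.
  apply: le_measure; rewrite ?inE//; first exact: measurable_ballE.
  by move=> w /= xw; apply: xrG; rewrite /ball_/= distrC.
Qed.

(** Tightness comes from goodness: the level set at [a + 1] is bounded, so the upper bound on a
    closed set beyond it has a rate of at least [a + 1]. Ball bounds come from the principle applied
    to balls and from lower semicontinuity. *)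
Lemma LDP_GRF_local_ldp eta s I : (forall n, measurable_fun setT (eta n)) ->
  LDP_GRF P eta s I -> local_ldp P eta s I.
Proof.
move=> me [[[s0 sy] I0 lsc ldp] grf].
have P0 n A : (0 <= P n A)%E by exact: measure_ge0.
have sn := speed_gt0 sy.
split.
- move=> x r a r0 Ia.
  have mB : measurable (ball x r) by exact: measurable_ball.
  have [/= lb _ _] := ldp _ mB.
  have : ((- a)%:E < limn_einf (fun n => (((s n)^-1)%:E *
      lne (P n (eta n @^-1` (ball x r))))%E))%E.
    apply: lt_le_trans lb; rewrite EFinN lteN2.
    apply: le_lt_trans Ia; apply: ereal_inf_lbound; exists x => //.
    exact: nbhsx_ballx.
  move=> /limn_einf_gt; apply: filterS2 sn => n sn /ltW.
  rewrite scaled_lne_ge//.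
  by under [X in P n X]eq_set => w do rewrite /ball/= distrC.
- move=> x a /ereal_between[b [ab bI]].
  have [V /nbhs_ballP[r /= r0 rV] VI] := lsc x b bI.
  (* The upper bound involves the closure of the ball, which at half the radius stays where [I]
     exceeds [b]. *)
  exists (r / 2); first by rewrite divr_gt0.
  have mB : measurable (ball x (r / 2)) by exact: measurable_ball.
  have [/= _ _ ub] := ldp _ mB.
  have : (limn_esup (fun n => (((s n)^-1)%:E *
      lne (P n (eta n @^-1` (ball x (r / 2)))))%E) < (- a)%:E)%E.
    apply: le_lt_trans ub _; rewrite EFinN lteN2.
    apply: lt_le_trans ab _; apply: le_ereal_inf_tmp => _ [y yx <-]; apply: ltW.
    have r2 : 0 < r / 2 by rewrite divr_gt0.
    apply/VI/rV; have [z [zx yz]] := yx (ball y (r / 2)) (nbhsx_ballx _ _ r2).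
    by rewrite (splitr r); apply: ball_triangle zx (ball_sym yz).
  move=> /limn_esup_lt; apply: filterS2 sn => n sn /ltW.
  rewrite scaled_lne_le//.
  by under [X in P n X]eq_set => w do rewrite /ball/= distrC.
- move=> a.
  have [M [_ /(_ (M + 1))]] := compact_bounded (grf (a + 1)).
  rewrite ltrDl ltr01 => /(_ isT) IM.
  exists (M + 2).
  pose F : set R := [set x | M + 2 <= `|x|].
  have cF : closed F.
    by apply: (@preimage_closed _ _ (fun x : R => `|x|)
      [set x | M + 2 <= x]) => [x _|]; [exact: norm_continuous|exact: closed_ge].
  have mF : measurable F by exact: closed_measurable.
  have [/= _ _ ub] := ldp _ mF.
  have : (limn_esup (fun n => (((s n)^-1)%:E *
      lne (P n (eta n @^-1` F)))%E) < (- a)%:E)%E.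
    apply: le_lt_trans ub _; rewrite EFinN lteN2.
    apply: (@lt_le_trans _ _ (a + 1)%:E); first by rewrite lte_fin ltrDl.
    apply: le_ereal_inf_tmp => _ [y + <-].
    rewrite -(closure_id F).1// => Fy; apply: ltW; rewrite ltNge; apply/negP => /IM yM.
    have {}yM : `|y| <= M + 1 := yM; have {}Fy : M + 2 <= `|y| := Fy.
    lra.
  move=> /limn_esup_lt; apply: filterS2 sn => n sn /ltW.
  by rewrite scaled_lne_le.
Qed.

End local_ldp_theory.

(** * Change of speed and products of independent variables *)

(** The rate function of superexponential concentration at [x0]: any deviation costs more than every
    multiple of the speed. *)
Definition chi_rate (R : realType) (x0 x : R) : \bar R :=
  if x == x0 then 0%E else +oo%E.

Section local_ldp_transforms.
Context (R : realType) (d : nat -> measure_display).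
Context (T : forall n, measurableType (d n)) (P : forall n, probability (T n) R).
Implicit Types (eta : forall n, T n -> R) (s : nat -> R) (I : R -> \bar R).

Lemma measurable_off_ballE eta n x r : measurable_fun setT (eta n) ->
  measurable [set w | (r <= `|eta n w - x|)%R].
Proof.
move=> me; rewrite (_ : mkset _ = ~` [set w | (`|eta n w - x| < r)%R]).
  by apply: measurableC; exact: measurable_ballE.
by apply/seteqP; split => w /=; rewrite leNgt => /negP.
Qed.

(** Removing a ball around [x0] from a segment leaves a compact set of points where every rate [a]
    is available, so finitely many balls cover it; tightness handles the outside. *)
Lemma off_ball_exp_small eta s (x0 : R) : s n @[n --> \oo] --> +oo ->
  (forall n, measurable_fun setT (eta n)) ->
  (forall x a : R, x != x0 -> exists2 r : R, 0 < r &
        \forall n \near \oo,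
        (P n [set w | (`|eta n w - x| < r)%R] <= (expR (- (s n * a)))%:E)%E) ->
  (forall a : R, exists K : R, \forall n \near \oo,
        (P n [set w | (K <= `|eta n w|)%R] <= (expR (- (s n * a)))%:E)%E) ->
  forall r a : R, 0 < r -> \forall n \near \oo,
    (P n [set w | (r <= `|eta n w - x0|)%R] <= (expR (- (s n * a)))%:E)%E.
Proof.
move=> sy me U Ti r a r0.
have mE n : measurable [set w | (r <= `|eta n w - x0|)%R].
  exact: measurable_off_ballE.
apply: (@exp_small_le _ _ _ P _ (a + 1)) => //; first by rewrite ltrDl.
have [K TK] := Ti (a + 1).
pose F : set R := [set x | r <= `|x - x0|].
have small : exp_small P s (a + 1) (fun n => eta n @^-1` (F `&` `[- K, K])).
  apply: (@compact_ideal _ _ (fun N => exp_small P s (a + 1) (fun n => eta n @^-1` N))).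
  - apply: (@subclosed_compact _ _ `[- K, K]%classic).
    + apply: closedI; last exact: itv_closed.
      apply: (@closed_comp _ _ (fun x : R => `|x - x0|) [set x | r <= x]).
        move=> x _; apply: (@continuous_comp _ _ _ (fun x => x - x0)).
          by apply: cvgB; [exact: cvg_id|exact: cvg_cst].
        exact: norm_continuous.
      exact: closed_ge.
    + exact: segment_compact.
    + by move=> x [].
  - by apply: exp_small_sub (exp_small0 P s _) => n x.
  - by move=> A B AB; apply: exp_small_sub => n x /AB.
  - by move=> A B sA sB; apply: exp_small_sub (exp_smallU sA sB) => n x.
  - move=> x [Fx _]; have xx0 : x != x0.
      apply/eqP => xx0; move: Fx; rewrite /F/= xx0 subrr normr0.
      by apply/negP; rewrite -ltNge.
    have [e e0 Pe] := U x (a + 1) xx0.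
    exists (ball x e); first exact: nbhsx_ballx.
    apply: exp_small_sub (exp_small_measurable _ Pe) => [n w|n].
      by rewrite /ball/= distrC.
    exact: measurable_ballE.
have mT n : measurable [set w | (K <= `|eta n w|)%R] by exact: measurable_tailE.
apply: exp_small_sub (exp_smallU small (exp_small_measurable mT TK)) => n w Fw.
have [wK|Kw] := ltP `|eta n w| K; [left|by right].
by split => //; move: wK; rewrite /= in_itv/= ltr_norml => /andP[/ltW-> /ltW->].
Qed.

Lemma off_ball_local_ldp_chi eta s (x0 : R) : s n @[n --> \oo] --> +oo ->
  (forall n, measurable_fun setT (eta n)) ->
  local_ldp P eta s (chi_rate x0) ->
  forall r a : R, 0 < r -> \forall n \near \oo,
    (P n [set w | (r <= `|eta n w - x0|)%R] <= (expR (- (s n * a)))%:E)%E.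
Proof.
move=> sy me [_ U Ti]; apply: off_ball_exp_small => // x a xx0.
by apply: U; rewrite /chi_rate (negbTE xx0) ltry.
Qed.

Lemma much_less_expR s (t : nat -> R) (a b : R) :
  s n @[n --> \oo] --> +oo -> t n @[n --> \oo] --> +oo ->
  much_less t s -> 0 < b ->
  \forall n \near \oo, expR (- (s n * b)) <= expR (- (t n * a)).
Proof.
move=> sy ty ts b0; have a1 : 0 < `|a| + 1 by rewrite ltr_wpDl.
have /cvgr0Pnorm_lt/(_ (b / (`|a| + 1))) := ts.
rewrite divr_gt0// => /(_ isT) ts'.
near=> n.
have sn : 0 < s n by near: n; exact: speed_gt0.
have tn : 0 < t n by near: n; exact: speed_gt0.
have : `|t n / s n| < b / (`|a| + 1) by near: n.
rewrite gtr0_norm ?divr_gt0// ltr_pdivrMr// ler_expR lerN2 => tb.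
apply: (@le_trans _ _ (t n * (`|a| + 1))).
  by rewrite ler_wpM2l//; [exact: ltW|have := ler_norm a; lra].
rewrite -ler_pdivlMr//; apply: (le_trans (ltW tb)).
by rewrite le_eqVlt; apply/orP; left; apply/eqP; ring.
Unshelve. all: by end_near. Qed.

(** A positive rate at speed [s] becomes infinite at the slower speed [t], since [s n * b]
    eventually exceeds [t n * a] for every [a]. Near [x0] the lower bound follows by complement. *)
Lemma local_ldp_slower eta s (t : nat -> R) I (x0 : R) :
  s n @[n --> \oo] --> +oo -> t n @[n --> \oo] --> +oo ->
  much_less t s -> (forall n, measurable_fun setT (eta n)) ->
  (forall x, x != x0 -> (0 < I x)%E) ->
  local_ldp P eta s I -> local_ldp P eta t (chi_rate x0).
Proof.
move=> sy ty ts me I0 [L U Ti].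
have U' (x a : R) : x != x0 -> exists2 r : R, 0 < r &
    \forall n \near \oo,
    (P n [set w | (`|eta n w - x| < r)%R] <= (expR (- (t n * a)))%:E)%E.
  move=> xx0; have [b [b0 bI]] := ereal_between (I0 x xx0).
  have [r r0 Ur] := U x b bI; exists r => //.
  rewrite lte_fin in b0; have := much_less_expR a sy ty ts b0.
  by apply: filterS2 Ur => n /le_trans h1 h2; apply: h1; rewrite lee_fin.
have T' (a : R) : exists K : R, \forall n \near \oo,
    (P n [set w | (K <= `|eta n w|)%R] <= (expR (- (t n * a)))%:E)%E.
  have [K TK] := Ti 1; exists K.
  have := much_less_expR a sy ty ts ltr01.
  by apply: filterS2 TK => n /le_trans h1 h2; apply: h1; rewrite lee_fin.
split=> //.
- move=> x r a r0; rewrite /chi_rate; case: eqVneq => [->|//].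
  rewrite lte_fin => a0.
  have off := off_ball_exp_small ty me U' T' 1 r0.
  (* The factor 2 makes each of the two exponentials at most 1/2, so that the mass off the ball and
     the claimed lower bound add up to at most 1. *)
  have e1 := expR_absorb 2 ty ltr01.
  have e2 := expR_absorb 2 ty a0.
  near=> n.
  rewrite (_ : mkset _ = ~` [set w | (r <= `|eta n w - x0|)%R]); last first.
    by apply/seteqP; split => w /=; rewrite ltNge => /negP.
  rewrite probability_setC; last exact: measurable_off_ballE.
  have offn : (P n [set w | (r <= `|eta n w - x0|)%R] <=
    (expR (- (t n * 1)))%:E)%E by near: n.
  rewrite leeBrDr ?fin_num_measure//; last exact: measurable_off_ballE.
  apply: (le_trans (leeD2l _ offn)); rewrite -EFinD lee_fin.
  have : 2 * expR (- (t n * 1)) <= expR (- (t n * 0)) by near: n.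
  have : 2 * expR (- (t n * a)) <= expR (- (t n * 0)) by near: n.
  rewrite mulr0 oppr0 expR0; lra.
- move=> x a; rewrite /chi_rate; case: eqVneq => [->|xx0 _]; last exact: U'.
  rewrite lte_fin => a0; exists 1 => //.
  apply: filterS (speed_gt0 ty) => n tn.
  apply: (@le_trans _ _ 1%E).
    by apply: probability_le1; exact: measurable_ballE.
  by rewrite lee_fin -[X in X <= _]expR0 ler_expR oppr_ge0 pmulr_rle0// ltW.
Unshelve. all: by end_near. Qed.

Lemma local_ldp_congr (d' : nat -> measure_display)
    (T' : forall n, measurableType (d' n)) (P' : forall n, probability (T' n) R)
    eta (eta' : forall n, T' n -> R) s I :
  (\forall n \near \oo, forall B : set R, measurable B ->
    P n (eta n @^-1` B) = P' n (eta' n @^-1` B)) ->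
  local_ldp P eta s I -> local_ldp P' eta' s I.
Proof.
move=> same [L U Ti].
have sameb : \forall n \near \oo, forall x r,
    P n [set w | (`|eta n w - x| < r)%R] = P' n [set w | (`|eta' n w - x| < r)%R].
  apply: filterS same => n sn x r.
  have mB : measurable (ball x r) by exact: measurable_ball.
  have := sn _ mB; rewrite /ball/= /ball_.
  by under [X in P n X = P' n _ -> _]eq_set => w do rewrite distrC;
     under [X in _ = P' n X -> _]eq_set => w do rewrite distrC.
have samet : \forall n \near \oo, forall K,
    P n [set w | (K <= `|eta n w|)%R] = P' n [set w | (K <= `|eta' n w|)%R].
  apply: filterS same => n sn K.
  have mF : measurable [set x : R | K <= `|x|].
    exact: (@measurable_tailE _ (fun=> _) (fun=> R) (fun=> id) 0%N).
  exact: sn _ mF.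
split.
- by move=> x r a r0 /(L x r a r0); apply: filterS2 sameb => n ->.
- move=> x a /U[r r0 Ur]; exists r => //.
  by apply: filterS2 sameb Ur => n ->.
- by move=> a; have [K TK] := Ti a; exists K; apply: filterS2 samet TK => n ->.
Qed.

End local_ldp_transforms.

(** * Products of independent factors, and division by a factor close to 1 *)

Section local_ldp_product.
Context (R : realType) (d : nat -> measure_display).
Context (T : forall n, measurableType (d n)) (P : forall n, probability (T n) R).
Implicit Types (s : nat -> R) (I : R -> \bar R).

Lemma nbhs_ball_prod (x y r1 r2 : R) : 0 < r1 -> 0 < r2 ->
  nbhs (x, y) [set z : R * R | `|z.1 - x| < r1 /\ `|z.2 - y| < r2].
Proof.
move=> r10 r20; exists (ball x r1, ball y r2).
  by split; exact: nbhsx_ballx.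
by move=> z [/=]; rewrite /ball/= ![`|_ - z.1|]distrC ![`|_ - z.2|]distrC.
Qed.

Lemma mul_near (x y r : R) : 0 < r -> exists2 e : R, 0 < e &
  forall x' y', `|x' - x| < e -> `|y' - y| < e -> `|x' * y' - x * y| < r.
Proof.
move=> r0; pose e := Num.min 1 (r / (`|x| + `|y| + 1)).
have M0 : 0 < `|x| + `|y| + 1 by rewrite ltr_wpDl// addr_ge0.
have e0 : 0 < e by rewrite lt_min ltr01 divr_gt0.
have e1 : e <= 1 by rewrite ge_min lexx.
have eM : e * (`|x| + `|y| + 1) <= r by rewrite -ler_pdivlMr// ge_min lexx orbT.
exists e => // x' y' xe ye.
have -> : x' * y' - x * y = (x' - x) * y + x * (y' - y) + (x' - x) * (y' - y).
  by ring.
apply: (@lt_le_trans _ _ (e * (`|x| + `|y| + 1))) => //.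
apply: (@le_lt_trans _ _ (`|x' - x| * `|y| + `|x| * `|y' - y| +
    `|x' - x| * `|y' - y|)).
  rewrite -!normrM; apply: le_trans (ler_normD _ _) _; rewrite lerD2r.
  exact: ler_normD.
have h1 : `|x' - x| * `|y| <= e * `|y| by rewrite ler_wpM2r// ltW.
have h2 : `|x| * `|y' - y| <= e * `|x| by rewrite mulrC ler_wpM2r// ltW.
have h3 : `|x' - x| * `|y' - y| < e.
  have [->|h] := eqVneq `|y' - y| 0; first by rewrite mulr0.
  apply: (@lt_le_trans _ _ (e * `|y' - y|)).
    by rewrite ltr_pM2r// lt_def h/=.
  by rewrite ler_piMr; lra.
lra.
Qed.

Lemma ereal_split_lt (x y : \bar R) (a : R) : (0 <= x)%E -> (0 <= y)%E ->
  (a%:E < x + y)%E -> exists a1 a2 : R,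
    [/\ (a1%:E < x)%E, (a2%:E < y)%E & a <= a1 + a2].
Proof.
case: x y => [x| |] [y| |] //= x0 y0 axy; rewrite ?lee_fin in x0 y0.
- rewrite lte_fin in axy.
  exists (x - (x + y - a) / 2), (y - (x + y - a) / 2).
  by rewrite !lte_fin; split; lra.
- exists (x - 1), (a - x + 1); rewrite lte_fin ltry; split=> //; lra.
- exists (a - y + 1), (y - 1); rewrite lte_fin ltry; split=> //; lra.
- by exists a, 0; rewrite !ltry; split=> //; lra.
Qed.

Lemma ereal_split_gt (x y : \bar R) (a : R) : (0 <= x)%E -> (0 <= y)%E ->
  (x + y < a%:E)%E -> exists a1 a2 : R,
    [/\ (x < a1%:E)%E, (y < a2%:E)%E & a1 + a2 = a].
Proof.
case: x y => [x| |] [y| |] //= x0 y0; rewrite ?lee_fin in x0 y0.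
rewrite lte_fin => axy.
exists (x + (a - x - y) / 2), (y + (a - x - y) / 2).
by rewrite !lte_fin; split; lra.
Qed.

(** Lower bound: [Ige] supplies a nearly optimal factorization of [z], and the two balls around its
    factors multiply by independence. Upper bound: by [Ile] every factorization costs at least
    [I z], and compactness of a square of pairs leaves finitely many factorizations to consider. *)
Lemma local_ldp_prod (V W : forall n, T n -> R) s (IV IW I : R -> \bar R) :
  s n @[n --> \oo] --> +oo ->
  (forall n, measurable_fun setT (V n)) ->
  (forall n, measurable_fun setT (W n)) ->
  (\forall n \near \oo, independent_rv (P n) (V n) (W n)) ->
  (forall v w : R, (I (v * w)%R <= IV v + IW w)%E) ->
  (forall z a, (I z < a%:E)%E -> exists v w : R, v * w = z /\ (IV v + IW w < a%:E)%E) ->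
  local_ldp P V s IV -> local_ldp P W s IW ->
  local_ldp P (fun n w => V n w * W n w) s I.
Proof.
move=> sy mV mW ind Ile Ige ldpV ldpW.
have IV0 := local_ldp_ge0 sy mV ldpV.
have IW0 := local_ldp_ge0 sy mW ldpW.
case: ldpV => LV UV TV; case: ldpW => LW UW TW.
have indb : \forall n \near \oo, forall v w r1 r2,
    P n ([set t | (`|V n t - v| < r1)%R] `&` [set t | (`|W n t - w| < r2)%R]) =
    (P n [set t | (`|V n t - v| < r1)%R] * P n [set t | (`|W n t - w| < r2)%R])%E.
  apply: filterS ind => n indn v w r1 r2.
  have E (U : T n -> R) u r :
      [set t | (`|U t - u| < r)%R] = U @^-1` (ball u r).
    by apply/seteqP; split => t; rewrite /ball/= distrC.
  by rewrite !E; apply: indn; exact: measurable_ball.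
have mVW n : measurable_fun setT (fun w => V n w * W n w) by exact: measurable_funM.
have mprod n z r : measurable [set t | (`|V n t * W n t - z| < r)%R].
  exact: (@measurable_ballE _ _ _ (fun n t => V n t * W n t)).
have tail (a : R) : exists2 K : R, 0 < K &
    exp_small P s a (fun n => [set t | (K <= `|V n t|)%R] `|`
      [set t | (K <= `|W n t|)%R]).
  have [K1 TK1] := TV a; have [K2 TK2] := TW a.
  exists (Num.max 1 (Num.max K1 K2)); first by rewrite lt_max ltr01.
  apply: exp_smallU.
  - apply: exp_small_sub (exp_small_measurable _ TK1) => [n t /=|n].
      by rewrite !ge_max => /and3P[].
    exact: measurable_tailE.
  - apply: exp_small_sub (exp_small_measurable _ TK2) => [n t /=|n].
      by rewrite !ge_max => /and3P[].
    exact: measurable_tailE.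
split.
- move=> z r a r0 /Ige[v [w [<- /ereal_split_gt]]].
  move=> /(_ (IV0 v) (IW0 w))[a1 [a2 [va1 wa2 a12]]].
  have [e e0 eP] := mul_near v w r0.
  near=> n.
  apply: (@le_trans _ _ (P n ([set t | (`|V n t - v| < e)%R] `&`
      [set t | (`|W n t - w| < e)%R]))); last first.
    apply: le_measure; rewrite ?inE//.
    + by apply: measurableI; exact: measurable_ballE.
    + by move=> t [/= ? ?]; exact: eP.
  rewrite (near indb n)// -a12 mulrDr opprD expRD EFinM.
  apply: lee_pmul; rewrite ?lee_fin ?expR_ge0//; near: n.
    exact: LV.
  exact: LW.
- move=> z a /ereal_between[b [ab bI]].
  have [K K0 TK] := tail b.
  (* Each region of pairs may choose its own radius around [z]; a union takes the smaller of two
     radii, so one radius survives the covering argument. *)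
  pose Id (N : set (R * R)) := exists2 r : R, 0 < r & exp_small P s b (fun n =>
    [set t | N (V n t, W n t) /\ (`|V n t * W n t - z| < r)%R]).
  have [r r0 small] : Id (`[- K, K] `*` `[- K, K]).
    apply: compact_ideal.
    - by apply: compact_setX; exact: segment_compact.
    - exists 1 => //; apply: exp_small_sub (exp_small0 P s b) => n t.
      by case.
    - move=> A B AB [r r0 sB]; exists r => //.
      by apply: exp_small_sub sB => n t [/AB].
    - move=> A B [r1 r10 sA] [r2 r20 sB]; exists (Num.min r1 r2).
        by rewrite lt_min r10.
      apply: exp_small_sub (exp_smallU sA sB) => n t [AB].
      by rewrite lt_min => /andP[h1 h2]; case: AB => ?; [left|right].
    - move=> [v w] _; have [vwz|vwz] := eqVneq (v * w) z.
        move: bI; rewrite -vwz => /lt_le_trans/(_ (Ile v w)).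
        move=> /(ereal_split_lt (IV0 v) (IW0 w))[a1 [a2 [a1v a2w b12]]].
        have [r1 r10 P1] := UV v a1 a1v.
        have [r2 r20 P2] := UW w a2 a2w.
        exists [set u | `|u.1 - v| < r1 /\ `|u.2 - w| < r2].
          exact: nbhs_ball_prod.
        exists 1 => //.
        have mA n : measurable ([set t | (`|V n t - v| < r1)%R] `&`
            [set t | (`|W n t - w| < r2)%R]).
          by apply: measurableI; exact: measurable_ballE.
        apply: exp_small_sub (exp_small_measurable mA _) => [n t [[]]//|].
        near=> n; rewrite (near indb n)//.
        apply: (@le_trans _ _ (expR (- (s n * a1)) * expR (- (s n * a2)))%:E).
          by rewrite EFinM; apply: lee_pmul => //; near: n.
        rewrite lee_fin -expRD ler_expR -opprD lerN2 -mulrDr ler_wpM2l//.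
        by apply: ltW; near: n; exact: speed_gt0.
      (* Near a pair whose product is not [z], the product stays away from [z], and the event is
         empty once the radius is small. *)
      have r0 : 0 < `|v * w - z| / 2 by rewrite divr_gt0// normr_gt0 subr_eq0.
      have [e e0 eP] := mul_near v w r0.
      exists [set u | `|u.1 - v| < e /\ `|u.2 - w| < e].
        exact: nbhs_ball_prod.
      exists (`|v * w - z| / 2) => //.
      apply: exp_small_sub (exp_small0 P s b) => n t /= [[ve we] vwr].
      have := eP _ _ ve we; have : `|v * w - z| <=
          `|V n t * W n t - z| + `|V n t * W n t - v * w|.
        rewrite (_ : v * w - z = (V n t * W n t - z) - (V n t * W n t - v * w)).
          exact: ler_normB.
        by ring.
      move: vwr; lra.
  exists r => //; apply: exp_small_le sy _ ab _ => //.
  apply: exp_small_sub (exp_smallU small TK) => n t /= tr.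
  have [VK|VK] := ltP `|V n t| K; last by right; left.
  have [WK|WK] := ltP `|W n t| K; last by right; right.
  left; split => //; split; rewrite /= in_itv/=.
    by move: VK; rewrite ltr_norml => /andP[/ltW-> /ltW->].
  by move: WK; rewrite ltr_norml => /andP[/ltW-> /ltW->].
- move=> a; have [K K0 TK] := tail (a + 1); exists (K * K).
  have aa : a < a + 1 by rewrite ltrDl.
  apply: exp_small_le sy _ aa _ => [n|].
    exact: (@measurable_tailE _ _ _ (fun n t => V n t * W n t)).
  apply: exp_small_sub TK => n t /=; rewrite normrM => KVW.
  have [VK|VK] := ltP `|V n t| K; last by left.
  have [WK|WK] := ltP `|W n t| K; last by right.
  exfalso; move: KVW; apply/negP; rewrite -ltNge.
  by apply: ltr_pM.
Unshelve. all: by end_near. Qed.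

Context (d' d'' : nat -> measure_display).
Context (T' : forall n, measurableType (d' n)) (P' : forall n, probability (T' n) R).
Context (T'' : forall n, measurableType (d'' n)).
Context (P'' : forall n, probability (T'' n) R).

(* Since [rho] is close to 1 with superexponentially high probability, a large
   deviation principle for the independent product [rho * W] passes to [W]. *)
Lemma local_ldp_divide (W : forall n, T n -> R) (rho : forall n, T' n -> R)
    (G : forall n, T'' n -> R) s I : s n @[n --> \oo] --> +oo ->
  (forall n, measurable_fun setT (W n)) ->
  (forall n, measurable_fun setT (rho n)) ->
  (\forall n \near \oo, forall B : set R, measurable B ->
     P'' n (G n @^-1` B) =
     (P n \x P' n)%E [set z | B (rho n z.2 * W n z.1)%R]) ->
  local_ldp P' rho s (chi_rate 1) -> local_ldp P'' G s I -> local_ldp P W s I.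
Proof.
move=> sy mW mrho GE ldprho [L U Ti].
have off := off_ball_local_ldp_chi sy mrho ldprho.
case: ldprho => Lrho _ _.
have s0 := speed_gt0 sy.
have mrW n : measurable_fun setT (fun z : T n * T' n => rho n z.2 * W n z.1).
  apply: measurable_funM.
    exact: measurableT_comp (mrho n) measurable_snd.
  exact: measurableT_comp (mW n) measurable_fst.
have mpre n (B : set R) : measurable B ->
    measurable [set z : T n * T' n | B (rho n z.2 * W n z.1)%R].
  by move=> mB; rewrite -[X in measurable X]setTI; exact: mrW.
have mball (x r : R) : measurable [set y : R | (`|y - x| < r)%R].
  exact: (@measurable_ballE _ (fun=> _) (fun=> R) (fun=> id) 0%N).
have mtail (K : R) : measurable [set y : R | (K <= `|y|)%R].
  exact: (@measurable_tailE _ (fun=> _) (fun=> R) (fun=> id) 0%N).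
(* A bound on [P''] of [G] in [B] yields one on [W] in [A] whenever
   [rho] close to 1 and [W] in [A] force [rho * W] in [B]. *)
have transfer (A : forall n, set (T n)) (B : set R) (e a b : R) :
    (forall n, measurable (A n)) -> measurable B -> 0 < e -> a < b ->
    (forall n w w', A n w -> `|rho n w' - 1| < e -> B (rho n w' * W n w)) ->
    (\forall n \near \oo, (P'' n (G n @^-1` B) <= (expR (- (s n * b)))%:E)%E) ->
    \forall n \near \oo, (P n (A n) <= (expR (- (s n * a)))%:E)%E.
  move=> mA mB e0 ab AB PB; near=> n.
  have sn : 0 < s n by near: n.
  have PBn : (P'' n (G n @^-1` B) <= (expR (- (s n * b)))%:E)%E by near: n.
  (* Since [chi_rate 1] vanishes at 1, this probability loses only the rate [b - a]; dividing by it
     turns the rate [b] into [a]. *)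
  have lower : ((expR (- (s n * (b - a))))%:E <=
      P' n [set w' | (`|rho n w' - 1| < e)%R])%E.
    near: n; apply: Lrho => //.
    by rewrite /chi_rate eqxx lte_fin subr_gt0.
  have mE : measurable [set w' | (`|rho n w' - 1| < e)%R].
    exact: measurable_ballE.
  have prodle : (P n (A n) * P' n [set w' | (`|rho n w' - 1| < e)%R] <=
      (expR (- (s n * b)))%:E)%E.
    rewrite -product_measure1E//.
    apply: le_trans PBn; rewrite (near GE n)//; apply: le_measure.
    - by rewrite inE; exact: measurableX.
    - by rewrite inE; exact: mpre.
    - by move=> [w w'] [/= Aw ew']; exact: AB.
  have prodle' : (P n (A n) * (expR (- (s n * (b - a))))%:E <=
      (expR (- (s n * b)))%:E)%E.
    by apply: le_trans prodle; exact: lee_wpmul2l.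
  move: prodle'; rewrite -lee_pdivlMr ?expR_gt0// => /le_trans; apply.
  rewrite lee_fin -expRN -expRD ler_expR le_eqVlt; apply/orP; left.
  by apply/eqP; ring.
split.
- move=> x r a r0 /ereal_between[a' [Ia' a'a]]; rewrite lte_fin in a'a.
  have r4 : 0 < r / 4 by rewrite divr_gt0.
  (* The bound 1/2 gives [|W| <= 2 |rho * W|]; the other one then makes the error [|rho - 1| |W|] at
     most [r / 4]. *)
  pose e := Num.min (1 / 2) (r / 4 / (2 * (`|x| + r / 4))).
  have M0 : 0 < 2 * (`|x| + r / 4) by rewrite mulr_gt0// ltr_wpDl.
  have e0 : 0 < e by rewrite lt_min !divr_gt0.
  have e1 : e <= 1 / 2 by rewrite ge_min lexx.
  have eM : e * (2 * (`|x| + r / 4)) <= r / 4.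
    by rewrite -ler_pdivlMr// ge_min lexx orbT.
  have key n w w' : `|rho n w' * W n w - x| < r / 4 -> `|rho n w' - 1| < e ->
      `|W n w - x| < r.
    set p := rho n w'; set v := W n w => pvx pe.
    have p12 : 1 / 2 <= p by move: pe; rewrite ltr_norml; lra.
    have pv : `|p * v| <= `|x| + r / 4.
      rewrite (_ : p * v = (p * v - x) + x); last by ring.
      by apply: le_trans (ler_normD _ _) _; lra.
    have v2 : `|v| <= 2 * (`|x| + r / 4).
      move: pv; rewrite normrM (ger0_norm (_ : 0 <= p)); last by lra.
      move=> pv; have : 1 / 2 * `|v| <= p * `|v| by rewrite ler_wpM2r.
      lra.
    rewrite (_ : v - x = (p * v - x) - (p - 1) * v); last by ring.
    apply: le_lt_trans (ler_normB _ _) _; rewrite normrM.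
    have : `|p - 1| * `|v| <= r / 4.
      by apply: le_trans eM; rewrite ler_pM// ltW.
    lra.
  have Ln := L x (r / 4) a' r4 Ia'.
  have offn := off e (a' + 1) e0.
  have ex1 := expR_absorb 2 sy a'a.
  have a1 : a' < a' + 1 by rewrite ltrDl.
  have ex2 := expR_absorb 2 sy a1.
  near=> n.
  have mA : measurable [set w | (`|W n w - x| < r)%R] by exact: measurable_ballE.
  have mB : measurable [set w' | (e <= `|rho n w' - 1|)%R].
    exact: measurable_off_ballE.
  (* If [rho * W] is near [x], either [W] is near [x] or [rho] is off 1. The latter has rate
     [a' + 1], hence is negligible against the left-hand side. *)
  have le1 : ((expR (- (s n * a')))%:E <=
      P n [set w | (`|W n w - x| < r)%R] + P' n [set w' | (e <= `|rho n w' - 1|)%R])%E.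
    apply: (@le_trans _ _ (P'' n [set w | (`|G n w - x| < r / 4)%R])).
      by near: n.
    rewrite ((near GE n) _ _ (mball x (r / 4)))//.
    apply: (@le_trans _ _ ((P n \x P' n)%E
      (([set w | (`|W n w - x| < r)%R] `*` setT) `|`
       (setT `*` [set w' | (e <= `|rho n w' - 1|)%R])))).
      apply: le_measure; rewrite ?inE.
      - exact: mpre (mball _ _).
      - by apply: measurableU; exact: measurableX.
      - move=> [w w'] /= h; have [h'|h'] := ltP `|rho n w' - 1| e; last by right.
        by left; split => //; exact: key h h'.
    have E1 : (P n \x P' n)%E ([set w | (`|W n w - x| < r)%R] `*` setT) =
        P n [set w | (`|W n w - x| < r)%R].
      rewrite product_measure1E// -[RHS]mule1; congr (_ * _)%E.
      exact: probability_setT.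
    have E2 : (P n \x P' n)%E (setT `*` [set w' | (e <= `|rho n w' - 1|)%R]) =
        P' n [set w' | (e <= `|rho n w' - 1|)%R].
      rewrite product_measure1E// -[RHS]mul1e; congr (_ * _)%E.
      exact: probability_setT.
    by rewrite -[in leRHS]E1 -[in leRHS]E2; apply: measureU2; exact: measurableX.
  have offn' : (P' n [set w' | (e <= `|rho n w' - 1|)%R] <=
    (expR (- (s n * (a' + 1))))%:E)%E by near: n.
  have := le_trans le1 (leeD2l _ offn').
  rewrite -leeBlDr// => /(le_trans _); apply.
  rewrite -EFinB lee_fin.
  have : 2 * expR (- (s n * a)) <= expR (- (s n * a')) by near: n.
  have : 2 * expR (- (s n * (a' + 1))) <= expR (- (s n * a')) by near: n.
  lra.
- move=> x a /ereal_between[b [ab bI]]; rewrite lte_fin in ab.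
  have [r r0 Ur] := U x b bI.
  exists (r / 4); first by rewrite divr_gt0.
  pose e := r / 4 / (`|x| + r / 4).
  have M0 : 0 < `|x| + r / 4 by rewrite ltr_wpDl// divr_gt0.
  have e0 : 0 < e by rewrite !divr_gt0.
  have eM : e * (`|x| + r / 4) = r / 4 by rewrite divfK// gt_eqF.
  apply: (transfer _ _ e a b _ (mball x r)) => // [n|n w w' /= Wx pe].
    exact: measurable_ballE.
  have Wle : `|W n w| <= `|x| + r / 4.
    rewrite (_ : W n w = (W n w - x) + x); last by ring.
    by apply: le_trans (ler_normD _ _) _; lra.
  rewrite (_ : _ - x = (W n w - x) + (rho n w' - 1) * W n w); last by ring.
  apply: le_lt_trans (ler_normD _ _) _; rewrite normrM.
  have : `|rho n w' - 1| * `|W n w| <= r / 4.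
    by rewrite -eM ler_pM// ltW.
  lra.
- move=> a; have [K TK] := Ti (a + 1).
  exists (2 * `|K|).
  apply: (transfer _ _ (1 / 2) a (a + 1) _ (mtail K)) => // [n||n w w' /= KW pe].
  - exact: measurable_tailE.
  - by rewrite ltrDl.
  - have p12 : 1 / 2 <= rho n w' by move: pe; rewrite ltr_norml; lra.
    rewrite normrM (ger0_norm (_ : 0 <= rho n w')); last by lra.
    have : 1 / 2 * `|W n w| <= rho n w' * `|W n w| by rewrite ler_wpM2r.
    have := ler_norm K; lra.
Unshelve. all: by end_near. Qed.
End local_ldp_product.

(** * Gaussian vectors and rotations *)

Section lebesgue_affine.
Context (R : realType).
Local Notation mu := (@lebesgue_measure R).

Lemma measurable_affine (a b : R) :
  @measurable_fun _ _ (measurableTypeR R) (measurableTypeR R) setT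
    (fun x : R => a * x + b).
Proof.
by apply: measurable_funD => //; exact: measurable_funM.
Qed.

(** The rescaled image measure agrees with Lebesgue measure on half-open intervals, which determines
    it. For [a < 0] the preimage has its closed end on the other side, with the same length. *)
Lemma lebesgue_measure_affine (a b : R) (A : set (measurableTypeR R)) :
  a != 0 -> measurable A ->
  (mu A = `|a|%:E * mu ((fun x => a * x + b)%R @^-1` A))%E.
Proof.
move=> a0 mA; have na : 0 <= `|a| by [].
pose f (x : measurableTypeR R) : measurableTypeR R := a * x + b.
pose pm : {measure set (measurableTypeR R) -> \bar R} := pushforward mu f.
pose nu : {measure set (measurableTypeR R) -> \bar R} := mscale (NngNum na)
  (pm (measurable_affine a b)).
rewrite (@lebesgue_measure_unique R nu)//.
move=> _ [[u v]] /= _ <-.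
rewrite /nu /mscale/= /pm /pushforward/=.
rewrite lebesgue_measure_itv/= lte_fin.
case: (ltrgtP a 0) a0 => // a0 _.
- rewrite (_ : _ @^-1` _ = `[(v - b) / a, (u - b) / a[%classic).
    rewrite lebesgue_measure_itv/= lte_fin ltr_nM2r ?invr_lt0// ltrD2r.
    case: ifP; rewrite ?mule0// => uv.
    by rewrite -!EFinD -EFinM ltr0_norm//; congr EFin; field; rewrite lt_eqF.
  apply/seteqP; split => x /=; rewrite !in_itv/= ler_ndivrMr// ltr_ndivlMr//;
  by rewrite andbC mulrC lerBrDr ltrBlDr.
- rewrite (_ : _ @^-1` _ = `](u - b) / a, (v - b) / a]%classic).
    rewrite lebesgue_measure_itv/= lte_fin ltr_pM2r ?invr_gt0// ltrD2r.
    case: ifP; rewrite ?mule0// => uv.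
    by rewrite -!EFinD -EFinM gtr0_norm//; congr EFin; field; rewrite gt_eqF.
  apply/seteqP; split => x /=; rewrite !in_itv/= ler_pdivlMr// ltr_pdivrMr//;
  by rewrite mulrC lerBrDr ltrBlDr.
Qed.
End lebesgue_affine.

Section gauss_density.
Context (R : realType).
Local Notation mu := (@lebesgue_measure R).

Lemma ge0_integral_affine (a b : R) (f : R -> \bar R) : a != 0 ->
  measurable_fun setT f -> (forall x, 0 <= f x)%E ->
  (\int[mu]_x f x = `|a|%:E * \int[mu]_x f (a * x + b)%R)%E.
Proof.
move=> a0 mf f0; have na : 0 <= `|a| by [].
pose g (x : measurableTypeR R) : measurableTypeR R := a * x + b.
have mg : measurable_fun setT g by exact: measurable_affine.
pose pm : {measure set (measurableTypeR R) -> \bar R} := pushforward mu g.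
have := @ge0_integral_pushforward _ _ _ _ R g mg mu setT f measurableT mf
  (fun y _ => f0 y).
rewrite preimage_setT => <-.
rewrite -(@ge0_integral_mscale _ _ _ (pm mg) setT measurableT (NngNum na))//.
by apply: eq_measure_integral => /= A mA _; exact: lebesgue_measure_affine.
Qed.

Definition gauss_pdf (x : R) : R := (Num.sqrt (2 * pi))^-1 * expR (- (x ^+ 2 / 2)).

Lemma normal_pdf01E : normal_pdf 0 1 = gauss_pdf.
Proof.
apply/funext => x; rewrite normal_pdfE ?oner_neq0// /gauss_pdf.
rewrite /normal_peak /normal_fun subr0 expr1n mul1r -mulr_natl.
by rewrite mulNr.
Qed.

Lemma gauss_pdf_gt0 x : 0 < gauss_pdf x.
Proof.
by rewrite /gauss_pdf mulr_gt0 ?expR_gt0// invr_gt0 sqrtr_gt0 mulr_gt0// pi_gt0.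
Qed.

Lemma measurable_gauss_pdf : measurable_fun setT gauss_pdf.
Proof. by rewrite -normal_pdf01E; exact: measurable_normal_pdf. Qed.

(** The Radon-Nikodym derivative of the normal law has the same integral as [gauss_pdf] over every
    measurable set, so the two agree almost everywhere. *)
Lemma ge0_integral_normal (f : R -> \bar R) :
  measurable_fun setT f -> (forall x, 0 <= f x)%E ->
  (\int[normal_prob 0 1]_x f x = \int[mu]_x (f x * (gauss_pdf x)%:E))%E.
Proof.
move=> mf f0; set nu := normal_prob 0 1.
pose h := Radon_Nikodym_SigmaFinite.f nu mu.
have dom : nu `<< mu by exact: normal_prob_dominates.
rewrite -(Radon_Nikodym_SigmaFinite.change_of_variables dom)//.
have hint := Radon_Nikodym_SigmaFinite.f_integrable dom.
have mpdf : measurable_fun setT (EFin \o gauss_pdf).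
  by apply/measurable_EFinP; exact: measurable_gauss_pdf.
apply: ge0_ae_eq_integral => //.
- by apply: emeasurable_funM => //; exact: measurable_int hint.
- exact: emeasurable_funM.
- by move=> x _; rewrite mule_ge0// Radon_Nikodym_SigmaFinite.f_ge0.
- by move=> x _; rewrite mule_ge0// lee_fin ltW// gauss_pdf_gt0.
- apply: ae_eqe_mul2l; apply: integral_ae_eq => // A AT mA.
  rewrite -Radon_Nikodym_SigmaFinite.f_integral//.
  by apply: eq_integral => x _; rewrite /= -normal_pdf01E.
Qed.

(* [normal_prob] lives on [measurableTypeR R]; this moves it to [R]. *)
Definition gauss_id (x : measurableTypeR R) : R := x.
Lemma measurable_gauss_id : measurable_fun setT gauss_id.
Proof. exact: measurable_id. Qed.
HB.instance Definition _ :=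
  isMeasurableFun.Build _ _ _ _ gauss_id measurable_gauss_id.

Definition gauss1 : probability R R := distribution (normal_prob 0 1) gauss_id.

Lemma ge0_integral_gauss1 (f : R -> \bar R) :
  measurable_fun setT f -> (forall x, 0 <= f x)%E ->
  (\int[gauss1]_x f x = \int[mu]_x (f x * (gauss_pdf x)%:E))%E.
Proof.
by move=> mf f0; rewrite ge0_integral_distribution// ge0_integral_normal.
Qed.

End gauss_density.

Section gauss_rotation.
Context (R : realType).
Local Notation g1 := (@gauss1 R).
Local Notation phi := (@gauss_pdf R).

Arguments gauss1 : simpl never.

Lemma measurable_gauss_pdfV : measurable_fun setT (fun x : R => (phi x)^-1).
Proof.
rewrite (_ : (fun _ => _) = fun x => phi x `^ (-1)).
  exact: (measurableT_comp (measurable_powR (-1)) (@measurable_gauss_pdf R)).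
by apply/funext => x; rewrite powR_inv1// ltW// gauss_pdf_gt0.
Qed.

(** The Lebesgue substitution with the density divided back out: both sides are integrals against
    the same probability, so Tonelli's theorem can be applied to [g1] between two substitutions. *)
Lemma ge0_integral_gauss1_affine (a b : R) (f : R -> \bar R) : a != 0 ->
  measurable_fun setT f -> (forall x, 0 <= f x)%E ->
  (\int[g1]_x f (a * x + b)%R =
   (`|a|^-1)%:E * \int[g1]_x (f x * (phi ((x - b) / a) / phi x)%:E))%E.
Proof.
move=> a0 mf f0.
have maff (c e : R) : measurable_fun setT (fun x : R => c * x + e).
  by apply: measurable_funD => //; exact: measurable_funM.
have mphi : measurable_fun setT phi by exact: measurable_gauss_pdf.
have mphia : measurable_fun setT (fun x : R => phi ((x - b) / a)).
  apply: measurableT_comp => //; apply: measurable_funM => //.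
  exact: measurable_funB.
have phi0 x : 0 < phi x by exact: gauss_pdf_gt0.
rewrite ge0_integral_gauss1//; last exact: measurableT_comp (maff a b).
rewrite ge0_integral_gauss1; first last.
- by move=> x; rewrite mule_ge0// lee_fin divr_ge0// ltW.
- apply: emeasurable_funM => //; apply/measurable_EFinP; apply: measurable_funM => //.
  exact: measurable_gauss_pdfV.
under [in RHS]eq_integral do rewrite -muleA -EFinM divfK ?gt_eqF//.
rewrite [in RHS](ge0_integral_affine b a0); first last.
- by move=> x; rewrite mule_ge0// lee_fin ltW.
- by apply: emeasurable_funM => //; apply/measurable_EFinP; exact: mphia.
rewrite muleA -EFinM mulVf ?normr_eq0// mul1e.
by apply: eq_integral => x _; rewrite addrK mulrAC divff// mul1r.
Qed.

Lemma ge0_integral_gauss1_sign (a : R) (f : R -> \bar R) : a ^+ 2 = 1 ->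
  measurable_fun setT f -> (forall x, 0 <= f x)%E ->
  (\int[g1]_x f (a * x)%R = \int[g1]_x f x)%E.
Proof.
move=> a2 mf f0; have a0 : a != 0.
  by apply/eqP => a0; move/eqP: a2; rewrite a0 expr0n/= eq_sym oner_eq0.
have -> : (\int[g1]_x f (a * x)%R = \int[g1]_x f (a * x + 0)%R)%E.
  by apply: eq_integral => x _; rewrite addr0.
rewrite ge0_integral_gauss1_affine//.
have /eqP := a2; rewrite sqrf_eq1 => /orP[]/eqP->;
  rewrite ?normrN normr1 invr1 mul1e; apply: eq_integral => x _.
  by rewrite subr0 mulr1 divff ?mule1// gt_eqF// gauss_pdf_gt0.
rewrite subr0 invrN1 mulrN1 [X in X / _](_ : _ = phi x).
  by rewrite divff ?mule1// gt_eqF// gauss_pdf_gt0.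
by rewrite /gauss_pdf sqrrN.
Qed.

Lemma gauss_pdf_rotation (c s u v : R) : c ^+ 2 + s ^+ 2 = 1 ->
  phi (c * u + s * v) * phi (c * v - s * u) = phi u * phi v.
Proof.
move=> cs; rewrite /gauss_pdf mulrACA [RHS]mulrACA -!expRD; congr (_ * expR _).
rewrite -!opprD -!mulrDl; congr (- (_ / _)).
transitivity ((c ^+ 2 + s ^+ 2) * (u ^+ 2 + v ^+ 2)); first by ring.
by rewrite cs mul1r.
Qed.

(** For [c != 0] the rotation is two one-variable substitutions: [u = c x - s y] at fixed [y], which
    turns the second argument into [(s u + y) / c], then [v = (s u + y) / c] at fixed [u]. The
    density weights cancel by [gauss_pdf_rotation]. For [c = 0] the coordinates are swapped up to a
    sign. *)
Lemma gauss1_rotation (c s : R) (h : R * R -> \bar R) : c ^+ 2 + s ^+ 2 = 1 ->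
  measurable_fun setT h -> (forall z, 0 <= h z)%E ->
  (\int[g1]_x \int[g1]_y h (c * x - s * y, s * x + c * y)%R =
   \int[g1]_x \int[g1]_y h (x, y))%E.
Proof.
move=> cs mh h0.
have mlin (T1 T2 : R * R -> R) : measurable_fun setT T1 -> measurable_fun setT T2 ->
    measurable_fun setT (fun z => h (T1 z, T2 z)).
  by move=> m1 m2; apply: measurableT_comp => //; exact: measurable_fun_pair.
have mfst : measurable_fun setT (fst : R * R -> R) by exact: measurable_fst.
have msnd : measurable_fun setT (snd : R * R -> R) by exact: measurable_snd.
have mZ (a : R) (f : R * R -> R) : measurable_fun setT f ->
    measurable_fun setT (fun z => a * f z).
  by move=> mf; exact: measurable_funM.
have mh2 (x : R) : measurable_fun setT (fun y : R => h (x, y)).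
  exact: measurable_fun_pair2.
have mrot : measurable_fun setT
    (fun z : R * R => h (c * z.1 - s * z.2, s * z.1 + c * z.2)).
  apply: mlin; first by apply: measurable_funB; exact: mZ.
  by apply: measurable_funD; exact: mZ.
rewrite (@fubini_tonelli _ _ _ _ _ g1 g1 _ mrot (fun z => h0 _)).
have [c0|c0] := eqVneq c 0.
  have s2 : s ^+ 2 = 1 by rewrite -cs c0 expr0n add0r.
  transitivity (\int[g1]_y \int[g1]_x h ((- s * y)%R, x))%E.
    apply: eq_integral => y _.
    rewrite -(ge0_integral_gauss1_sign s2 (mh2 (- s * y)))//.
    by apply: eq_integral => x _; rewrite /= c0 !mul0r addr0 sub0r -mulNr.
  rewrite (@ge0_integral_gauss1_sign (- s)
    (fun u => \int[g1]_x h (u, x))%E) ?sqrrN//.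
    exact: (@measurable_fun_fubini_tonelli_F _ _ _ _ _ g1 _ mh).
  by move=> x; exact: integral_ge0.
have mphi : measurable_fun setT phi by exact: measurable_gauss_pdf.
have phi0 x : 0 < phi x by exact: gauss_pdf_gt0.
have mhy (y : R) : measurable_fun setT (fun u : R => h (u, (s * u + y) / c)).
  apply: measurableT_comp => //; apply: measurable_fun_pair => //.
  by apply: measurable_funM => //; apply: measurable_funD => //.
transitivity (\int[g1]_y ((`|c|^-1)%:E * \int[g1]_x (h (x, ((s * x + y) / c)%R) *
    (phi ((x - - (s * y)) / c) / phi x)%:E)))%E.
  apply: eq_integral => y _.
  rewrite -(ge0_integral_gauss1_affine (- (s * y)) c0 (mhy y))//.
  apply: eq_integral => x _ /=; congr (h (_, _)); apply: (mulIf c0).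
  rewrite divfK//.
  transitivity (s * (c * x) + (c ^+ 2 + s ^+ 2) * y - s ^+ 2 * y).
    by ring.
  by rewrite cs mul1r; ring.
have mw : measurable_fun setT (fun z : R * R =>
    (h (z.2, ((s * z.2 + z.1) / c)%R) *
      (phi ((z.2 - - (s * z.1)) / c) / phi z.2)%:E)%E).
  apply: emeasurable_funM.
    apply: mlin => //; apply: measurable_funM => //.
    by apply: measurable_funD => //; exact: mZ.
  apply/measurable_EFinP; apply: measurable_funM.
    apply: measurableT_comp => //; apply: measurable_funM => //.
    apply: measurable_funB => //; apply: measurableT_comp => //; exact: mZ.
  exact: measurableT_comp measurable_gauss_pdfV msnd.
have w0 (z : R * R) : (0 <= (h (z.2, ((s * z.2 + z.1) / c)%R) *
      (phi ((z.2 - - (s * z.1)) / c) / phi z.2)%:E)%E)%E.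
  by rewrite mule_ge0// lee_fin divr_ge0// ltW.
rewrite ge0_integralZl//; last first.
- by move=> y _; apply: integral_ge0 => x _; exact: (w0 (y, x)).
- exact: (@measurable_fun_fubini_tonelli_F _ _ _ _ _ g1 _ mw w0).
rewrite (@fubini_tonelli _ _ _ _ _ g1 g1 _ mw w0)/=.
rewrite -ge0_integralZl//; last 2 first.
- exact: (@measurable_fun_fubini_tonelli_G _ _ _ _ _ g1 _ mw w0).
- by move=> y _; apply: integral_ge0 => x _; exact: (w0 (x, y)).
apply: eq_integral => u _.
have ci : c^-1 != 0 by rewrite invr_eq0.
pose f (v : R) := (h (u, v) * (phi (c * u + s * v) / phi u)%:E)%E.
have mf : measurable_fun setT f.
  apply: emeasurable_funM => //; apply/measurable_EFinP.
  apply: measurable_funM => //; apply: measurableT_comp => //.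
  by apply: measurable_funD => //; exact: measurable_funM.
have f0 v : (0 <= f v)%E by rewrite mule_ge0// lee_fin divr_ge0// ltW.
transitivity ((`|c|^-1)%:E * \int[g1]_y f (c^-1 * y + (s * u / c))%R)%E.
  apply: (congr1 (fun I => ((`|c|^-1)%:E * I)%E)); apply: eq_integral => y _.
  rewrite /f; congr (h (_, _) * _)%E.
    by rewrite mulrDl addrC [y / c]mulrC.
  congr ((phi _ / _)%:E); apply: (mulIf c0); rewrite divfK//.
  transitivity ((c ^+ 2 + s ^+ 2) * u + s * y); first by rewrite cs mul1r opprK.
  by field.
rewrite (ge0_integral_gauss1_affine _ ci mf f0) muleA -EFinM normfV [`|c|^-1^-1]invrK.
rewrite mulVf ?normr_eq0// mul1e; apply: eq_integral => v _.
rewrite /f -muleA -EFinM invrK.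
rewrite (_ : (v - _) * c = c * v - s * u); last by field.
by rewrite mulf_div gauss_pdf_rotation// divff ?mule1// mulf_eq0 !gt_eqF.
Qed.

End gauss_rotation.

(** * Standard Gaussian tuples and their orthogonal invariance *)

Section gaussn.
Context (R : realType).
Local Notation g1 := (@gauss1 R).

Definition cons_tuple n (z : R * n.-tuple R) : n.+1.-tuple R :=
  [tuple of z.1 :: z.2].

Lemma measurable_cons_tuple n : measurable_fun setT (@cons_tuple n).
Proof. exact: measurable_cons measurable_fst measurable_snd. Qed.

HB.instance Definition _ n :=
  isMeasurableFun.Build _ _ _ _ (@cons_tuple n) (@measurable_cons_tuple n).

Fixpoint gaussn n : probability (n.-tuple R) R :=
  match n return probability (n.-tuple R) R with
  | 0 => dirac [tuple]
  | n'.+1 => distribution (g1 \x gaussn n')%E (@cons_tuple n')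
  end.

Lemma ge0_integral_gaussnS n (f : n.+1.-tuple R -> \bar R) :
  measurable_fun setT f -> (forall v, 0 <= f v)%E ->
  (\int[gaussn n.+1]_v f v =
   \int[g1]_x \int[gaussn n]_v f (cons_tuple (x, v)))%E.
Proof.
move=> mf f0; have mfc := measurableT_comp mf (@measurable_cons_tuple n).
rewrite ge0_integral_distribution// fubini_tonelli1// => z.
exact: f0.
Qed.

Lemma measurable_cons_at n x (f : n.+1.-tuple R -> \bar R) :
  measurable_fun setT f -> measurable_fun setT (fun v => f (cons_tuple (x, v))).
Proof.
move=> mf; apply: (measurableT_comp mf).
exact: (measurableT_comp (@measurable_cons_tuple n) (pair1_measurable x)).
Qed.

Definition row_of n (v : n.-tuple R) : 'rV[R]_n := \row_i tnth v i.
Definition tuple_of_row n (r : 'rV[R]_n) : n.-tuple R := [tuple r 0 i | i < n].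
Definition tmul n k (v : n.-tuple R) (M : 'M[R]_(n, k)) : k.-tuple R :=
  tuple_of_row (row_of v *m M).

Lemma tuple_of_rowK n : cancel (@tuple_of_row n) (@row_of n).
Proof. by move=> r; apply/rowP => i; rewrite mxE tnth_mktuple. Qed.

Lemma row_ofK n : cancel (@row_of n) (@tuple_of_row n).
Proof. by move=> v; apply: eq_from_tnth => i; rewrite tnth_mktuple mxE. Qed.

Lemma measurable_tmul n k (M : 'M[R]_(n, k)) : 
  measurable_fun setT (fun v : n.-tuple R => tmul v M).
Proof.
apply/measurable_fun_tnthP => j.
rewrite (_ : _ \o _ = fun v => \sum_(i < n) tnth v i * M i j).
  apply: measurable_sum => i; apply: measurable_funM => //.
  exact: measurable_tnth.
by apply/funext => v /=; rewrite tnth_mktuple mxE; apply: eq_bigr => i _; rewrite mxE.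
Qed.

Lemma tmulA n k l (v : n.-tuple R) (M : 'M[R]_(n, k)) (N : 'M[R]_(k, l)) :
  tmul (tmul v M) N = tmul v (M *m N).
Proof. by rewrite /tmul tuple_of_rowK mulmxA. Qed.

Lemma tmul1 n (v : n.-tuple R) : tmul v (1%:M) = v.
Proof. by rewrite /tmul mulmx1 row_ofK. Qed.

Lemma row_of_cons n x (v : n.-tuple R) :
  row_of (cons_tuple (x, v)) = row_mx x%:M (row_of v) :> 'rV[R]_(1 + n).
Proof.
apply/rowP => j; rewrite mxE; case: (split_ordP j) => i ->.
  by rewrite row_mxEl ord1 mxE (tnth_nth 0).
by rewrite row_mxEr mxE !(tnth_nth 0).
Qed.

Lemma tuple_of_row_cons n x (r : 'rV[R]_n) :
  tuple_of_row (row_mx x%:M r : 'rV[R]_(1 + n)) = cons_tuple (x, tuple_of_row r).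
Proof. by apply: (can_inj (@row_ofK n.+1)); rewrite tuple_of_rowK row_of_cons tuple_of_rowK. Qed.

Lemma row_of_cons2 n x y (v : n.-tuple R) :
  row_of (cons_tuple (x, cons_tuple (y, v))) =
  row_mx (\row_(i < 2) if i == 0 then x else y) (row_of v) :> 'rV[R]_(2 + n).
Proof.
apply/rowP => j; rewrite mxE; case: (split_ordP j) => i ->.
  by rewrite row_mxEl mxE (tnth_nth 0); case: i => [[|[|]]].
by rewrite row_mxEr mxE !(tnth_nth 0).
Qed.

(** Tuples are row vectors, multiplied on the right. Invariance is stated through integrals so that
    it passes through iterated integration one coordinate at a time. *)
Definition gauss_invariant n (O : 'M[R]_n) : Prop :=
  forall f : n.-tuple R -> \bar R, measurable_fun setT f ->
    (forall v, 0 <= f v)%E ->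
    (\int[gaussn n]_v f (tmul v O) = \int[gaussn n]_v f v)%E.

Lemma gauss_invariantM n (O O' : 'M[R]_n) :
  gauss_invariant O -> gauss_invariant O' -> gauss_invariant (O *m O').
Proof.
move=> iO iO' f mf f0; rewrite -(iO' f)// -(iO (fun v => f (tmul v O')))//.
  by apply: eq_integral => v _; rewrite tmulA.
exact: measurableT_comp (measurable_tmul O').
Qed.

Lemma gauss_invariant_lift0 n (O : 'M[R]_n) :
  gauss_invariant O -> gauss_invariant (lift0_mx O : 'M[R]_(n.+1)).
Proof.
move=> iO f mf f0.
have mfO : measurable_fun setT (fun v => f (tmul v (lift0_mx O : 'M[R]_(n.+1)))).
  exact: measurableT_comp (measurable_tmul _).
rewrite (ge0_integral_gaussnS mfO (fun v => f0 _)) (ge0_integral_gaussnS mf f0).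
apply: eq_integral => x _.
rewrite -(iO (fun v => f (cons_tuple (x, v))) (measurable_cons_at x mf))//.
apply: eq_integral => v _; congr f.
rewrite -tuple_of_row_cons /tmul; congr (@tuple_of_row n.+1 _).
rewrite row_of_cons (@mul_row_block _ 1 1 n 1 n).
by rewrite !mulmx0 addr0 add0r mulmx1.
Qed.

Definition rot2 (c s : R) : 'M[R]_2 :=
  \matrix_(i, j) if i == j then c else if (i < j)%N then s else - s.

Definition givens n c s : 'M[R]_(2 + n) := block_mx (rot2 c s) 0 0 1%:M.

Lemma rot2_orth c s : c ^+ 2 + s ^+ 2 = 1 -> (rot2 c s)^T *m rot2 c s = 1%:M.
Proof.
move=> cs; apply/matrixP => i j; rewrite !mxE !big_ord_recl big_ord0 !mxE/=.
case: i => [[|[|//]] ?]; case: j => [[|[|//]] ?]; rewrite /= -?cs;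
  rewrite /eqfun/eq_op/= ?mulr1n ?mulr0n; by [ring|rewrite -cs; ring].
Qed.

Lemma givens_orth n c s : c ^+ 2 + s ^+ 2 = 1 ->
  (givens n c s)^T *m givens n c s = 1%:M.
Proof.
move=> cs; rewrite /givens tr_block_mx mulmx_block !trmx0 !mul0mx !mulmx0.
rewrite trmx1 mulmx1 rot2_orth// addr0 !addr0 add0r.
by rewrite -scalar_mx_block.
Qed.

Lemma tmul_givens n c s x y (v : n.-tuple R) :
  tmul (cons_tuple (x, cons_tuple (y, v))) (givens n c s) =
  cons_tuple (c * x - s * y, cons_tuple (s * x + c * y, v)).
Proof.
apply: (can_inj (@row_ofK n.+2)); rewrite /tmul tuple_of_rowK !row_of_cons2.
rewrite (@mul_row_block _ 1 2 n 2 n) !mulmx0 addr0 add0r mulmx1.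
apply: (congr1 (fun u => @row_mx _ 1 2 n u (row_of v))).
apply/rowP => j; rewrite !mxE !big_ord_recl big_ord0 !mxE/=.
by case: j => [[|[|//]] ?]; rewrite /eq_op/=; ring.
Qed.

Lemma gauss_invariant_givens n c s : c ^+ 2 + s ^+ 2 = 1 ->
  gauss_invariant (givens n c s : 'M[R]_(n.+2)).
Proof.
move=> cs f mf f0.
pose h (z : R * R) := (\int[gaussn n]_v f (cons_tuple (z.1, cons_tuple (z.2, v))))%E.
have mF : measurable_fun setT (fun z : (R * R) * n.-tuple R =>
    f (cons_tuple (z.1.1, cons_tuple (z.1.2, z.2)))).
  apply: measurableT_comp => //.
  apply: measurableT_comp (@measurable_cons_tuple n.+1) _ => /=.
  apply: measurable_fun_pair => /=.
    exact: measurableT_comp measurable_fst measurable_fst.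
  apply: measurableT_comp (@measurable_cons_tuple n) _ => /=.
  apply: measurable_fun_pair => //=.
  exact: measurableT_comp measurable_snd measurable_fst.
have mh : measurable_fun setT h.
  exact: (@measurable_fun_fubini_tonelli_F _ _ _ _ _ (gaussn n) _ mF).
have h0 z : (0 <= h z)%E by exact: integral_ge0.
have mfG : measurable_fun setT (fun v => f (tmul v (givens n c s))).
  exact: measurableT_comp (measurable_tmul _).
rewrite (ge0_integral_gaussnS mfG (fun v => f0 _)) (ge0_integral_gaussnS mf f0).
transitivity (\int[g1]_x \int[g1]_y h (x, y))%E; last first.
  apply: eq_integral => x _.
  by rewrite (ge0_integral_gaussnS (measurable_cons_at x mf) (fun v => f0 _)).
rewrite -(gauss1_rotation cs mh h0); apply: eq_integral => x _.
rewrite (ge0_integral_gaussnS (measurable_cons_at x mfG) (fun v => f0 _)).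
apply: eq_integral => y _; apply: eq_integral => v _.
by rewrite tmul_givens.
Qed.

(** By induction the lower coordinates of [b] are rotated onto the second axis, and one Givens
    rotation moves the result onto the first. The matrix is a product of factors that visibly
    preserve the Gaussian. *)
Lemma gauss_invariant_reduce n (b : 'cV[R]_n.+1) : exists O : 'M[R]_n.+1,
  [/\ gauss_invariant O, O^T *m O = 1%:M &
      exists r, O *m b = r *: delta_mx 0 0].
Proof.
elim: n b => [|n IHn] b.
  exists 1%:M; split; first by move=> f _ _; apply: eq_integral => v _; rewrite tmul1.
    by rewrite trmx1 mulmx1.
  exists (b 0 0); rewrite mul1mx; apply/colP => i.
  by rewrite !mxE ord1 eqxx mulr1.
have [ O [iO oO [r Or]]] := IHn (dsubmx (b : 'cV[R]_(1 + n.+1))).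
pose b0 := b 0 0; pose t := Num.sqrt (b0 ^+ 2 + r ^+ 2).
(* At [t = 0] the quotients would be 0 and give no rotation; both entries vanish then, and the
   identity serves. *)
pose c := if t == 0 then 1 else b0 / t.
pose s := if t == 0 then 0 else r / t.
have t2 : t ^+ 2 = b0 ^+ 2 + r ^+ 2.
  by rewrite sqr_sqrtr// addr_ge0// sqr_ge0.
have cs : c ^+ 2 + s ^+ 2 = 1.
  rewrite /c /s; case: eqVneq => [_|t0]; first by rewrite expr1n expr0n addr0.
  by rewrite !expr_div_n -mulrDl -t2 divff// sqrf_eq0.
have rc : c * r - s * b0 = 0.
  rewrite /c /s; case: eqVneq => [t0|t0]; last by field.
  move: t2; rewrite t0 expr0n/= => /esym/eqP.
  rewrite paddr_eq0 ?sqr_ge0// !sqrf_eq0 => /andP[/eqP-> /eqP->].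
  by rewrite !mulr0 subrr.
exists ((givens n c s : 'M[R]_(n.+2)) *m (lift0_mx O : 'M[R]_(n.+2))); split.
- apply: gauss_invariantM; first exact: gauss_invariant_givens.
  exact: gauss_invariant_lift0.
- rewrite trmx_mul -mulmxA (mulmxA (givens n c s)^T) givens_orth// mul1mx.
  rewrite /lift0_mx (@tr_block_mx _ 1 n.+1 1 n.+1) (@mulmx_block _ 1 n.+1 1 n.+1 1 n.+1).
  rewrite !trmx0 !mul0mx !mulmx0 trmx1 mulmx1 oO !addr0 add0r.
  by rewrite -(@scalar_mx_block _ 1 n.+1).
- exists (c * b0 + s * r).
  pose u2 : 'cV[R]_2 := \col_(i < 2) (if i == 0 then b0 else r).
  have eqOb : (lift0_mx O : 'M[R]_(n.+2)) *m b = (col_mx u2 0 : 'cV[R]_(2 + n)).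
    rewrite -[b](@vsubmxK _ 1 n.+1) /lift0_mx (@mul_block_col _ 1 n.+1 1 n.+1).
    rewrite !mul0mx add0r addr0 mul1mx Or.
    apply/colP => i; case: (@split_ordP 2 n i) => j ->.
      rewrite [RHS](@col_mxEu _ 2 n) [RHS]mxE; case: j => [[|[|//]] p].
        have -> : @lshift 2 n (Ordinal p) = @lshift 1 n.+1 0 :> 'I_(n.+2).
          exact/val_inj.
        rewrite (@col_mxEu _ 1 n.+1) !mxE/=; congr (b _ _); exact/val_inj.
      have -> : @lshift 2 n (Ordinal p) = @rshift 1 n.+1 0 :> 'I_(n.+2).
        exact/val_inj.
      by rewrite (@col_mxEd _ 1 n.+1) !mxE/= mulr1.
    rewrite [RHS](@col_mxEd _ 2 n) [RHS]mxE.
    have -> : @rshift 2 n j = @rshift 1 n.+1 (lift ord0 j) :> 'I_(n.+2).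
      exact/val_inj.
    by rewrite (@col_mxEd _ 1 n.+1) !mxE/= mulr0.
  rewrite -mulmxA eqOb /givens (@mul_block_col _ 2 n 2 n) !mul0mx !mulmx0 !addr0.
  apply/colP => i; case: (@split_ordP 2 n i) => j ->.
    rewrite (@col_mxEu _ 2 n) !mxE !big_ord_recl big_ord0 !mxE/=.
    case: j => [[|[|//]] p].
      by rewrite /eq_op/= mulr1 addr0.
    by rewrite /eq_op/= mulr0 addr0 mulNr addrC.
  by rewrite (@col_mxEd _ 2 n) !mxE/= mulr0.
Qed.

(* A matrix with orthonormal columns maps a standard Gaussian vector to a
   standard Gaussian vector: rotate its first column to a multiple of the first
   basis vector, split off the first coordinate, and recurse. *)
Lemma gaussn_stiefel n k (B : 'M[R]_(n, k)) : B^T *m B = 1%:M ->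
  forall f : k.-tuple R -> \bar R, measurable_fun setT f ->
    (forall v, 0 <= f v)%E ->
    (\int[gaussn n]_v f (tmul v B) = \int[gaussn k]_v f v)%E.
Proof.
elim: k n B => [|k IHk] n B oB f mf f0.
  have -> : f = cst (f [tuple]) by apply/funext => v; rewrite (tuple0 v).
  rewrite !integral_cst//= !probability_setT//.
case: n B oB => [|n] B oB.
  move/matrixP: oB => /(_ 0 0); rewrite !mxE big_ord0 eqxx => /esym/eqP.
  by rewrite oner_eq0.
have [ O [iO oO [r Or]]] := gauss_invariant_reduce (col 0 B).
pose C : 'M[R]_(1 + n, 1 + k) := O *m B.
have oC : C^T *m C = 1%:M.
  by rewrite /C trmx_mul -mulmxA (mulmxA O^T) oO mul1mx.
have Cu : ulsubmx C = r%:M.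
  apply/matrixP => i j; rewrite !ord1 !mxE eqxx mulr1n.
  move/colP: Or => /(_ 0); rewrite !mxE/= mulr1 => <-.
  apply: eq_bigr => l _; rewrite !mxE; congr (O _ _ * B _ _); exact/val_inj.
have Cd : dlsubmx C = 0.
  apply/matrixP => i j; rewrite !ord1 !mxE.
  move/colP: Or => /(_ (rshift 1 i)); rewrite !mxE/= mulr0 => Oi; rewrite -[RHS]Oi.
  apply: eq_bigr => l _; rewrite !mxE; congr (O _ _ * B _ _); exact/val_inj.
move: oC; rewrite -(submxK C) tr_block_mx mulmx_block Cu Cd.
rewrite trmx0 mulmx0 addr0 !mul0mx !addr0 tr_scalar_mx.
rewrite (@scalar_mx_block _ 1 k) => /eq_block_mx[].
rewrite -scalar_mxM => /matrixP/(_ 0 0); rewrite !mxE /= !mulr1n => r1.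
rewrite mul_scalar_mx => rC _ oD.
(* The first column is [(r, 0, ..., 0)] with [r ^ 2 = 1], so orthogonality to the other columns
   empties the first row. Thus [C] is block diagonal and [r] is a sign, absorbed by symmetry of
   [g1]. *)
have Cr : ursubmx C = 0.
  by rewrite -[ursubmx C]scale1r -r1 -scalerA rC scaler0.
rewrite Cr mulmx0 add0r in oD.
pose D := drsubmx C.
have tC x v : tmul (cons_tuple (x, v)) C = cons_tuple (r * x, tmul v D).
  rewrite /tmul -tuple_of_row_cons; congr (@tuple_of_row k.+1 _).
  rewrite row_of_cons -[in LHS](submxK C) Cu Cd Cr.
  rewrite (@mul_row_block _ 1 1 n 1 k) !mulmx0 addr0 add0r -scalar_mxM.
  by rewrite (mulrC x).
rewrite -(iO (fun v => f (tmul v B)))//; last exact: measurableT_comp (measurable_tmul B).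
transitivity (\int[gaussn n.+1]_v f (tmul v C))%E.
  by apply: eq_integral => v _; rewrite tmulA.
rewrite ge0_integral_gaussnS//; last exact: measurableT_comp (measurable_tmul C).
have mfc : measurable_fun setT (fun z => f (@cons_tuple k z)).
  exact: measurableT_comp (@measurable_cons_tuple k).
transitivity (\int[g1]_x \int[gaussn k]_w f (cons_tuple ((r * x)%R, w)))%E.
  apply: eq_integral => x _.
  rewrite -(IHk _ D oD _ (measurable_cons_at (r * x) mf))//.
  by apply: eq_integral => v _; rewrite tC.
rewrite (ge0_integral_gaussnS mf f0).
apply: (@ge0_integral_gauss1_sign _ r
  (fun x => \int[gaussn k]_w f (cons_tuple (x, w)))%E) => //.
- exact: (@measurable_fun_fubini_tonelli_F _ _ _ _ _ (gaussn k) _ mfc (fun z => f0 _)).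
- by move=> x; exact: integral_ge0.
Qed.

End gaussn.

(** * Moment generating function of a Gaussian power *)

Section gauss_expectation.
Context (R : realType).
Local Notation g1 := (@gauss1 R).
Local Notation phi := (@gauss_pdf R).
Implicit Types f g : R -> R.

Definition gexp f : \bar R := (\int[g1]_x (f x)%:E)%E.

Lemma gexp_le f g : measurable_fun setT f -> measurable_fun setT g ->
  (forall x, 0 <= f x) -> (forall x, f x <= g x) -> (gexp f <= gexp g)%E.
Proof.
move=> mf mg f0 fg; apply: ge0_le_integral => //.
- by move=> x _; rewrite lee_fin.
- exact/measurable_EFinP.
- exact/measurable_EFinP.
- by move=> x _; rewrite lee_fin.
Qed.

Lemma gexpD f g : measurable_fun setT f -> measurable_fun setT g ->
  (forall x, 0 <= f x) -> (forall x, 0 <= g x) ->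
  gexp (fun x => f x + g x) = (gexp f + gexp g)%E.
Proof.
move=> mf mg f0 g0; rewrite /gexp -ge0_integralD//.
- by move=> x _; rewrite lee_fin.
- exact/measurable_EFinP.
- by move=> x _; rewrite lee_fin.
- exact/measurable_EFinP.
Qed.

Lemma gexpZ (c : R) f : measurable_fun setT f -> (forall x, 0 <= f x) ->
  0 <= c -> gexp (fun x => c * f x) = (c%:E * gexp f)%E.
Proof.
move=> mf f0 c0; rewrite /gexp -ge0_integralZl//.
- exact/measurable_EFinP.
- by move=> x _; rewrite lee_fin.
Qed.

Lemma gexp_cst (c : R) : gexp (fun=> c) = c%:E.
Proof. by rewrite /gexp integral_cst//= (@probability_setT _ _ _ g1) mule1. Qed.

Lemma gexp_ge0 f : (forall x, 0 <= f x) -> (0 <= gexp f)%E.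
Proof. by move=> f0; apply: integral_ge0 => x _; rewrite lee_fin. Qed.

Lemma gexpE f : measurable_fun setT f -> (forall x, 0 <= f x) ->
  gexp f = (\int[lebesgue_measure]_x (f x * phi x)%:E)%E.
Proof.
move=> mf f0; rewrite /gexp ge0_integral_gauss1//.
exact/measurable_EFinP.
Qed.

Lemma integral_gauss_pdf : (\int[lebesgue_measure]_x (phi x)%:E = 1)%E.
Proof.
rewrite -[RHS](integral_normal_pdf 0 1); apply: eq_integral => x _.
by rewrite normal_pdf01E.
Qed.

Lemma measurable_EFin_gauss_pdf : measurable_fun setT (EFin \o phi).
Proof. by apply/measurable_EFinP; exact: measurable_gauss_pdf. Qed.

Lemma gexp_expR_measurable (f : R -> R) : measurable_fun setT f ->
  measurable_fun setT (fun x => expR (f x)).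
Proof. by move=> mf; exact: measurableT_comp. Qed.

Lemma measurable_sqr_mul (t : R) : measurable_fun setT (fun x : R => t * x ^+ 2).
Proof. by apply: measurable_funM => //; exact: measurable_funX. Qed.

(** Scaling the variable by [sqrt (1 - 2 t)] turns the Gaussian density into the integrand. *)
Lemma gexp_sqr (t : R) : t < 1 / 2 ->
  gexp (fun x => expR (t * x ^+ 2)) = (Num.sqrt (1 - 2 * t))^-1%:E.
Proof.
move=> t2; have a0 : 0 < Num.sqrt (1 - 2 * t) by rewrite sqrtr_gt0; lra.
rewrite gexpE; last by move=> x; rewrite expR_ge0.
  have := @ge0_integral_affine _ (Num.sqrt (1 - 2 * t)) 0 _ (lt0r_neq0 a0)
    measurable_EFin_gauss_pdf _.
  rewrite integral_gauss_pdf => H.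
  have {H} /esym H := H (fun x => ltW (gauss_pdf_gt0 x)).
  rewrite (gtr0_norm a0) in H.
  transitivity ((Num.sqrt (1 - 2 * t))^-1%:E * 1)%E; last by rewrite mule1.
  rewrite -H muleA -EFinM mulVf ?gt_eqF// mul1e.
  apply: eq_integral => x _ /=; rewrite addr0 /gauss_pdf mulrCA -expRD.
  congr (_ * expR _)%:E; rewrite exprMn sqr_sqrtr; last by lra.
  by field.
by apply: gexp_expR_measurable; exact: measurable_sqr_mul.
Qed.

Lemma gexp_lin (t : R) : gexp (fun x => expR (t * x)) = (expR (t ^+ 2 / 2))%:E.
Proof.
rewrite gexpE; last by move=> x; rewrite expR_ge0.
  have := @ge0_integral_affine _ 1 (- t) _ (oner_neq0 R)
    measurable_EFin_gauss_pdf _.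
  rewrite integral_gauss_pdf => H.
  have {H} := H (fun x => ltW (gauss_pdf_gt0 x)); rewrite normr1 mul1e => H.
  transitivity ((expR (t ^+ 2 / 2))%:E * 1)%E; last by rewrite mule1.
  have mF : measurable_fun setT (fun x : R => (phi (1 * x + - t))%:E).
    by apply: (measurableT_comp measurable_EFin_gauss_pdf); exact: measurable_affine.
  have F0 (x : R) : setT x -> (0 <= (phi (1 * x + - t))%:E)%E.
    by rewrite lee_fin ltW// gauss_pdf_gt0.
  have k0 : (0 <= (expR (t ^+ 2 / 2))%:E)%E by rewrite lee_fin expR_ge0.
  rewrite H -(ge0_integralZl lebesgue_measure measurableT mF F0 k0).
  apply: eq_integral => x _; rewrite -EFinM /gauss_pdf !(mulrCA (expR _)) -!expRD.
  by congr (_ * expR _)%:E; field.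
by apply: gexp_expR_measurable; exact: measurable_funM.
Qed.

End gauss_expectation.

Section scalar_bounds.
Context (R : realType).
Implicit Types u y e h x : R.

Lemma sqr_abs u : `|u| ^+ 2 = u ^+ 2.
Proof. exact: real_normK (num_real u). Qed.

(** Only [1 + x <= expR x] is iterated: for [u >= 0] through [expR u <= 1 + u expR u] used twice,
    for [u < 0] through [expR u <= 1 / (1 - u) <= 1 + u + u ^ 2]. *)
Lemma expR_le_taylor u : expR u <= 1 + u + u ^+ 2 * expR `|u|.
Proof.
have [u0|u0] := leP 0 u.
  rewrite ger0_norm//.
  have h : expR u <= 1 + u * expR u.
    have := expR_ge1Dx (- u); rewrite -(ler_pM2l (expR_gt0 u)) -expRD subrr expR0.
    lra.
  apply: (le_trans h); have : u * expR u <= u * (1 + u * expR u) by rewrite ler_wpM2l.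
  lra.
rewrite ltr0_norm//.
have h1 : expR u * (1 - u) <= 1.
  have := expR_ge1Dx (- u); rewrite -(ler_pM2l (expR_gt0 u)) -expRD subrr expR0.
  lra.
have h2 : 1 <= expR (- u) by have := expR_ge1Dx (- u); lra.
have h3 : 1 <= (1 + u + u ^+ 2) * (1 - u) by nra.
have : expR u * (1 - u) <= (1 + u + u ^+ 2) * (1 - u) by lra.
rewrite ler_pM2r; last by lra.
by move=> /le_trans; apply; rewrite lerD2l ler_peMr// sqr_ge0.
Qed.

Lemma sqr_le_expR e y : 0 < e -> 0 <= y -> y ^+ 2 <= 2 / e ^+ 2 * expR (e * y).
Proof.
move=> e0 y0; have := @expR_ge1Dxn _ (e * y) 1 (mulr_ge0 (ltW e0) y0).
rewrite exprMn /= (_ : 2`! = 2)%N// => h.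
have h' : e ^+ 2 * y ^+ 2 / 2 <= expR (e * y) by lra.
by rewrite mulrAC ler_pdivlMr ?exprn_gt0//; lra.
Qed.

Lemma le_expR e y : 0 < e -> y <= e^-1 * expR (e * y).
Proof.
move=> e0; rewrite ler_pdivlMl//; have := expR_ge1Dx (e * y); lra.
Qed.

(** A slightly larger exponent absorbs the polynomial factor, so that Taylor remainders integrate to
    values of the moment generating function. *)
Lemma taylor_remainder_le (t e y : R) : 0 <= t -> 0 < e -> 0 <= y ->
  (t * y) ^+ 2 * expR (t * y) <= t ^+ 2 * (2 / e ^+ 2) * expR ((t + e) * y).
Proof.
move=> t0 e0 y0.
have -> : expR ((t + e) * y) = expR (e * y) * expR (t * y).
  by rewrite -expRD; congr expR; ring.
rewrite exprMn mulrA ler_wpM2r ?expR_ge0// -mulrA ler_wpM2l ?sqr_ge0//.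
exact: sqr_le_expR.
Qed.

End scalar_bounds.

Section mgf.
Context (R : realType) (q : R) (hq : 1 <= q <= 2).
Local Notation g1 := (@gauss1 R).

#[local] Hint Extern 0 (is_true (0 <= expR _)) => exact: expR_ge0 : core.
#[local] Hint Extern 0 (is_true (0 <= _ `^ _)) => exact: powR_ge0 : core.

Let q_gt0 : 0 < q. Proof. by case/andP: hq => q1 _; lra. Qed.

Lemma measurable_norm_powR : measurable_fun setT (fun x : R => `|x| `^ q).
Proof.
by apply: (measurableT_comp (measurable_powR q)); exact: normr_measurable.
Qed.

Lemma measurable_expR_norm_powR (t : R) :
  measurable_fun setT (fun x : R => expR (t * `|x| `^ q)).
Proof.
apply: gexp_expR_measurable; apply: measurable_funM => //.
exact: measurable_norm_powR.
Qed.

Definition mgf (t : R) : \bar R := gexp (fun x => expR (t * `|x| `^ q)).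

Lemma mgfE t : mgf t = gexp (fun x => expR (t * `|x| `^ q)).
Proof. by []. Qed.

Lemma Lambda_mgf t : Lambda q t = lne (mgf t).
Proof.
rewrite /Lambda /mgf gexpE//; last exact: measurable_expR_norm_powR.
congr lne; apply: eq_integral => x _; congr EFin.
by rewrite /gauss_pdf mulrCA -expRD.
Qed.

Lemma mgf_le t t' : t <= t' -> (mgf t <= mgf t')%E.
Proof.
move=> tt'; apply: gexp_le => //; try exact: measurable_expR_norm_powR.
by move=> x; rewrite ler_expR ler_wpM2r// powR_ge0.
Qed.

Lemma mgf0 : mgf 0 = 1%E.
Proof.
rewrite -[RHS]/(1%:E) -gexp_cst; congr gexp; apply/funext => x.
by rewrite mul0r expR0.
Qed.

Lemma norm_powR_ge (x : R) : `|x| - 1 <= `|x| `^ q.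
Proof.
case/andP: hq => q1 q2; have [x1|x1] := leP 1 `|x|.
  by have := le1r_powR x1 q1; lra.
by have := powR_ge0 `|x| q; lra.
Qed.

Lemma norm_powR_ge_min (x : R) : x ^+ 2 <= `|x| `^ q \/ 1 <= `|x| `^ q.
Proof.
case/andP: hq => q1 q2; have [x1|x1] := leP `|x| 1; [left|right].
  have [->|x0] := eqVneq x 0; first by rewrite expr0n powR_ge0.
  rewrite -sqr_abs -powR_mulrn//.
  by apply: ger_powR => //; rewrite normr_gt0 x0.
by rewrite -[leLHS](powRr0 `|x|) ler_powR//; lra.
Qed.

Lemma norm_powR_le_sqr (x : R) : `|x| `^ q <= 1 + x ^+ 2.
Proof.
case/andP: hq => q1 q2; have [x1|x1] := leP `|x| 1.
  have : `|x| `^ q <= 1 `^ q by apply: ge0_ler_powR; rewrite ?nnegrE// ltW.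
  by rewrite powR1; have := sqr_ge0 x; lra.
have : `|x| `^ q <= `|x| `^ 2%:R by apply: ler_powR => //; exact: ltW.
rewrite powR_mulrn// sqr_abs; lra.
Qed.

Lemma norm_powR_le_near0 (e : R) : 0 < e ->
  exists2 C : R, 0 < C & forall x, `|x| `^ q <= e + C * x ^+ 2.
Proof.
move=> e0; pose r := e `^ q^-1.
have r0 : 0 < r by exact: powR_gt0.
have re : r `^ q = e by rewrite -powRrM mulVf ?gt_eqF// powRr1// ltW.
exists ((r ^+ 2)^-1 + 1) => [|x]; first by rewrite ltr_wpDl// invr_ge0 sqr_ge0.
have Cx : 0 <= x ^+ 2 by exact: sqr_ge0.
have [xr|xr] := leP `|x| r.
  have : `|x| `^ q <= r `^ q by apply: ge0_ler_powR; rewrite ?nnegrE// ltW.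
  rewrite re => /le_trans; apply; rewrite lerDl mulr_ge0//.
  by rewrite addr_ge0// invr_ge0 sqr_ge0.
apply: (le_trans (norm_powR_le_sqr x)).
have : 1 <= (r ^+ 2)^-1 * x ^+ 2.
  rewrite ler_pdivlMl ?exprn_gt0// mulr1 -[leRHS]sqr_abs.
  by rewrite ler_pXn2r ?nnegrE// ltW.
lra.
Qed.

(** Bounding [|x| ^ q] by [e + C x ^ 2] leaves an explicit Gaussian integral. Up to a root, the
    decay has an arbitrarily small rate [e]: the variable has mass near 0. *)
Lemma mgf_lower (e : R) : 0 < e -> exists2 C : R, 0 < C &
  forall t, 0 <= t -> (((expR (- (t * e))) * (Num.sqrt (1 + 2 * t * C))^-1)%:E
    <= mgf (- t))%E.
Proof.
move=> e0; have [C C0 HC] := norm_powR_le_near0 e0; exists C => // t t0.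
have tC : - (t * C) < 1 / 2 by have := mulr_ge0 t0 (ltW C0); lra.
rewrite EFinM (_ : 1 + 2 * t * C = 1 - 2 * - (t * C)); last by ring.
rewrite -gexp_sqr// -gexpZ//; last first.
  by apply: gexp_expR_measurable; exact: measurable_sqr_mul.
apply: gexp_le => //.
- apply: measurable_funM => //.
  by apply: gexp_expR_measurable; exact: measurable_sqr_mul.
- exact: measurable_expR_norm_powR.
- move=> x; rewrite -expRD ler_expR.
  have := ler_wpM2l t0 (HC x); lra.
Qed.

Lemma mgf_gt0 t : (0 < mgf t)%E.
Proof.
have [C C0 HC] := mgf_lower ltr01.
apply: (@lt_le_trans _ _ (mgf (- `|t|))); last by apply: mgf_le; rewrite lerNl -normrN ler_norm.
apply: lt_le_trans (HC _ (normr_ge0 t)); rewrite lte_fin mulr_gt0 ?expR_gt0//.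
by rewrite invr_gt0 sqrtr_gt0 ltr_wpDr// !mulr_ge0// ltW.
Qed.

(** Pointwise, [|x| ^ q] is at least [x ^ 2] or at least 1. The bound tends to 0 as [t] grows, which
    is what makes [Lambda_star q 0] infinite. *)
Lemma mgf_neg (t : R) : 0 <= t ->
  (mgf (- t) <= ((Num.sqrt (1 + 2 * t))^-1 + expR (- t))%:E)%E.
Proof.
move=> t0; have t2 : - t < 1 / 2 by lra.
rewrite EFinD (_ : 1 + 2 * t = 1 - 2 * - t); last by ring.
have ms : measurable_fun setT (fun x : R => expR (- t * x ^+ 2)).
  by apply: gexp_expR_measurable; exact: measurable_sqr_mul.
rewrite -gexp_sqr// -gexp_cst -gexpD//.
apply: gexp_le => //.
- exact: measurable_expR_norm_powR.
- exact: measurable_funD.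
- move=> x; have e1 := expR_ge0 (- t * x ^+ 2); have e2 := expR_ge0 (- t).
  case: (norm_powR_ge_min x) => h.
    have : expR (- t * `|x| `^ q) <= expR (- t * x ^+ 2).
      by rewrite ler_expR !mulNr lerN2 ler_wpM2l.
    lra.
  have : expR (- t * `|x| `^ q) <= expR (- t).
    by rewrite ler_expR mulNr lerN2 ler_peMr.
  lra.
Qed.

Lemma mgf_fin_lt (t : R) : t < 1 / 2 -> (mgf t < +oo)%E.
Proof.
move=> t2; have [t0|t0] := leP t 0.
  by apply: le_lt_trans (mgf_le t0) _; rewrite mgf0 ltry.
have ms : measurable_fun setT (fun x : R => expR (t * x ^+ 2)).
  by apply: gexp_expR_measurable; exact: measurable_sqr_mul.
apply: (@le_lt_trans _ _ ((expR t)%:E * gexp (fun x => expR (t * x ^+ 2)))%E).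
  rewrite -gexpZ//.
  apply: gexp_le => //.
  - exact: measurable_expR_norm_powR.
  - exact: measurable_funM.
  - move=> x; rewrite -expRD ler_expR.
    have := ler_wpM2l (ltW t0) (norm_powR_le_sqr x); lra.
by rewrite gexp_sqr// -EFinM ltry.
Qed.

Lemma mgf_fin_q (t : R) : q < 2 -> (mgf t < +oo)%E.
Proof.
move=> q2; have [t0|t0] := leP t 0.
  by apply: le_lt_trans (mgf_le t0) _; rewrite mgf0 ltry.
(* Beyond [K] one has [t |x| ^ q <= x ^ 2 / 4], an exponent that the Gaussian integrates. *)
pose K := (4 * t) `^ (2 - q)^-1.
have t4 : 0 < 4 * t by lra.
have K0 : 0 < K by exact: powR_gt0.
have KE : K `^ (2 - q) = 4 * t.
  rewrite -powRrM mulVf ?powRr1//; first exact: ltW.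
  by rewrite gt_eqF// subr_gt0.
have ms : measurable_fun setT (fun x : R => expR (1 / 4 * x ^+ 2)).
  by apply: gexp_expR_measurable; exact: measurable_sqr_mul.
apply: (@le_lt_trans _ _ ((expR (t * K `^ q))%:E *
    gexp (fun x => expR (1 / 4 * x ^+ 2)))%E).
  rewrite -gexpZ//.
  apply: gexp_le => //.
  - exact: measurable_expR_norm_powR.
  - exact: measurable_funM.
  - move=> x; rewrite -expRD ler_expR.
    have [xK|xK] := leP `|x| K.
      have : `|x| `^ q <= K `^ q by apply: ge0_ler_powR; rewrite ?nnegrE// ltW.
      by move=> /(ler_wpM2l (ltW t0)); have := sqr_ge0 x; lra.
    have x0 : 0 < `|x| by exact: lt_trans xK.
    have KX : 4 * t <= `|x| `^ (2 - q).
      rewrite -KE; apply: ge0_ler_powR; rewrite ?nnegrE ?subr_ge0; exact: ltW.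
    have E : x ^+ 2 = `|x| `^ (2 - q) * `|x| `^ q.
      rewrite -powRD; last by rewrite (gt_eqF x0) implybT.
      by rewrite subrK -[RHS]/(_ `^ 2%:R) powR_mulrn// sqr_abs.
    have := ler_wpM2r (powR_ge0 `|x| q) KX; rewrite -E.
    have := mulr_ge0 (ltW t0) (powR_ge0 K q); lra.
by rewrite gexp_sqr ?ltry//; lra.
Qed.

(** From [expR (h y) - 1 <= h y expR (h y)] and [y <= expR (e y) / e]. It yields continuity on the
    part of the domain of finiteness that leaves room for [e]. *)
Lemma mgf_lip (t h e : R) : 0 <= h -> 0 < e ->
  (mgf (t + h) <= mgf t + (h / e)%:E * mgf (t + h + e))%E.
Proof.
move=> h0 e0; have he : 0 <= h / e by rewrite divr_ge0// ltW.
have mm := measurable_expR_norm_powR.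
rewrite /mgf -gexpZ// -gexpD//; last by move=> x; rewrite mulr_ge0// expR_ge0.
  apply: gexp_le => //; first by apply: measurable_funD => //; exact: measurable_funM.
  move=> x; set y := `|x| `^ q; have y0 : 0 <= y by exact: powR_ge0.
  have h1 : expR (h * y) <= 1 + h * y * expR (h * y).
    have := expR_ge1Dx (- (h * y)).
    rewrite -(ler_pM2l (expR_gt0 (h * y))) -expRD subrr expR0; lra.
  have h2 : y <= e^-1 * expR (e * y) by exact: le_expR.
  have h3 : h * y * expR (h * y) <= h / e * expR ((h + e) * y).
    have -> : expR ((h + e) * y) = expR (e * y) * expR (h * y).
      by rewrite -expRD; congr expR; ring.
    by rewrite mulrA ler_wpM2r// -mulrA ler_wpM2l.
  have := ler_wpM2l (expR_ge0 (t * y)) (le_trans h1 (lerD (lexx 1) h3)).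
  rewrite mulrDr mulr1 mulrCA -!expRD.
  by rewrite -!mulrDl addrA.
exact: measurable_funM.
Qed.

(** The Taylor bounds at [h (y - x)] and [- h (y - x)] are added: first-order terms cancel and the
    error is of order [h ^ 2]. *)
Lemma mgf_second (t h e x : R) : 0 <= h -> 0 < e -> h <= e -> 0 <= x ->
  ((expR (- (h * x)))%:E * mgf (t + h) + (expR (h * x))%:E * mgf (t - h) <=
   2%:E * mgf t + (h ^+ 2 * (4 / e ^+ 2 * expR (2 * e * x)))%:E * mgf (t + 2 * e))%E.
Proof.
move=> h0 e0 he x0; have mm := measurable_expR_norm_powR.
have c0 : 0 <= h ^+ 2 * (4 / e ^+ 2 * expR (2 * e * x)).
  by rewrite !mulr_ge0 ?expR_ge0 ?sqr_ge0// invr_ge0 sqr_ge0.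
rewrite /mgf -!gexpZ ?expR_ge0// -!gexpD//;
  do ?[by move=> z; rewrite mulr_ge0// expR_ge0 | exact: measurable_funM].
apply: gexp_le.
- by apply: measurable_funD; exact: measurable_funM.
- by apply: measurable_funD; exact: measurable_funM.
- by move=> z; rewrite addr_ge0// mulr_ge0// expR_ge0.
move=> z; set y := `|z| `^ q; have y0 : 0 <= y by exact: powR_ge0.
pose u := y - x.
have hu : `|u| <= y + x by rewrite (le_trans (ler_normB _ _))// !ger0_norm.
have h1 := expR_le_taylor (h * u); have h2 := expR_le_taylor (- (h * u)).
rewrite normrN sqrrN in h2.
have h3 : (h * u) ^+ 2 * expR `|h * u| <=
    h ^+ 2 * (2 / e ^+ 2 * expR (2 * e * x)) * expR (2 * e * y).
  rewrite exprMn -[u ^+ 2]sqr_abs -[leLHS]mulrA -[leRHS]mulrA ler_wpM2l ?sqr_ge0//.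
  apply: (@le_trans _ _ (2 / e ^+ 2 * expR (e * `|u|) * expR (e * `|u|))).
    apply: ler_pM; rewrite ?sqr_ge0 ?expR_ge0//; first exact: sqr_le_expR.
    by rewrite ler_expR normrM (ger0_norm h0) ler_wpM2r.
  rewrite -!mulrA -!expRD ler_wpM2l//.
  rewrite ler_wpM2l ?invr_ge0 ?sqr_ge0// ler_expR.
  have := ler_wpM2l (ltW e0) hu; lra.
have h4 : expR (h * u) + expR (- (h * u)) <=
    2 + h ^+ 2 * (4 / e ^+ 2 * expR (2 * e * x)) * expR (2 * e * y) by lra.
have := ler_wpM2l (expR_ge0 (t * y)) h4.
set B := h ^+ 2 * _.
have -> : expR (t * y) * (expR (h * u) + expR (- (h * u))) =
    expR (- (h * x)) * expR ((t + h) * y) + expR (h * x) * expR ((t - h) * y).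
  by rewrite mulrDr -!expRD; congr (expR _ + expR _); rewrite /u; ring.
suff -> : expR (t * y) * (2 + B * expR (2 * e * y)) =
    2 * expR (t * y) + B * expR ((t + 2 * e) * y) by [].
rewrite mulrDr (mulrC _ 2) mulrCA -expRD; congr (_ + _ * expR _); ring.
Qed.

Definition abs_moment : \bar R := gexp (fun x => `|x| `^ q).

Lemma gauss_momentE : gauss_moment q = fine abs_moment.
Proof.
rewrite /abs_moment gexpE; [|exact: measurable_norm_powR|by move=> x; exact: powR_ge0].
rewrite /gauss_moment /Rintegral; congr fine; apply: eq_integral => x _.
by congr EFin; rewrite /gauss_pdf; ring.
Qed.

Lemma abs_moment_fin : abs_moment \is a fin_num.
Proof.
rewrite ge0_fin_numE; last by apply: gexp_ge0 => x; exact: powR_ge0.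
apply: (@le_lt_trans _ _ (4%:E * mgf (1 / 4))%E).
  rewrite -gexpZ//; last exact: measurable_expR_norm_powR.
  apply: gexp_le => //; first exact: measurable_norm_powR.
    by apply: measurable_funM => //; exact: measurable_expR_norm_powR.
  by move=> x; have := expR_ge1Dx (1 / 4 * `|x| `^ q); lra.
have : (mgf (1 / 4) < +oo)%E by apply: mgf_fin_lt; lra.
have := mgf_gt0 (1 / 4).
by case: (mgf (1 / 4)) => // r _ _; rewrite -EFinM ltry.
Qed.

Lemma gauss_moment_gt0 : 0 < gauss_moment q.
Proof.
(* [e^{-y} >= 1 - y] gives [1 <= mgf (-1) + E y] *)
have mp := measurable_norm_powR.
have mm := measurable_expR_norm_powR.
rewrite gauss_momentE; suff : (0 < abs_moment)%E.
  by move=> h; rewrite fine_gt0// h ltey_eq abs_moment_fin.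
have [t [t0 tlt]] : exists t : R, 0 < t /\ (mgf (- t) < 1)%E.
  (* Here [1 + 2 * 4] is a square, and [mgf_neg] gives at most [1/3 + 1/5]. *)
  exists 4; split=> //; apply: le_lt_trans (mgf_neg _) _ => //.
  have h9 : Num.sqrt (1 + 2 * 4) = 3 :> R.
    by rewrite (_ : 1 + 2 * 4 = 3 ^+ 2) ?sqrtr_sqr ?ger0_norm//; ring.
  rewrite h9 lte_fin expRN.
  have : (5 : R) <= expR 4 by have := expR_ge1Dx (4 : R); lra.
  move=> h5; have : (expR 4)^-1 <= (5 : R)^-1 by rewrite lef_pV2 ?posrE ?expR_gt0.
  lra.
have h : (1 <= mgf (- t) + t%:E * abs_moment)%E.
  rewrite -gexpZ//; last exact: ltW.
  rewrite -gexpD//; [|exact: measurable_funM|].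
    rewrite -[leLHS]/(1%:E) -gexp_cst; apply: gexp_le => //.
      by apply: measurable_funD => //; exact: measurable_funM.
    by move=> x; have := expR_ge1Dx (- t * `|x| `^ q); lra.
  by move=> x; rewrite mulr_ge0 ?powR_ge0// ltW.
have a0 : (0 <= abs_moment)%E by apply: gexp_ge0 => x; exact: powR_ge0.
rewrite lt_def a0 andbT; apply/eqP => am0.
by move: h; rewrite am0 mule0 adde0 leNgt tlt.
Qed.

(** First-order expansion at 0 with the mean as slope. With its mirror image below, it shows that
    the rate is positive away from the mean. *)
Lemma mgf_first_pos (t e : R) : 0 <= t -> 0 < e ->
  (mgf t <= 1 + t%:E * abs_moment + (t ^+ 2 * (2 / e ^+ 2))%:E * mgf (t + e))%E.
Proof.
move=> t0 e0; have mp := measurable_norm_powR.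
have mm := measurable_expR_norm_powR.
have c0 : 0 <= t ^+ 2 * (2 / e ^+ 2).
  by rewrite !mulr_ge0 ?sqr_ge0// invr_ge0 sqr_ge0.
have c00 (x : R) : 0 <= t ^+ 2 * (2 / e ^+ 2) * expR ((t + e) * `|x| `^ q).
  by rewrite mulr_ge0.
have mt : measurable_fun setT (fun x : R => t * `|x| `^ q) by exact: measurable_funM.
have t00 (x : R) : 0 <= t * `|x| `^ q by rewrite mulr_ge0// powR_ge0.
rewrite /mgf -!gexpZ// -?[1%E]/(1%:E) -?gexp_cst -?gexpD//;
  do ?[by move=> z; rewrite ?addr_ge0 ?mulr_ge0 ?powR_ge0 ?expR_ge0
      | exact: measurable_funM | exact: measurable_funD].
apply: gexp_le => //.
  by apply: measurable_funD => //; [exact: measurable_funD|exact: measurable_funM].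
move=> x; set y := `|x| `^ q; have y0 : 0 <= y by exact: powR_ge0.
apply: (le_trans (expR_le_taylor _)); rewrite ger0_norm ?mulr_ge0//.
by have := taylor_remainder_le t0 e0 y0; lra.
Qed.

Lemma mgf_first_neg (t e : R) : 0 <= t -> 0 < e ->
  (mgf (- t) + t%:E * abs_moment <= 1 + (t ^+ 2 * (2 / e ^+ 2))%:E * mgf (t + e))%E.
Proof.
move=> t0 e0; have mp := measurable_norm_powR.
have mm := measurable_expR_norm_powR.
have c0 : 0 <= t ^+ 2 * (2 / e ^+ 2).
  by rewrite !mulr_ge0 ?sqr_ge0// invr_ge0 sqr_ge0.
have c00 (x : R) : 0 <= t ^+ 2 * (2 / e ^+ 2) * expR ((t + e) * `|x| `^ q).
  by rewrite mulr_ge0.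
have mt : measurable_fun setT (fun x : R => t * `|x| `^ q) by exact: measurable_funM.
have t00 (x : R) : 0 <= t * `|x| `^ q by rewrite mulr_ge0// powR_ge0.
rewrite /mgf -!gexpZ// -?[1%E]/(1%:E) -?gexp_cst -?gexpD//;
  do ?[by move=> z; rewrite ?addr_ge0 ?mulr_ge0 ?powR_ge0 ?expR_ge0
      | exact: measurable_funM | exact: measurable_funD].
apply: gexp_le.
- exact: measurable_funD.
- by apply: measurable_funD => //; exact: measurable_funM.
- by move=> z; rewrite addr_ge0// expR_ge0.
move=> x; set y := `|x| `^ q; have y0 : 0 <= y by exact: powR_ge0.
have := expR_le_taylor (- t * y); rewrite mulNr normrN sqrrN ger0_norm ?mulr_ge0//.
by have := taylor_remainder_le t0 e0 y0; lra.
Qed.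

End mgf.

(** Its value is 0 where [mgf] is infinite, so a finiteness hypothesis goes with it. *)
HB.lock Definition mgfr (R : realType) (q t : R) : R := fine (mgf q t).

(** * Exponential tilting *)

Section tilt.
Context (R : realType) (q : R) (hq : 1 <= q <= 2).
Local Notation M := (mgf q).
Local Notation m := (mgfr q).

Lemma mgf_finE t : (M t < +oo)%E -> M t = (m t)%:E.
Proof.
by move=> Mt; rewrite mgfr.unlock fineK// ge0_fin_numE// ltW// mgf_gt0.
Qed.

Lemma fine_mgf_gt0 t : (M t < +oo)%E -> 0 < m t.
Proof. by move=> Mt; rewrite -lte_fin -mgf_finE// mgf_gt0. Qed.

Lemma mgf_fin_le t t' : t <= t' -> (M t' < +oo)%E -> (M t < +oo)%E.
Proof. by move=> tt'; apply: le_lt_trans; exact: mgf_le. Qed.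

Lemma fine_mgf_le t t' : t <= t' -> (M t' < +oo)%E -> m t <= m t'.
Proof.
move=> tt' Mt'; rewrite -lee_fin -(mgf_finE Mt') -(mgf_finE (mgf_fin_le tt' Mt')).
exact: mgf_le.
Qed.

Lemma fine_mgf_lip u v w e : 0 < e -> u <= v -> v + e <= w -> (M w < +oo)%E ->
  `|m v - m u| <= (v - u) * (m w / e).
Proof.
move=> e0 uv vw Mw; have vu0 : 0 <= v - u by rewrite subr_ge0.
have Mve : (M (v + e) < +oo)%E by exact: mgf_fin_le Mw.
have Mv : (M v < +oo)%E by apply: mgf_fin_le Mve; rewrite lerDl ltW.
have Mu : (M u < +oo)%E by exact: mgf_fin_le Mv.
have := @mgf_lip _ q u (v - u) e vu0 e0.
rewrite subrKC (mgf_finE Mv) (mgf_finE Mu) (mgf_finE Mve) -EFinM -EFinD lee_fin => h.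
rewrite ger0_norm ?subr_ge0; last exact: fine_mgf_le.
have : (v - u) / e * m (v + e) <= (v - u) / e * m w.
  by rewrite ler_wpM2l ?divr_ge0// ?fine_mgf_le// ltW.
rewrite (_ : (v - u) * (m w / e) = (v - u) / e * m w); last by ring.
by lra.
Qed.

Lemma fine_mgf_continuous t e : 0 < e -> (M (t + 2 * e) < +oo)%E ->
  {for t, continuous m}.
Proof.
move=> e0 Mt; apply/cvgrPdist_lt => eps eps0.
pose L := m (t + 2 * e) / e + 1.
have L0 : 0 < L by rewrite ltr_wpDl// divr_ge0 ?ltW// fine_mgf_gt0.
have LL : m (t + 2 * e) / e <= L by rewrite /L lerDl.
near=> s.
have st : `|t - s| < e by near: s; apply/nbhs_ballP; exists e.
have stL : `|t - s| < eps / L.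
  by near: s; apply/nbhs_ballP; exists (eps / L) => //=; rewrite divr_gt0.
rewrite ltr_pdivlMr// in stL; apply: le_lt_trans stL.
have [ts|ts] := leP t s.
  rewrite distrC; apply: le_trans (fine_mgf_lip e0 ts _ Mt) _.
    by move: st; rewrite distrC ger0_norm ?subr_ge0//; lra.
  by rewrite distrC ger0_norm ?subr_ge0// ler_wpM2l// subr_ge0.
apply: le_trans (fine_mgf_lip e0 (ltW ts) _ Mt) _; first lra.
by rewrite ger0_norm ?subr_ge0 ?ler_wpM2l ?subr_ge0// ltW.
Unshelve. all: by end_near. Qed.

(** Together with its left counterpart, it confines the minimum of [mgf t * expR (- t x)], whose
    value at 0 is 1, to a compact interval. For [q = 2] the blow-up at 1/2 is used, for [q < 2] the
    growth at infinity; [e] keeps room inside the domain of finiteness. *)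
Lemma mgf_tilt_right x : 0 < x -> exists b e : R,
  [/\ 0 < b, 0 < e, (M (b + e) < +oo)%E & 1 < m b * expR (- (b * x))].
Proof.
move=> x0; case/andP: hq => q1; rewrite le_eqVlt => /predU1P[q2|q2].
  (* At [b = (1 - w ^ 2) / 2] the function [mgf 2] equals [1 / w = 2 expR (x / 2)], which beats
     [expR (b x)] because [b < 1/2]. *)
  pose w := expR (- (x / 2)) / 2.
  have ex1 : expR (- (x / 2)) <= 1 by rewrite expR_le1; lra.
  have w0 : 0 < w by rewrite divr_gt0// expR_gt0.
  have w1 : w < 1 by rewrite /w; lra.
  have w2 : 0 < w ^+ 2 by rewrite exprn_gt0.
  have w21 : w ^+ 2 < 1 by rewrite exprn_ilt1// ltW.
  exists ((1 - w ^+ 2) / 2), (w ^+ 2 / 4); split; [lra|lra| |].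
    apply: mgf_fin_lt => //; lra.
  have -> : m ((1 - w ^+ 2) / 2) = w^-1.
    rewrite mgfr.unlock mgfE (_ : (fun _ => _) = fun z => expR ((1 - w ^+ 2) / 2 * z ^+ 2)).
      rewrite gexp_sqr/=; last lra.
      rewrite (_ : 1 - _ = w ^+ 2); last by field.
      by rewrite sqrtr_sqr gtr0_norm.
    by apply/funext => z; rewrite q2 powR_mulrn// sqr_abs.
  have -> : w^-1 = 2 * expR (x / 2) by rewrite /w invf_div expRN invrK.
  rewrite -mulrA -expRD.
  have : 1 <= expR (x / 2 - (1 - w ^+ 2) / 2 * x).
    rewrite -[leLHS]expR0 ler_expR.
    by rewrite (_ : _ - _ = w ^+ 2 * x / 2); [rewrite !mulr_ge0// ltW|field].
  lra.
(* As [|z| ^ q >= z - 1], the function is at least [expR (b ^ 2 / 2 - b)]; for [b = 4 (1 + x)] the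
   exponent left after subtracting [b x] is [b (1 + x) > 0]. *)
have b0 : 0 < 4 * (1 + x) by lra.
exists (4 * (1 + x)), 1; split => //; first exact: mgf_fin_q.
set b := 4 * (1 + x).
have Mb : (M b < +oo)%E by exact: mgf_fin_q.
have : expR (b ^+ 2 / 2 - b) <= m b.
  rewrite -lee_fin -mgf_finE//.
  have ml : measurable_fun setT (fun z : R => expR (b * z)).
    by apply: gexp_expR_measurable; exact: measurable_funM.
  rewrite expRD mulrC EFinM -(gexp_lin b) -gexpZ ?expR_ge0//.
  apply: gexp_le; [exact: measurable_funM|exact: measurable_expR_norm_powR| |].
    by move=> z; rewrite mulr_ge0 ?expR_ge0.
  move=> z; rewrite -expRD ler_expR.
  have := norm_powR_ge hq z; have := ler_norm z => h1 h2.
  have : b * (z - 1) <= b * `|z| `^ q by rewrite ler_wpM2l//; [exact: ltW|lra].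
  lra.
move=> h; have := ler_wpM2r (expR_ge0 (- (b * x))) h.
rewrite -expRD; apply: lt_le_trans; rewrite expR_gt1.
have -> : b ^+ 2 / 2 - b + - (b * x) = b * (1 + x) by rewrite /b; field.
by rewrite mulr_gt0//; lra.
Qed.

Lemma mgf_tilt_left x : 0 < x -> exists a : R,
  a < 0 /\ 1 < m a * expR (- (a * x)).
Proof.
move=> x0; have x2 : 0 < x / 2 by lra.
have [C C0 HC] := mgf_lower hq x2.
have xx : 0 < x ^+ 2 by rewrite exprn_gt0.
(* With [e = x / 2] in [mgf_lower] it remains to beat [1 + 2 t C] by [expR (t x)]. Its quadratic
   term is [t (t x ^ 2) / 2] with [t x ^ 2 = 4 C + x ^ 2], which exceeds [2 t C]. *)
pose t := 4 * C / x ^+ 2 + 1.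
have t0 : 0 < t by rewrite ltr_wpDl// !mulr_ge0// ?invr_ge0 ltW.
exists (- t); split; first lra.
have Mt : (M (- t) < +oo)%E by apply: mgf_fin_lt => //; lra.
have := HC t (ltW t0); rewrite mgf_finE// lee_fin => h.
have := ler_wpM2r (expR_ge0 (- (- t * x))) h.
apply: lt_le_trans; rewrite mulrAC -expRD.
rewrite (_ : - (t * (x / 2)) + _ = t * x / 2); last by field.
have tC : 0 < 1 + 2 * t * C by rewrite ltr_wpDr// !mulr_ge0// ltW.
rewrite ltr_pdivlMr ?sqrtr_gt0// mul1r.
rewrite -[ltRHS]ger0_norm ?expR_ge0// -sqrtr_sqr ltr_sqrt ?exprn_gt0 ?expR_gt0//.
rewrite -expRM_natr (_ : t * x / 2 * 2%:R = t * x); last by field.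
apply: (lt_le_trans _ (@expR_ge1Dxn _ _ 1 _)); last by rewrite mulr_ge0// ltW.
rewrite ltrD2l (_ : 2`! = 2)%N// exprMn.
have : t * x ^+ 2 = 4 * C + x ^+ 2 by rewrite /t; field; rewrite gt_eqF.
move=> tx; rewrite (_ : t ^+ 2 * x ^+ 2 / 2%:R = t * (t * x ^+ 2) / 2); last by field.
rewrite tx; have := mulr_gt0 t0 xx; lra.
Qed.

(* The minimizer [t] of [exp(- t x) * mgf t] is the exponential tilt with mean [x];
   the second-order bound [mgf_second] replaces differentiability of [mgf]. *)
Lemma mgf_tilt x : 0 < x -> exists2 t : R, (M t < +oo)%E &
  forall d, 0 < d -> exists h : R,
  [/\ 0 < h, (M (t + h) < +oo)%E,
      m (t + h) * expR (- (h * (x + d))) < m t &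
      m (t - h) * expR (h * (x - d)) < m t].
Proof.
move=> x0.
have [b [e [b0 e0 Mbe fb]]] := mgf_tilt_right x0.
have [a [a0 fa]] := mgf_tilt_left x0.
pose f t := m t * expR (- (t * x)).
have ab : a <= b by apply: ltW; apply: lt_trans b0.
have cf : {within `[a, b], continuous f}.
  apply: continuous_in_subspaceT => t; rewrite inE/= in_itv/= => /andP[at' tb].
  apply: cvgM.
    apply: (@fine_mgf_continuous _ (e / 2)); first by rewrite divr_gt0.
    by apply: mgf_fin_le Mbe; lra.
  apply: continuous_comp; last exact: continuous_expR.
  apply: cvgN; apply: cvgMl; exact: cvg_id.
(* As [f 0 = 1] lies below both end values, the minimizer is interior. *)
have [t + tmin] := EVT_min ab cf.
rewrite in_itv/= => /andP[at' tb].
have f0 : f 0 = 1 by rewrite /f mgfr.unlock mgf0/= mul0r oppr0 expR0 mulr1.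
have ft1 : f t <= 1.
  by rewrite -f0; apply: tmin; rewrite in_itv/= !ltW.
have {}at' : a < t.
  rewrite lt_neqAle at' andbT; apply/eqP => ta; move: ft1; rewrite -ta.
  by apply/negP; rewrite -ltNge.
have {}tb : t < b.
  rewrite lt_neqAle tb andbT; apply/eqP => ta; move: ft1; rewrite ta.
  by apply/negP; rewrite -ltNge.
pose r := Num.min (t - a) (Num.min (b - t) (e / 2)).
have r0 : 0 < r by rewrite !lt_min !subr_gt0 at' tb /= divr_gt0.
have ra : r <= t - a by rewrite ge_min lexx.
have rb : r <= b - t by rewrite !ge_min lexx orbT.
have re : r <= e / 2 by rewrite !ge_min lexx !orbT.
have Mr : (M (t + 2 * r) < +oo)%E by apply: mgf_fin_le Mbe; lra.
have Mt : (M t < +oo)%E by apply: mgf_fin_le Mr; lra.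
have mt0 := fine_mgf_gt0 Mt.
pose B := 4 / r ^+ 2 * expR (2 * r * x) * m (t + 2 * r).
have B0 : 0 < B.
  by rewrite !mulr_gt0 ?expR_gt0 ?fine_mgf_gt0// invr_gt0 exprn_gt0.
exists t => // d d0.
(* Minimality bounds each of the two terms of [mgf_second] below by [m t], hence each is at most
   [m t + h ^ 2 B]. This [h] keeps [h ^ 2 B] below the gain [h d m t] offered by [expR (h d)]. *)
pose h := Num.min r (d * m t / (2 * B)).
have h0 : 0 < h.
  by rewrite lt_min r0 /= divr_gt0 // mulr_gt0.
have hr : h <= r by rewrite ge_min lexx.
have hB : h * (2 * B) <= d * m t.
  have B2 : 0 < 2 * B by rewrite mulr_gt0.
  by rewrite -(ler_pdivlMr _ _ B2) ge_min lexx orbT.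
have Mp : (M (t + h) < +oo)%E by apply: mgf_fin_le Mr; lra.
have Mm : (M (t - h) < +oo)%E by apply: mgf_fin_le Mt; lra.
have := mgf_second q t (ltW h0) r0 hr (ltW x0).
rewrite (mgf_finE Mp) (mgf_finE Mm) (mgf_finE Mt) (mgf_finE Mr).
rewrite -!EFinM -!EFinD lee_fin => sec.
have minp : m t <= expR (- (h * x)) * m (t + h).
  have : f t <= f (t + h) by apply: tmin; rewrite in_itv/=; apply/andP; split; lra.
  rewrite /f (_ : - ((t + h) * x) = - (h * x) + - (t * x)); last by ring.
  by rewrite expRD mulrA ler_pM2r ?expR_gt0// mulrC.
have minm : m t <= expR (h * x) * m (t - h).
  have : f t <= f (t - h) by apply: tmin; rewrite in_itv/=; apply/andP; split; lra.
  rewrite /f (_ : - ((t - h) * x) = h * x + - (t * x)); last by ring.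
  by rewrite expRD mulrA ler_pM2r ?expR_gt0// mulrC.
have sec' : h ^+ 2 * (4 / r ^+ 2 * expR (2 * r * x)) * m (t + 2 * r) < m t * (h * d).
  rewrite -mulrA -/B expr2; have : 0 < h * (d * m t) by rewrite !mulr_gt0.
  have := ler_wpM2l (ltW h0) hB; lra.
have up : m t * (1 + h * d) <= m t * expR (h * d).
  by rewrite ler_wpM2l ?expR_ge1Dx// ltW.
exists h; split => //.
- rewrite (_ : - (h * (x + d)) = - (h * x) - h * d); last by ring.
  rewrite expRD mulrA mulrC -ltr_pdivlMl ?expR_gt0// -expRN opprK [ltRHS]mulrC.
  rewrite (mulrC (m _) (expR _)); lra.
- rewrite (_ : h * (x - d) = h * x - h * d); last by ring.
  rewrite expRD mulrA mulrC -ltr_pdivlMl ?expR_gt0// -expRN opprK [ltRHS]mulrC.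
  rewrite (mulrC (m _) (expR _)); lra.
Qed.

End tilt.

(** * The Legendre transform at 0 and its zero *)

Section Lambda_star_theory.
Context (R : realType) (q : R) (hq : 1 <= q <= 2).
Local Notation M := (mgf q).
Local Notation m := (mgfr q).

Lemma Lambda_mgfr t : (M t < +oo)%E -> Lambda q t = (ln (m t))%:E.
Proof.
by move=> Mt; rewrite Lambda_mgf (mgf_finE hq Mt) lne_EFin// (fine_mgf_gt0 hq Mt).
Qed.

Lemma Lambda_star_ge x t : (M t < +oo)%E ->
  ((x * t - ln (m t))%:E <= Lambda_star q x)%E.
Proof.
move=> Mt; apply: ereal_sup_ubound; exists t => //.
by rewrite (Lambda_mgfr Mt).
Qed.

Lemma Lambda_star_gt x (a : R) : (a%:E < Lambda_star q x)%E ->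
  exists t, (M t < +oo)%E /\ a < x * t - ln (m t).
Proof.
move=> /ereal_sup_gt[_ [t _ <-]]; have [Mt|] := ltP (M t) +oo%E.
  by rewrite (Lambda_mgfr Mt) -EFinB lte_fin; exists t.
by rewrite leye_eq => /eqP Mt; rewrite Lambda_mgf Mt.
Qed.

(** Letting [t] tend to [-oo] sends [mgf] to 0, so [- Lambda] is unbounded. This is why only
    positive values of the projected factor count in the rates. *)
Lemma Lambda_star0 : Lambda_star q 0 = +oo%E.
Proof.
apply/eqP; rewrite eq_le leey /= leNgt; apply/negP => /ereal_between[a [La _]].
have {La} : (Lambda_star q 0 < `|a|%:E)%E.
  by apply: lt_le_trans La _; rewrite lee_fin ler_norm.
apply/negP; rewrite -leNgt.
(* Both terms of [mgf_neg] are then at most [1 / w], and they add up to [expR (- |a|)]. *)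
pose w := 2 * expR `|a|.
have w1 : 1 <= w by have := expR_ge1Dx `|a|; have := normr_ge0 a; rewrite /w; lra.
pose t := (w ^+ 2 - 1) / 2.
have t0 : 0 <= t by rewrite divr_ge0// subr_ge0 exprn_ege1.
have Mt : (M (- t) < +oo)%E by apply: mgf_fin_lt => //; lra.
have := mgf_neg hq t0; rewrite (mgf_finE hq Mt) lee_fin.
rewrite (_ : 1 + 2 * t = w ^+ 2); last by rewrite /t; field.
rewrite sqrtr_sqr ger0_norm; last lra.
have w0 : 0 < w by lra.
have et : expR (- t) <= w^-1.
  rewrite expRN lef_pV2 ?posrE ?expR_gt0//.
  apply: le_trans (expR_ge1Dx _); rewrite /t; have := sqr_ge0 (w - 1); lra.
move=> h; have {}h : m (- t) <= expR (- `|a|).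
  apply: le_trans h _; rewrite (_ : expR (- `|a|) = w^-1 + w^-1); first by rewrite lerD2l.
  by rewrite /w expRN; field; rewrite gt_eqF// expR_gt0.
apply: le_trans (Lambda_star_ge 0 Mt); rewrite lee_fin mul0r sub0r lerNr.
rewrite -[leRHS]expRK ler_ln ?posrE ?expR_gt0//.
exact: fine_mgf_gt0.
Qed.

Lemma ln_le_sub1 (x : R) : 0 < x -> ln x <= x - 1.
Proof.
move=> x0; have := @le_ln1Dx R (x - 1); rewrite subrKC; apply; lra.
Qed.

(** For a small [t] with the sign of [x - mu], the linear gain [t (x - mu)] beats the quadratic
    remainder of [ln (mgf t) <= mgf t - 1]. *)
Lemma Lambda_star_gt0 x : x != gauss_moment q -> (0 < Lambda_star q x)%E.
Proof.
set mu := gauss_moment q => xmu.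
have muE : abs_moment q = mu%:E.
  by rewrite /mu gauss_momentE// fineK// abs_moment_fin.
have e8 : 0 < (1 / 8 : R) by lra.
have M4 : (M (1 / 4) < +oo)%E by apply: mgf_fin_lt => //; lra.
pose B := 2 / (1 / 8) ^+ 2 * m (1 / 4).
have B0 : 0 < B by rewrite !mulr_gt0 ?(fine_mgf_gt0 hq M4)// invr_gt0 exprn_gt0.
pose r := `|x - mu|.
have r0 : 0 < r by rewrite normr_gt0 subr_eq0.
pose t := Num.min (1 / 8) (r / (2 * B)).
have B2 : 0 < 2 * B by rewrite mulr_gt0.
have t0 : 0 < t by rewrite lt_min e8 /= divr_gt0.
have t8 : t <= 1 / 8 by rewrite ge_min lexx.
have tB : t * (2 * B) <= r by rewrite -(ler_pdivlMr _ _ B2) ge_min lexx orbT.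
have Mt8 : (M (t + 1 / 8) < +oo)%E by apply: mgf_fin_lt => //; lra.
have m8 : m (t + 1 / 8) <= m (1 / 4) by apply: fine_mgf_le => //; lra.
have tt : t ^+ 2 * (2 / (1 / 8) ^+ 2) * m (t + 1 / 8) <= t ^+ 2 * B.
  rewrite /B [leRHS]mulrA ler_wpM2l//; apply: mulr_ge0; first exact: sqr_ge0.
  by rewrite divr_ge0// exprn_ge0//; lra.
have tt2 : t ^+ 2 * B < t * r.
  rewrite expr2 -mulrA ltr_pM2l//; have := mulr_gt0 t0 B0; lra.
have [xlt|xgt] := ltP mu x.
  have Mt : (M t < +oo)%E by apply: mgf_fin_lt => //; lra.
  have := @mgf_first_pos _ q t (1 / 8) (ltW t0) e8.
  rewrite muE (mgf_finE hq Mt) (mgf_finE hq Mt8) -!EFinM -!EFinD lee_fin => h.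
  apply: lt_le_trans (Lambda_star_ge x Mt); rewrite lte_fin.
  have := ln_le_sub1 (fine_mgf_gt0 hq Mt).
  have : t * r = t * x - t * mu.
    by rewrite /r ger0_norm ?subr_ge0 ?ltW//; ring.
  lra.
have Mt : (M (- t) < +oo)%E by apply: mgf_fin_lt => //; lra.
have := @mgf_first_neg _ q t (1 / 8) (ltW t0) e8.
rewrite muE (mgf_finE hq Mt) (mgf_finE hq Mt8) -!EFinM -!EFinD lee_fin => h.
apply: lt_le_trans (Lambda_star_ge x Mt); rewrite lte_fin.
have := ln_le_sub1 (fine_mgf_gt0 hq Mt).
have : t * r = t * mu - t * x.
  by rewrite /r ler0_norm ?subr_le0//; ring.
lra.
Qed.

End Lambda_star_theory.

Lemma mgf2 (R : realType) (t : R) : t < 1 / 2 ->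
  mgf 2 t = (Num.sqrt (1 - 2 * t))^-1%:E.
Proof.
move=> t2; rewrite mgfE (_ : (fun _ => _) = fun z : R => expR (t * z ^+ 2)).
  exact: gexp_sqr.
by apply/funext => z; rewrite powR_mulrn// sqr_abs.
Qed.

Lemma abs_moment_mgf_le (R : realType) (q t : R) : 0 <= t ->
  (1 + t%:E * abs_moment q <= mgf q t)%E.
Proof.
move=> t0; have mp := measurable_norm_powR q.
have mm := measurable_expR_norm_powR q.
have p0 (x : R) : 0 <= `|x| `^ q by exact: powR_ge0.
have tp0 (x : R) : 0 <= t * `|x| `^ q by rewrite mulr_ge0.
have mt : measurable_fun setT (fun x : R => t * `|x| `^ q) by exact: measurable_funM.
rewrite mgfE /abs_moment -gexpZ// -[1%E]/(1%:E) -gexp_cst -gexpD//.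
apply: gexp_le => //; first exact: measurable_funD.
  by move=> x; rewrite addr_ge0.
by move=> x; exact: expR_ge1Dx.
Qed.

Lemma abs_moment_mgf_neg (R : realType) (q t : R) : 0 <= t ->
  (1 <= mgf q (- t) + t%:E * abs_moment q)%E.
Proof.
move=> t0; have mp := measurable_norm_powR q.
have mm := measurable_expR_norm_powR q.
have p0 (x : R) : 0 <= `|x| `^ q by exact: powR_ge0.
have tp0 (x : R) : 0 <= t * `|x| `^ q by rewrite mulr_ge0.
have e0 (x : R) : 0 <= expR (- t * `|x| `^ q) by exact: expR_ge0.
have mt : measurable_fun setT (fun x : R => t * `|x| `^ q) by exact: measurable_funM.
rewrite mgfE /abs_moment -gexpZ// -gexpD// -[leLHS]/(1%:E) -gexp_cst.
apply: gexp_le => //; first exact: measurable_funD.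
by move=> x; have := expR_ge1Dx (- t * `|x| `^ q); lra.
Qed.

Lemma gauss_moment2 (R : realType) : gauss_moment (2 : R) = 1.
Proof.
(* compare [mgf 2 t = (1 - 2 t)^(-1/2)] with the tangent line [1 + t * E X^2] *)
have h2 : 1 <= (2 : R) <= 2 by lra.
have muE : abs_moment (2 : R) = (gauss_moment 2)%:E.
  by rewrite gauss_momentE// fineK// abs_moment_fin.
set mu := gauss_moment (2 : R) in muE *.
apply/eqP; rewrite eq_le; apply/andP; split.
- rewrite leNgt; apply/negP => mu1.
  pose t := Num.min (1 / 4) ((mu - 1) / 8).
  have t0 : 0 < t by rewrite lt_min !divr_gt0// subr_gt0.
  have t4 : t <= 1 / 4 by rewrite ge_min lexx.
  have t8 : t <= (mu - 1) / 8 by rewrite ge_min lexx orbT.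
  have := abs_moment_mgf_le 2 (ltW t0).
  rewrite muE mgf2; last lra.
  rewrite -EFinM -EFinD lee_fin; apply/negP; rewrite -ltNge.
  (* For [t <= 1/4] this bounds [(1 - 2 t) ^ (-1/2)], and [t <= (mu - 1) / 8] keeps [4 t ^ 2] below
     [t (mu - 1)]. *)
  apply: (@le_lt_trans _ _ (1 + t + 4 * t ^+ 2)); last by nra.
  have w0 : 0 < Num.sqrt (1 - 2 * t) by rewrite sqrtr_gt0; lra.
  rewrite -[leLHS]mul1r ler_pdivrMr// -(@ler_pXn2r _ 2) ?nnegrE//; last first.
    by rewrite mulr_ge0// ?ltW//; nra.
  rewrite exprMn sqr_sqrtr; last lra.
  have : 0 <= t ^+ 2 * (1 - 4 * t) by rewrite mulr_ge0 ?sqr_ge0//; lra.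
  have : 0 <= t ^+ 2 by exact: sqr_ge0.
  have : 0 <= t ^+ 4 by exact: exprn_even_ge0.
  have : 0 <= t ^+ 4 * (1 - 4 * t) by rewrite mulr_ge0 ?exprn_even_ge0//; lra.
  have : 0 <= t ^+ 3 by rewrite exprn_ge0 ?ltW.
  rewrite expr1n.
  have -> : (1 + t + 4 * t ^+ 2) ^+ 2 * (1 - 2 * t) =
    1 + 5 * t ^+ 2 - 10 * t ^+ 3 - 32 * t ^+ 5 by ring.
  have -> : t ^+ 4 * (1 - 4 * t) = t ^+ 4 - 4 * t ^+ 5 by ring.
  have -> : t ^+ 2 * (1 - 4 * t) = t ^+ 2 - 4 * t ^+ 3 by ring.
  have : 0 <= t ^+ 2 * (1 / 4 - t) * (1 / 4 + t).
    by rewrite !mulr_ge0 ?sqr_ge0//; lra.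
  have -> : t ^+ 2 * (1 / 4 - t) * (1 / 4 + t) = t ^+ 2 / 16 - t ^+ 4 by field.
  lra.
- rewrite leNgt; apply/negP => mu1.
  pose t := Num.min (1 / 4) ((1 - mu) / 8).
  have t0 : 0 < t by rewrite lt_min !divr_gt0// subr_gt0.
  have t4 : t <= 1 / 4 by rewrite ge_min lexx.
  have t8 : t <= (1 - mu) / 8 by rewrite ge_min lexx orbT.
  have := abs_moment_mgf_neg 2 (ltW t0).
  rewrite muE mgf2; last lra.
  rewrite -EFinM -EFinD lee_fin mulrN opprK; apply/negP; rewrite -ltNge.
  apply: (@le_lt_trans _ _ (1 - t + 2 * t ^+ 2 + t * mu)); last by nra.
  rewrite lerD2r.
  have w0 : 0 < Num.sqrt (1 + 2 * t) by rewrite sqrtr_gt0; lra.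
  rewrite -[leLHS]mul1r ler_pdivrMr// -(@ler_pXn2r _ 2) ?nnegrE//; last first.
    by rewrite mulr_ge0// ?ltW//; nra.
  rewrite exprMn sqr_sqrtr; last lra.
  rewrite expr1n.
  have -> : (1 - t + 2 * t ^+ 2) ^+ 2 * (1 + 2 * t) =
    1 + t ^+ 2 + 6 * t ^+ 3 - 4 * t ^+ 4 + 8 * t ^+ 5 by ring.
  have : 0 <= t ^+ 3 by rewrite exprn_ge0 ?ltW.
  have : 0 <= t ^+ 5 by rewrite exprn_ge0 ?ltW.
  have : 0 <= t ^+ 3 * (1 / 4 - t) by rewrite !mulr_ge0 ?sqr_ge0//; lra.
  have -> : t ^+ 3 * (1 / 4 - t) = t ^+ 3 / 4 - t ^+ 4 by field.
  have := sqr_ge0 t; lra.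
Qed.

Lemma powR_near (R : realType) (p c r : R) : 0 < p -> 0 <= c -> 0 < r ->
  exists2 d, 0 < d & forall z, 0 <= z -> `|z - c| < d -> `|z `^ p - c `^ p| < r.
Proof.
move=> p0 c0 r0; have pK (x : R) : 0 <= x -> (x `^ p^-1) `^ p = x.
  by move=> x0; rewrite -powRrM mulVf ?gt_eqF// powRr1.
have Kp (x : R) : 0 <= x -> (x `^ p) `^ p^-1 = x.
  by move=> x0; rewrite -powRrM mulfV ?gt_eqF// powRr1.
have ip : 0 < p^-1 by rewrite invr_gt0.
have cp0 := powR_ge0 c p.
pose H := (c `^ p + r) `^ p^-1.
have cH : c < H.
  rewrite -[ltLHS](Kp c c0); apply: gt0_ltr_powR; rewrite ?nnegrE//; lra.
have H0 : 0 <= H by exact: powR_ge0.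
have HE : H `^ p = c `^ p + r by rewrite pK//; lra.
have up z : 0 <= z -> z < H -> z `^ p < c `^ p + r.
  by move=> z0 zH; rewrite -HE; apply: gt0_ltr_powR.
have [cr|cr] := ltP (c `^ p - r) 0.
  exists (H - c); first by rewrite subr_gt0.
  move=> z z0; rewrite !ltr_norml => /andP[_ zH].
  by have := up z z0; have := powR_ge0 z p; lra.
pose L := (c `^ p - r) `^ p^-1.
have Lc : L < c.
  rewrite -[ltRHS](Kp c c0); apply: gt0_ltr_powR; rewrite ?nnegrE//; lra.
have L0 : 0 <= L by exact: powR_ge0.
have LE : L `^ p = c `^ p - r by rewrite pK.
clearbody L H; exists (Num.min (H - c) (c - L)); first by rewrite lt_min !subr_gt0 cH.
move=> z z0; rewrite lt_min => /andP[]; rewrite !ltr_norml => /andP[_ zH] /andP[zL _].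
have : L `^ p < z `^ p by apply: gt0_ltr_powR; rewrite ?nnegrE//; lra.
rewrite LE; have := up z z0; lra.
Qed.

(** * Cramer's theorem for power means *)

Section cramer.
Context (R : realType) (q : R) (hq : 1 <= q <= 2).
Local Notation M := (mgf q).
Local Notation m := (mgfr q).

Definition powR_sum n (v : n.-tuple R) : R := \sum_(i < n) `|tnth v i| `^ q.

Lemma measurable_powR_sum n : measurable_fun setT (@powR_sum n).
Proof.
apply: measurable_sum => i.
exact: measurableT_comp (measurable_norm_powR q) (measurable_tnth i).
Qed.

Lemma powR_sum_ge0 n (v : n.-tuple R) : 0 <= powR_sum v.
Proof. by apply: sumr_ge0 => i _; exact: powR_ge0. Qed.

Lemma measurable_expR_powR_sum n (t : R) :
  measurable_fun setT (fun v : n.-tuple R => (expR (t * powR_sum v))%:E).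
Proof.
apply/measurable_EFinP; apply: measurableT_comp => //.
by apply: measurable_funM => //; exact: measurable_powR_sum.
Qed.

Lemma mgf_prod n t : (M t < +oo)%E ->
  (\int[gaussn R n]_v (expR (t * powR_sum v))%:E = (m t ^+ n)%:E)%E.
Proof.
move=> Mt; elim: n => [|n IHn].
  rewrite (_ : (fun _ => _) = cst 1%E); last first.
    by apply/funext => v; rewrite /powR_sum big_ord0 mulr0 expR0.
  by rewrite integral_cst//= probability_setT mul1e.
have e0 (x : R) : (0 <= (expR x)%:E)%E by rewrite lee_fin expR_ge0.
rewrite (ge0_integral_gaussnS (@measurable_expR_powR_sum _ t) (fun _ => e0 _)).
transitivity (\int[gauss1 R]_x ((m t ^+ n)%:E * (expR (t * `|x| `^ q))%:E))%E.
  apply: eq_integral => x _; rewrite muleC -IHn.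
  rewrite -(@ge0_integralZl _ _ _ (gaussn R n) setT measurableT _
    (@measurable_expR_powR_sum _ t) (expR (t * `|x| `^ q))%:E (fun _ _ => e0 _) (e0 _)).
  apply: eq_integral => v _; rewrite -EFinM -expRD /powR_sum big_ord_recl -mulrDr.
  rewrite tnth0; congr (expR (t * (_ + _)))%:E.
  by apply: eq_bigr => i _; rewrite tnthS.
have mt : (0 <= (m t ^+ n)%:E)%E by rewrite lee_fin exprn_ge0// ltW// fine_mgf_gt0.
rewrite (@ge0_integralZl _ _ _ (gauss1 R) setT measurableT _ _
  (m t ^+ n)%:E (fun _ _ => e0 _) mt); last first.
  by apply/measurable_EFinP; exact: measurable_expR_norm_powR.
by rewrite -[X in (_ * X)%E]/(gexp _) -mgfE (mgf_finE hq Mt) -EFinM exprSr.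
Qed.

(** The exponential Chebyshev inequality, with the factorization of the moment generating function
    over independent coordinates. *)
Lemma gaussn_le_integral n (A : set (n.-tuple R)) (c t : R) : (M t < +oo)%E ->
  measurable A -> 0 <= c ->
  (forall v, A v -> 1 <= c * expR (t * powR_sum v)) ->
  (gaussn R n A <= (c * m t ^+ n)%:E)%E.
Proof.
move=> Mt mA c0 Ac.
have e0 (x : R) : (0 <= (expR x)%:E)%E by rewrite lee_fin expR_ge0.
rewrite EFinM -mgf_prod//.
rewrite -(@ge0_integralZl _ _ _ (gaussn R n) setT measurableT _
    (@measurable_expR_powR_sum _ t) c%:E (fun _ _ => e0 _)) ?lee_fin//.
rewrite -[X in gaussn R n X]setIT -integral_indic//; apply: ge0_le_integral => //.
- by apply/measurable_EFinP; exact: measurable_indic.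
- apply: emeasurable_funM => //; exact: measurable_expR_powR_sum.
- move=> v _; rewrite -EFinM lee_fin indicE; case: (boolP (v \in A)) => [|_].
    by rewrite inE => /Ac.
  by rewrite mulr_ge0// expR_ge0.
Qed.

Lemma expRn_ln n (x : R) : 0 < x -> x ^+ n = expR (n%:R * ln x).
Proof. by move=> x0; rewrite mulrC expRM_natr lnK. Qed.

Lemma measurable_ball_sum n (x d : R) :
  measurable [set v : n.-tuple R | (`|n%:R^-1 * powR_sum v - x| < d)%R].
Proof.
apply: (@measurable_ballE R (fun=> _) (fun=> n.-tuple R) (fun=> fun v => n%:R^-1 * powR_sum v) 0%N).
by apply: measurable_funM => //; exact: measurable_powR_sum.
Qed.

Lemma gaussn_ball_le n (t x d : R) : (0 < n)%N -> (M t < +oo)%E ->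
  (gaussn R n [set v | (`|n%:R^-1 * powR_sum v - x| < d)%R] <=
   (expR (- (n%:R * (x * t - `|t| * d - ln (m t)))))%:E)%E.
Proof.
move=> n0 Mt; have nR : 0 < n%:R :> R by rewrite ltr0n.
have mt0 := fine_mgf_gt0 hq Mt.
apply: le_trans (gaussn_le_integral Mt _ (expR_ge0 (- (n%:R * (x * t - `|t| * d)))) _) _.
- exact: measurable_ball_sum.
- move=> v /= vx; rewrite -expRD -[leLHS]expR0 ler_expR.
  set S := powR_sum v in vx *.
  have SE : S = n%:R * (n%:R^-1 * S) by rewrite mulVKf// gt_eqF.
  rewrite [in leRHS]SE; set z := n%:R^-1 * S in vx *.
  have : - (t * (z - x)) <= `|t| * d.
    apply: le_trans (ler_norm _) _; rewrite normrN normrM ler_wpM2l//; exact: ltW.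
  move=> /(ler_wpM2l (ltW nR)); lra.
- by rewrite lee_fin (expRn_ln _ mt0) -expRD ler_expR; lra.
Qed.

Lemma gaussn_tail_le n (t z : R) : (0 < n)%N -> (M t < +oo)%E -> 0 <= t ->
  (gaussn R n [set v | (z <= n%:R^-1 * powR_sum v)%R] <=
   (expR (- (n%:R * (z * t - ln (m t)))))%:E)%E.
Proof.
move=> n0 Mt t0; have nR : 0 < n%:R :> R by rewrite ltr0n.
have mt0 := fine_mgf_gt0 hq Mt.
apply: le_trans (gaussn_le_integral Mt _ (expR_ge0 (- (n%:R * (z * t)))) _) _.
- rewrite -[X in measurable X]setTI; apply: (@measurable_fun_ler _ _ _ setT) => //.
  by apply: measurable_funM => //; exact: measurable_powR_sum.
- move=> v /= vz; rewrite -expRD -[leLHS]expR0 ler_expR.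
  set S := powR_sum v in vz *.
  have SE : S = n%:R * (n%:R^-1 * S) by rewrite mulVKf// gt_eqF.
  rewrite [in leRHS]SE; have := ler_wpM2l (ltW nR) (ler_wpM2r t0 vz); lra.
- by rewrite lee_fin (expRn_ln _ mt0) -expRD ler_expR; lra.
Qed.

(** With [S] the sum, [expR (t S)] is at most the sum of three terms pointwise. On the ball the
    first suffices; off it [S / n] is at least [x + d] or at most [x - d], and the shift by [h] or
    [- h] pays. After integration the last two terms are the geometric errors that [mgf_tilt] makes
    small against [m t ^ n]. *)
Lemma gaussn_ball_ge n (t h x d : R) : (0 < n)%N -> 0 < h -> (M (t + h) < +oo)%E ->
  ((m t ^+ n)%:E <=
   (expR (n%:R * (x * t + `|t| * d)))%:E *
     gaussn R n [set v | (`|n%:R^-1 * powR_sum v - x| < d)%R] +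
   ((m (t + h) * expR (- (h * (x + d)))) ^+ n)%:E +
   ((m (t - h) * expR (h * (x - d))) ^+ n)%:E)%E.
Proof.
move=> n0 h0 Mp; have nR : 0 < n%:R :> R by rewrite ltr0n.
have Mt : (M t < +oo)%E by apply: (mgf_fin_le _ Mp); lra.
have Mm : (M (t - h) < +oo)%E by apply: (mgf_fin_le _ Mp); lra.
set A := [set v | _]; have mA : measurable A by exact: measurable_ball_sum.
pose c1 := expR (n%:R * (x * t + `|t| * d)).
pose c2 := expR (- (h * (x + d))) ^+ n.
pose c3 := expR (h * (x - d)) ^+ n.
have e0 (y : R) : (0 <= (expR y)%:E)%E by rewrite lee_fin expR_ge0.
have i0 (v : n.-tuple R) : (0 <= (\1_A v)%:E :> \bar R)%E by rewrite lee_fin.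
have c10 : (0 <= c1%:E)%E by exact: e0.
have c20 : (0 <= c2%:E)%E by rewrite lee_fin exprn_ge0// expR_ge0.
have c30 : (0 <= c3%:E)%E by rewrite lee_fin exprn_ge0// expR_ge0.
have me s := @measurable_expR_powR_sum n s.
have mi : measurable_fun setT (fun v => (\1_A v)%:E : \bar R).
  by apply/measurable_EFinP; exact: measurable_indic.
rewrite !exprMn -/c2 -/c3 -/c1 (mulrC _ c2) (mulrC _ c3) !(EFinM, EFinD).
rewrite -[X in gaussn R n X]setIT -[X in (c1%:E * X)%E]integral_indic//.
rewrite -!mgf_prod//.
rewrite -(@ge0_integralZl _ _ _ (gaussn R n) setT measurableT _ mi c1%:E (fun _ _ => i0 _) c10).
rewrite -(@ge0_integralZl _ _ _ (gaussn R n) setT measurableT _ (me (t + h)) c2%:E (fun _ _ => e0 _) c20).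
rewrite -(@ge0_integralZl _ _ _ (gaussn R n) setT measurableT _ (me (t - h)) c3%:E (fun _ _ => e0 _) c30).
have m1 : measurable_fun setT (fun v => c1%:E * (\1_A v)%:E : \bar R)%E.
  exact: emeasurable_funM.
have m2 : measurable_fun setT (fun v : n.-tuple R => c2%:E * (expR ((t + h) * powR_sum v))%:E : \bar R)%E.
  exact: emeasurable_funM.
have m3 : measurable_fun setT (fun v : n.-tuple R => c3%:E * (expR ((t - h) * powR_sum v))%:E : \bar R)%E.
  exact: emeasurable_funM.
have p1 v : (0 <= c1%:E * (\1_A v)%:E :> \bar R)%E by rewrite mule_ge0.
have p2 (v : n.-tuple R) : (0 <= c2%:E * (expR ((t + h) * powR_sum v))%:E)%E by rewrite mule_ge0.
have p3 (v : n.-tuple R) : (0 <= c3%:E * (expR ((t - h) * powR_sum v))%:E)%E by rewrite mule_ge0.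
rewrite -(@ge0_integralD _ _ _ (gaussn R n) setT measurableT _ _ (fun _ _ => p1 _) m1 (fun _ _ => p2 _) m2).
have p12 v : (0 <= c1%:E * (\1_A v)%:E + c2%:E * (expR ((t + h) * powR_sum v))%:E)%E.
  by rewrite adde_ge0.
rewrite -(@ge0_integralD _ _ _ (gaussn R n) setT measurableT _ _ (fun _ _ => p12 _)
  (emeasurable_funD m1 m2) (fun _ _ => p3 _) m3).
apply: (@ge0_le_integral _ _ _ (gaussn R n) setT measurableT).
- by move=> v _; exact: e0.
- exact: me.
- by apply: emeasurable_funD => //; exact: emeasurable_funD.
move=> v _; rewrite -!EFinM -!EFinD lee_fin.
set S := powR_sum v.
have SE : S = n%:R * (n%:R^-1 * S) by rewrite mulVKf// gt_eqF.
have cc2 : c2 = expR (- (n%:R * (h * (x + d)))).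
  by rewrite /c2 -expRM_natl mulrN.
have cc3 : c3 = expR (n%:R * (h * (x - d))) by rewrite /c3 -expRM_natl.
have g1 : 0 <= c1 * \1_A v by rewrite mulr_ge0 ?expR_ge0.
have g2 : 0 <= c2 * expR ((t + h) * S) by rewrite mulr_ge0 ?expR_ge0// -lee_fin.
have g3 : 0 <= c3 * expR ((t - h) * S) by rewrite mulr_ge0 ?expR_ge0// -lee_fin.
have [vA|vA] := boolP (v \in A).
  have : expR (t * S) <= c1 * \1_A v.
    rewrite indicE vA mulr1 ler_expR; move: vA; rewrite inE /A/= -/S.
    rewrite [in leLHS]SE; set z := n%:R^-1 * S => zx.
    have : t * (z - x) <= `|t| * d.
      by apply: le_trans (ler_norm _) _; rewrite normrM ler_wpM2l//; exact: ltW.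
    move=> /(ler_wpM2l (ltW nR)); lra.
  lra.
move: vA; rewrite notin_setE /A/= -/S => /negP; rewrite -leNgt => zx.
have {zx} : x + d <= n%:R^-1 * S \/ n%:R^-1 * S <= x - d.
  by move: zx; rewrite ler_normr => /orP[?|?]; [left|right]; lra.
move=> [] zx.
  have : expR (t * S) <= c2 * expR ((t + h) * S).
    rewrite cc2 -expRD ler_expR.
    have := ler_wpM2l (ltW nR) (ler_wpM2l (ltW h0) zx).
    rewrite (_ : n%:R * (h * (n%:R^-1 * S)) = h * S); first lra.
    by rewrite mulrCA -SE.
  lra.
have : expR (t * S) <= c3 * expR ((t - h) * S).
  rewrite cc3 -expRD ler_expR.
  have := ler_wpM2l (ltW nR) (ler_wpM2l (ltW h0) zx).
  rewrite (_ : n%:R * (h * (n%:R^-1 * S)) = h * S); first lra.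
  by rewrite mulrCA -SE.
lra.
Qed.

Lemma gaussn_ball_lower (x d a : R) : 0 < x -> 0 < d -> (Lambda_star q x < a%:E)%E ->
  \forall n \near \oo, ((expR (- (n%:R * a)))%:E <=
    gaussn R n [set v | (`|n%:R^-1 * powR_sum v - x| < d)%R])%E.
Proof.
move=> x0 d0 xa.
have [t Mt tilt] := mgf_tilt hq x0.
have mt0 := fine_mgf_gt0 hq Mt.
have gap : x * t - ln (m t) < a.
  by rewrite -lte_fin; apply: le_lt_trans xa; exact: Lambda_star_ge.
(* The ball is shrunk so that the loss [|t| e] uses at most half of the gap between the tilted
   exponent and [a]. *)
pose e := Num.min d ((a - (x * t - ln (m t))) / (2 * (`|t| + 1))).
have T0 : 0 < 2 * (`|t| + 1) by rewrite mulr_gt0// ltr_wpDl.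
have e0 : 0 < e by rewrite lt_min d0 /= divr_gt0// subr_gt0.
have ed : e <= d by rewrite ge_min lexx.
have et : e * (2 * (`|t| + 1)) <= a - (x * t - ln (m t)).
  by rewrite -(ler_pdivlMr _ _ T0) ge_min lexx orbT.
have ba : x * t + `|t| * e - ln (m t) < a by lra.
have [h [h0 Mp lp lm]] := tilt e e0.
pose r1 := m (t + h) * expR (- (h * (x + e))) / m t.
pose r2 := m (t - h) * expR (h * (x - e)) / m t.
(* Both error ratios being below 1, their powers drop below 1/4, and the ball keeps at least half of
   [m t ^ n]. *)
have small (r : R) : 0 <= r -> r < 1 -> \forall n \near \oo, r ^+ n < 1 / 4.
  move=> r0 r1'; have : r ^+ n @[n --> \oo] --> (0 : R).
    by apply: cvg_expr; rewrite ger0_norm.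
  have e4 : 0 < 1 / 4 :> R by lra.
  move=> /cvgr0Pnorm_lt/(_ _ e4); apply: filterS => n.
  by rewrite ger0_norm// exprn_ge0.
have Mm : (M (t - h) < +oo)%E by apply: (mgf_fin_le _ Mp); lra.
have r10 : 0 <= r1.
  by rewrite !mulr_ge0 ?invr_ge0 ?expR_ge0// ltW// fine_mgf_gt0.
have r20 : 0 <= r2.
  by rewrite !mulr_ge0 ?invr_ge0 ?expR_ge0// ltW// fine_mgf_gt0.
have r11 : r1 < 1 by rewrite ltr_pdivrMr// mul1r.
have r21 : r2 < 1 by rewrite ltr_pdivrMr// mul1r.
have natoo : (n%:R : R) @[n --> \oo] --> +oo by exact: cvgr_idn.
have ab2 := expR_absorb 2 natoo ba.
near=> n.
have n0 : (0 < n)%N by near: n; exists 1%N.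
have nR : 0 < n%:R :> R by rewrite ltr0n.
apply: (@le_trans _ _ (gaussn R n [set v | (`|n%:R^-1 * powR_sum v - x| < e)%R])); last first.
  apply: le_measure; rewrite ?inE; [exact: measurable_ball_sum..|].
  by move=> v /= /lt_le_trans; apply.
have := @gaussn_ball_ge n t h x e n0 h0 Mp.
have mB := @measurable_ball_sum n x e.
rewrite -[gaussn R n _](fineK (fin_num_measure _ _ mB)).
set p := fine _; rewrite -EFinM -!EFinD !lee_fin => main.
have mn0 : 0 < m t ^+ n by rewrite exprn_gt0.
have s1 : r1 ^+ n < 1 / 4 by near: n; exact: small.
have s2 : r2 ^+ n < 1 / 4 by near: n; exact: small.
have e1 : (m (t + h) * expR (- (h * (x + e)))) ^+ n = r1 ^+ n * m t ^+ n.
  by rewrite -exprMn divfK// gt_eqF.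
have e2 : (m (t - h) * expR (h * (x - e))) ^+ n = r2 ^+ n * m t ^+ n.
  by rewrite -exprMn divfK// gt_eqF.
rewrite e1 e2 in main.
have h1 : r1 ^+ n * m t ^+ n <= 1 / 4 * m t ^+ n by rewrite ler_wpM2r// ltW.
have h2 : r2 ^+ n * m t ^+ n <= 1 / 4 * m t ^+ n by rewrite ler_wpM2r// ltW.
have main' : m t ^+ n <= 2 * (expR (n%:R * (x * t + `|t| * e)) * p) by lra.
have main2 : expR (- (n%:R * (x * t + `|t| * e - ln (m t)))) <= 2 * p.
  rewrite (_ : - _ = n%:R * ln (m t) + - (n%:R * (x * t + `|t| * e))); last by ring.
  rewrite expRD -(expRn_ln _ mt0) expRN ler_pdivrMr ?expR_gt0//.
  by apply: (le_trans main'); rewrite mulrA mulrAC.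
have : 2 * expR (- (n%:R * a)) <= expR (- (n%:R * (x * t + `|t| * e - ln (m t)))).
  by near: n.
lra.
Unshelve. all: by end_near. Qed.

Definition cramer_rate (c : R) : \bar R :=
  if 0 <= c then Lambda_star q (c `^ q) else +oo%E.

Definition power_mean n (v : n.-tuple R) : R := (n%:R^-1 * powR_sum v) `^ q^-1.

Lemma measurable_power_mean n : measurable_fun setT (@power_mean n).
Proof.
apply: measurableT_comp (measurable_powR _) _.
by apply: measurable_funM => //; exact: measurable_powR_sum.
Qed.

Lemma cramer_rate_gt0 c : c != gauss_moment q `^ q^-1 -> (0 < cramer_rate c)%E.
Proof.
have q0 : 0 < q by case/andP: hq => q1 _; lra.
rewrite /cramer_rate; case: ifP => // c0 cmu; apply: Lambda_star_gt0 => //.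
apply: contra cmu => /eqP <-.
by rewrite -powRrM mulfV ?powRr1// (gt_eqF q0).
Qed.

(** The bounds for the mean of [|g_i| ^ q] are carried through the continuous maps [x ^ (1/q)] and
    [x ^ q] of the half-line. At [c = 0] the lower bound is vacuous by [Lambda_star0]. *)
Lemma cramer : local_ldp (gaussn R) power_mean (fun n => n%:R) cramer_rate.
Proof.
have q0 : 0 < q by case/andP: hq => q1 _; lra.
have iq0 : 0 < q^-1 by rewrite invr_gt0.
have mean0 n (v : n.-tuple R) : 0 <= n%:R^-1 * powR_sum v.
  by rewrite mulr_ge0 ?invr_ge0// powR_sum_ge0.
have meanE n (v : n.-tuple R) : n%:R^-1 * powR_sum v = power_mean v `^ q.
  by rewrite -powRrM mulVf ?gt_eqF// powRr1.
have pm0 n (v : n.-tuple R) : 0 <= power_mean v by exact: powR_ge0.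
have mP n := @measurable_power_mean n.
have mpb n x r : measurable [set v : n.-tuple R | (`|power_mean v - x| < r)%R].
  exact: (@measurable_ballE R _ (fun n => n.-tuple R) (fun n => @power_mean n) n x r (mP n)).
have mpt n K : measurable [set v : n.-tuple R | (K <= `|power_mean v|)%R].
  exact: (@measurable_tailE R _ (fun n => n.-tuple R) (fun n => @power_mean n) n K (mP n)).
split.
- move=> c r a r0; rewrite /cramer_rate; case: ifP => // c0 ca.
  have {}c0 : 0 < c.
    rewrite lt_def c0 andbT; apply/eqP => c00; move: ca.
    by rewrite c00 powR0 ?gt_eqF// Lambda_star0.
  have x0 : 0 < c `^ q by exact: powR_gt0.
  have [e e0 He] := powR_near iq0 (ltW x0) r0.
  apply: filterS (gaussn_ball_lower x0 e0 ca) => n; move/le_trans; apply.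
  apply: le_measure; rewrite ?inE.
  + exact: measurable_ball_sum.
  + exact: mpb.
  + move=> v /= /(He _ (mean0 _ v)); rewrite /power_mean.
    by rewrite -[X in _ - X]powRrM mulfV ?gt_eqF// powRr1// ltW.
- move=> c a; rewrite /cramer_rate; case: ifPn => [c0|].
    move=> /(Lambda_star_gt hq)[t [Mt at']].
    pose d := (c `^ q * t - ln (m t) - a) / (`|t| + 1).
    have T0 : 0 < `|t| + 1 by rewrite ltr_wpDl.
    have d0 : 0 < d by rewrite divr_gt0// subr_gt0.
    have dE : d * (`|t| + 1) = c `^ q * t - ln (m t) - a by rewrite divfK ?gt_eqF.
    have [e e0 He] := powR_near q0 c0 d0.
    exists e => //; exists 1%N => // n /= n0.
    apply: (@le_trans _ _ (gaussn R n [set v | (`|n%:R^-1 * powR_sum v - c `^ q| < d)%R])).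
      apply: le_measure; rewrite ?inE.
      + exact: mpb.
      + exact: measurable_ball_sum.
      + by move=> v /= /(He _ (pm0 _ v)); rewrite -meanE.
    apply: (le_trans (gaussn_ball_le _ _ n0 Mt)).
    rewrite lee_fin ler_expR lerN2 ler_wpM2l//; lra.
  rewrite -ltNge => c0 _; exists (- c); first lra.
  exists 1%N => // n _ /=.
  rewrite (_ : mkset _ = set0) ?measure0 ?lee_fin ?expR_ge0//.
  apply/seteqP; split => // v /=; rewrite ltr_norml => /andP[_].
  by have := pm0 _ v; lra.
- move=> a; pose t : R := 1 / 4.
  have Mt : (M t < +oo)%E by apply: mgf_fin_lt => //; rewrite /t; lra.
  pose z := 4 * (a + ln (m t)).
  (* The value [z] makes the exponent at [t = 1/4], where [mgf] is finite for all [q], equal to [a];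
     above 1 the power mean [p] satisfies [p <= p ^ q]. *)
  exists (Num.max 1 z); exists 1%N => // n /= n0.
  have t0 : 0 <= t by rewrite /t; lra.
  apply: (@le_trans _ _ (gaussn R n [set v | (z <= n%:R^-1 * powR_sum v)%R])).
    apply: le_measure; rewrite ?inE.
    + exact: mpt.
    + rewrite -[X in measurable X]setTI; apply: (@measurable_fun_ler _ _ _ setT) => //.
      by apply: measurable_funM => //; exact: measurable_powR_sum.
    + move=> v /=; rewrite ger0_norm// ge_max meanE => /andP[p1 pz].
      apply: (le_trans pz); apply: le1r_powR => //; by case/andP: hq.
  apply: (le_trans (gaussn_tail_le _ n0 Mt t0)).
  rewrite lee_fin ler_expR lerN2 ler_wpM2l//.
  rewrite /z /t; lra.
Qed.

End cramer.

(** * Haar projections *)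

Section matrix_measurability.
Context (R : realType).

Lemma measurable_coord n k (i : 'I_n) (j : 'I_k) :
  measurable_fun setT (fun a : borel 'M[R]_(n, k) => a i j).
Proof.
apply: (measurability _ (RGenOpens.measurableE R)).
move=> _ [_ [a [b ->] <-]]; rewrite setTI; apply: sub_sigma_algebra.
have /continuousP cf := @coord_continuous R n k i j.
exact/cf/interval_open.
Qed.

Lemma measurable_lqnorm d (T : measurableType d) (q : R) k (f : T -> 'cV[R]_k) :
  (forall i, measurable_fun setT (fun w => f w i 0)) ->
  measurable_fun setT (fun w => lqnorm q (f w)).
Proof.
move=> mf; apply: (measurableT_comp (measurable_powR q^-1)).
apply: measurable_sum => i.
exact: (measurableT_comp (measurable_norm_powR q) (mf i)).
Qed.

Lemma measurable_mulmx_coord d (T : measurableType d) n k l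
    (f : T -> 'M[R]_(n, k)) (g : T -> 'M[R]_(k, l)) :
  (forall i j, measurable_fun setT (fun w => f w i j)) ->
  (forall i j, measurable_fun setT (fun w => g w i j)) ->
  forall i j, measurable_fun setT (fun w => (f w *m g w) i j).
Proof.
move=> mf mg i j; rewrite (_ : (fun _ => _) = fun w => \sum_l f w i l * g w l j).
  by apply: measurable_sum => x; exact: measurable_funM.
by apply/funext => w; rewrite mxE.
Qed.

Lemma measurable_trmx_coord d (T : measurableType d) n k (f : T -> 'M[R]_(n, k)) :
  (forall i j, measurable_fun setT (fun w => f w i j)) ->
  forall i j, measurable_fun setT (fun w => (f w)^T i j).
Proof.
move=> mf i j; rewrite (_ : (fun _ => _) = fun w => f w j i); first exact: mf.
by apply/funext => w; rewrite mxE.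
Qed.

Lemma measurable_stiefel n k : measurable (@stiefel R n k : set (borel 'M[R]_(n, k))).
Proof.
rewrite (_ : @stiefel R n k = \bigcap_(i in [set: 'I_k]) \bigcap_(j in [set: 'I_k])
    ((fun a : borel 'M[R]_(n, k) => (a^T *m a) i j) @^-1` [set (1%:M : 'M[R]_k) i j])).
  apply: fin_bigcap_measurable; first exact: finite_finset.
  move=> i _; apply: fin_bigcap_measurable; first exact: finite_finset.
  move=> j _; rewrite -[X in measurable X]setTI.
  apply: measurable_mulmx_coord => //; last exact: measurable_coord.
  by apply: measurable_trmx_coord; exact: measurable_coord.
apply/seteqP; split => a; rewrite /stiefel/=.
  by move=> h i _ j _; exact: (congr1 (fun M : 'M[R]_k => M i j) h).
by move=> h; apply/matrixP => i j; exact: h.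
Qed.

Lemma lqnorm_ge0 (q : R) k (v : 'cV[R]_k) : 0 <= lqnorm q v.
Proof. exact: powR_ge0. Qed.

Lemma lqnormZ (q r : R) k (v : 'cV[R]_k) : 0 < q ->
  lqnorm q (r *: v) = `|r| * lqnorm q v.
Proof.
move=> q0; rewrite /lqnorm.
rewrite (eq_bigr (fun i => `|r| `^ q * `|v i 0| `^ q)); last first.
  by move=> i _; rewrite mxE normrM powRM.
rewrite -mulr_sumr powRM ?powR_ge0//; last first.
  by apply: sumr_ge0 => i _; exact: powR_ge0.
by rewrite -powRrM mulfV ?powRr1// (gt_eqF q0).
Qed.

Lemma lqnorm2_sqr k (v : 'cV[R]_k) : lqnorm 2 v ^+ 2 = (v^T *m v) 0 0.
Proof.
rewrite /lqnorm -powR_mulrn ?powR_ge0// -powRrM mulVf// powRr1; last first.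
  by apply: sumr_ge0 => i _; exact: powR_ge0.
rewrite mxE; apply: eq_bigr => i _.
by rewrite mxE powR_mulrn// sqr_abs expr2.
Qed.

Lemma lqnorm2_orth n k (O : 'M[R]_(n, k)) (v : 'cV[R]_k) : O^T *m O = 1%:M ->
  lqnorm 2 (O *m v) = lqnorm 2 v.
Proof.
move=> oO; apply/eqP; rewrite -(@eqrXn2 _ 2) ?lqnorm_ge0// !lqnorm2_sqr.
by rewrite trmx_mul -mulmxA (mulmxA O^T) oO mul1mx.
Qed.

Lemma lqnorm2_delta n (i : 'I_n) : lqnorm 2 (delta_mx i 0 : 'cV[R]_n) = 1.
Proof.
apply/eqP; rewrite -(@eqrXn2 _ 2) ?lqnorm_ge0// lqnorm2_sqr expr1n.
by rewrite trmx_delta mul_delta_mx mxE !eqxx.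
Qed.

End matrix_measurability.

Section product_sections.
Context d1 d2 (T1 : measurableType d1) (T2 : measurableType d2) (R : realType).
Context (m1 : probability T1 R) (m2 : probability T2 R).

Lemma prod_probabilityE (S : set (T1 * T2)) : measurable S ->
  (m1 \x m2)%E S = (\int[m1 \x m2]_z (\1_S z)%:E)%E.
Proof. by move=> mS; rewrite integral_indic// setIT. Qed.

Lemma prod_ysection_eq (S S' : set (T1 * T2)) : measurable S -> measurable S' ->
  (forall y, m1 [set x | S (x, y)] = m1 [set x | S' (x, y)]) ->
  (m1 \x m2)%E S = (m1 \x m2)%E S'.
Proof.
move=> mS mS' SS'; rewrite !prod_probabilityE//.
have h (U : set (T1 * T2)) : measurable U -> (\int[m1 \x m2]_z (\1_U z)%:E =
    \int[m2]_y m1 [set x | U (x, y)])%E.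
  move=> mU; rewrite fubini_tonelli2//; last first.
    by apply/measurable_EFinP; exact: measurable_indic.
  - apply: eq_integral => y _; rewrite /fubini_G.
    rewrite -[X in _ = m1 X]setIT -integral_indic//.
    by have := measurable_ysection y mU; rewrite /ysection; under eq_set do rewrite inE.
by rewrite !h//; apply: eq_integral => y _.
Qed.

(** The set [D] allows sections to be known only almost surely: a Haar matrix has orthonormal
    columns only on the Stiefel manifold. *)
Lemma prod_xsection_cst (S : set (T1 * T2)) (D : set T1) (c : \bar R) :
  measurable S -> measurable D -> m1 D = 1%E ->
  (forall x, D x -> m2 [set y | S (x, y)] = c) ->
  (m1 \x m2)%E S = c.
Proof.
move=> mS mD D1 Sc; rewrite prod_probabilityE// fubini_tonelli1//; last first.
  by apply/measurable_EFinP; exact: measurable_indic.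
have D0 : D !=set0.
  apply/set0P/eqP => D0; move: D1; rewrite D0 measure0 => /eqP.
  by rewrite eq_sym onee_eq0.
have [x0 Dx0] := D0.
have c0 : (0 <= c)%E by rewrite -(Sc _ Dx0).
transitivity (\int[m1]_x (cst c x))%E; last first.
  by rewrite integral_cst//= probability_setT mule1.
apply: ge0_ae_eq_integral => //.
- apply: measurable_fun_fubini_tonelli_F; last by move=> z; rewrite lee_fin.
  by apply/measurable_EFinP; exact: measurable_indic.
- by move=> x _; apply: integral_ge0 => y _; rewrite lee_fin.
exists (~` D); split; first exact: measurableC.
  have := probability_setC m1 mD.
  by rewrite D1 subee.
move=> x /= h Dx; apply: h => _; rewrite /fubini_F -(Sc _ Dx).
rewrite -[X in _ = m2 X]setIT -integral_indic//.
by have := measurable_xsection x mS; rewrite /xsection; under eq_set do rewrite inE.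
Qed.

End product_sections.

Section haar_laws.
Context (R : realType) (q : R) (q0 : 0 < q) (n k : nat).
Context (mu : probability (borel 'M[R]_(n.+1, k)) R) (haar : is_haar_stiefel mu).
Local Notation e1 := (delta_mx 0 0 : 'cV[R]_n.+1).

Lemma measurable_lqnorm_tr (x : 'cV[R]_n.+1) :
  measurable_fun setT (fun a : borel 'M[R]_(n.+1, k) => lqnorm q (a^T *m x)).
Proof.
apply: measurable_lqnorm => i; apply: measurable_mulmx_coord => //.
by apply: measurable_trmx_coord; exact: measurable_coord.
Qed.

(** An orthogonal [O] takes [x] to [r e1] with [|r| = |x|_2]; moving [O] from the vector to the
    matrix does not change the Haar law. *)
Lemma haar_radial (x : 'cV[R]_n.+1) (B : set R) : measurable B ->
  mu [set a | B (lqnorm q (a^T *m x))] =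
  mu [set a | B (lqnorm 2 x * lqnorm q (a^T *m e1))].
Proof.
move=> mB; have [ O [_ oO [r Or]]] := gauss_invariant_reduce x.
have xE : x = O^T *m (r *: e1) by rewrite -Or mulmxA oO mul1mx.
have nx : lqnorm 2 x = `|r|.
  by rewrite -(lqnorm2_orth x oO) Or lqnormZ// lqnorm2_delta mulr1.
have mS : measurable ([set a | B (lqnorm 2 x * lqnorm q (a^T *m e1))]
    : set (borel 'M[R]_(n.+1, k))).
  rewrite -[X in measurable X]setTI.
  have : measurable_fun setT (fun a : borel 'M[R]_(n.+1, k) =>
      lqnorm 2 x * lqnorm q (a^T *m e1)).
    by apply: measurable_funM => //; exact: measurable_lqnorm_tr.
  exact.
have key (a : 'M[R]_(n.+1, k)) : lqnorm q (a^T *m x) =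
    lqnorm 2 x * lqnorm q ((O *m a)^T *m e1).
  by rewrite nx -(lqnormZ r _ q0) scalemxAr trmx_mul -mulmxA -xE.
rewrite -(haar.2 O oO _ mS); congr (mu _); apply/seteqP.
by split => a /=; rewrite key.
Qed.

Context (d : measure_display) (T : measurableType d) (P : probability T R).
Context (xi : T -> 'cV[R]_n.+1).
Context (mxi : forall i, measurable_fun setT (fun w => xi w i 0)).

Lemma measurable_tr_mul_set (B : set R) : measurable B ->
  measurable [set z : borel 'M[R]_(n.+1, k) * T | B (lqnorm q (z.1^T *m xi z.2))].
Proof.
move=> mB; rewrite -[X in measurable X]setTI.
have : measurable_fun setT (fun z : borel 'M[R]_(n.+1, k) * T =>
    lqnorm q (z.1^T *m xi z.2)).
  apply: measurable_lqnorm => i; apply: measurable_mulmx_coord.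
    apply: measurable_trmx_coord => i' j'.
    exact: (measurableT_comp (measurable_coord i' j') measurable_fst).
  by move=> i' j'; rewrite ord1; exact: (measurableT_comp (mxi i') measurable_snd).
exact.
Qed.

Lemma measurable_radial_set (B : set R) : measurable B ->
  measurable [set z : borel 'M[R]_(n.+1, k) * T |
    B (lqnorm 2 (xi z.2) * lqnorm q (z.1^T *m e1))].
Proof.
move=> mB; rewrite -[X in measurable X]setTI.
have : measurable_fun setT (fun z : borel 'M[R]_(n.+1, k) * T =>
    lqnorm 2 (xi z.2) * lqnorm q (z.1^T *m e1)).
  apply: measurable_funM.
    apply: measurable_lqnorm => i.
    exact: (measurableT_comp (mxi i) measurable_snd).
  exact: (measurableT_comp (measurable_lqnorm_tr e1) measurable_fst).
exact.
Qed.

Lemma haar_joint_radial (B : set R) : measurable B ->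
  (mu \x P)%E [set z | B (lqnorm q (z.1^T *m xi z.2))] =
  (mu \x P)%E [set z | B (lqnorm 2 (xi z.2) * lqnorm q (z.1^T *m e1))].
Proof.
move=> mB; apply: prod_ysection_eq.
- exact: measurable_tr_mul_set.
- exact: measurable_radial_set.
- by move=> y; exact: (haar_radial (xi y) mB).
Qed.

End haar_laws.

Section gauss_haar.
Context (R : realType) (q : R) (q0 : 0 < q).

Definition col_of n (v : n.-tuple R) : 'cV[R]_n := (row_of v)^T.

Lemma lqnorm_col_of n (v : n.-tuple R) :
  lqnorm q (col_of v) = powR_sum q v `^ q^-1.
Proof.
rewrite /lqnorm /powR_sum; congr (_ `^ _); apply: eq_bigr => i _.
by rewrite !mxE.
Qed.

Lemma measurable_col_of n i :
  measurable_fun setT (fun v : n.-tuple R => col_of v i 0).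
Proof.
rewrite (_ : (fun _ => _) = (fun v => tnth v i)); first exact: measurable_tnth.
by apply/funext => v; rewrite !mxE.
Qed.

(** The law of [|a^T g|_q], for independent Haar [a] and Gaussian [g], is computed twice: fixing
    [g], it is radial; fixing [a] in the Stiefel manifold, [a^T g] is standard Gaussian in dimension
    [k]. *)
Lemma gauss_haar_law n k (mu : probability (borel 'M[R]_(n.+1, k)) R) (B : set R) :
  is_haar_stiefel mu -> measurable B ->
  gaussn R k [set v | B (lqnorm q (col_of v))] =
  (mu \x gaussn R n.+1)%E [set z |
    B (lqnorm 2 (col_of z.2) * lqnorm q (z.1^T *m delta_mx 0 0))].
Proof.
move=> haar mB.
rewrite -(@haar_joint_radial _ _ q0 _ _ _ haar _ _ _ _ (@measurable_col_of n.+1))//.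
symmetry; apply: (@prod_xsection_cst _ _ _ _ R mu (gaussn R n.+1) _ (@stiefel R n.+1 k)).
- by apply: measurable_tr_mul_set => //; exact: measurable_col_of.
- exact: measurable_stiefel.
- by have [] := haar.
move=> a oa.
have mk l (C : 'M[R]_(l, k)) : measurable_fun setT
    (fun v : l.-tuple R => lqnorm q (col_of (tmul v C))).
  apply: measurable_lqnorm => i.
  exact: (measurableT_comp (@measurable_col_of k i) (measurable_tmul C)).
have mS : measurable [set v : k.-tuple R | B (lqnorm q (col_of v))].
  rewrite -[X in measurable X]setTI.
  have : measurable_fun setT (fun v : k.-tuple R => lqnorm q (col_of v)).
    by apply: measurable_lqnorm => i; exact: measurable_col_of.
  exact.
have mS' : measurable [set v : n.+1.-tuple R | B (lqnorm q (col_of (tmul v a)))].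
  by rewrite -[X in measurable X]setTI; exact: mk.
set S := [set v : k.-tuple R | _] in mS *.
have mf : measurable_fun setT (fun v => (\1_S v)%:E : \bar R).
  by apply/measurable_EFinP; exact: measurable_indic.
have f0 v : (0 <= (\1_S v)%:E :> \bar R)%E by rewrite lee_fin.
have E1 := gaussn_stiefel oa mf f0.
have E2 := integral_indic (gaussn R k) measurableT mS.
have E3 := integral_indic (gaussn R n.+1) measurableT mS'.
rewrite setIT in E2; rewrite setIT in E3.
rewrite -E2 -E1 (_ : [set v | _] = [set v | B (lqnorm q (col_of (tmul v a)))]).
  by rewrite -E3.
apply/seteqP; split => v /=; by rewrite /col_of /tmul tuple_of_rowK trmx_mul.
Qed.

End gauss_haar.

Section local_ldp_misc.
Context (R : realType) (d : nat -> measure_display).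
Context (T : forall n, measurableType (d n)) (P : forall n, probability (T n) R).
Implicit Types (eta : forall n, T n -> R) (s : nat -> R) (I : R -> \bar R).

Lemma local_ldp_subseq eta s I (k : nat -> nat) : k n @[n --> \oo] --> \oo ->
  local_ldp P eta s I ->
  local_ldp (fun n => P (k n)) (fun n => eta (k n)) (fun n => s (k n)) I.
Proof.
move=> koo [L U Ti]; split.
- by move=> x r a r0 /(L x r a r0); exact: koo.
- by move=> x a /U[r r0 Ur]; exists r => //; exact: koo Ur.
- by move=> a; have [K TK] := Ti a; exists K; exact: koo TK.
Qed.

Lemma local_ldp_eq_speed eta s (t : nat -> R) I :
  (\forall n \near \oo, s n = t n) -> local_ldp P eta s I -> local_ldp P eta t I.
Proof.
move=> st [L U Ti]; split.
- by move=> x r a r0 /(L x r a r0); apply: filterS2 st => n ->.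
- move=> x a /U[r r0 Ur]; exists r => //.
  by apply: filterS2 st Ur => n ->.
- by move=> a; have [K TK] := Ti a; exists K; apply: filterS2 st TK => n ->.
Qed.

(** A ball of radius [- x] around [x < 0] misses the half-line, so its probability is zero and no
    finite rate obeys the lower bound. *)
Lemma local_ldp_neg eta s I : (forall n w, 0 <= eta n w) ->
  local_ldp P eta s I -> forall x, x < 0 -> I x = +oo%E.
Proof.
move=> eta0 [L _ _] x x0; apply/eqP; rewrite eq_le leey /= leNgt; apply/negP.
move=> /ereal_between[a [Ia _]].
have x0' : 0 < - x by lra.
have [n] := filter_ex (L x (- x) a x0' Ia).
rewrite (_ : mkset _ = set0); first by rewrite measure0 lee_fin leNgt expR_gt0.
apply/seteqP; split => // w /=; rewrite ltr_norml => /andP[_].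
by have := eta0 n w; lra.
Qed.

End local_ldp_misc.

Section joint_laws.
Context (R : realType) (d d1 d2 : measure_display).
Context (T : measurableType d) (T1 : measurableType d1) (T2 : measurableType d2).
Context (P : probability T R).

Lemma independent_joint_law (X : {mfun T >-> T1}) (Y : {mfun T >-> T2})
    (S : set (T1 * T2)) : independent_rv P X Y -> measurable S ->
  P [set w | S (X w, Y w)] = (distribution P X \x distribution P Y)%E S.
Proof.
move=> ind mS; pose f w := (X w, Y w).
have mf : measurable_fun setT f by exact: measurable_fun_pair.
pose pm : {measure set (T1 * T2) -> \bar R} := pushforward P f.
by rewrite (@product_measure_unique _ _ _ _ _ (distribution P X)
  (distribution P Y) (pm mf))// => B C mB mC; exact: ind.
Qed.

Lemma distribution_prod (X : {mfun T >-> T1}) (Q : probability T2 R)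
    (S : set (T1 * T2)) : measurable S ->
  (distribution P X \x Q)%E S = (P \x Q)%E [set z | S (X z.1, z.2)].
Proof.
move=> mS; pose f (z : T * T2) := (X z.1, z.2).
have mf : measurable_fun setT f.
  apply: measurable_fun_pair => //.
  exact: (measurableT_comp (measurable_funPT X) measurable_fst).
pose pm : {measure set (T1 * T2) -> \bar R} := pushforward (P \x Q)%E f.
rewrite (@product_measure_unique _ _ _ _ _ (distribution P X) Q (pm mf))// => B C mB mC.
rewrite -[LHS]/((P \x Q)%E ((X @^-1` B) `*` C)).
rewrite product_measure1E// -[X in measurable X]setTI.
exact: measurable_funPT.
Qed.

Lemma independent_rv_comp (X : {mfun T >-> T1}) (Y : {mfun T >-> T2})
    (f : T1 -> R) (g : T2 -> R) : independent_rv P X Y ->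
  measurable_fun setT f -> measurable_fun setT g ->
  independent_rv P (g \o Y) (f \o X).
Proof.
move=> ind mf mg B C mB mC; rewrite setIC muleC.
apply: (ind (f @^-1` C) (g @^-1` B)).
- by rewrite -[X in measurable X]setTI; exact: mf.
- by rewrite -[X in measurable X]setTI; exact: mg.
Qed.

End joint_laws.

(** The first basis vector in every dimension, including 0, where [delta_mx 0 0] does not
    typecheck. *)
Definition first_vec (R : realType) n : 'cV[R]_n := \col_(i < n) ((i == 0 :> nat)%N)%:R.

Lemma first_vecS (R : realType) n : first_vec R n.+1 = delta_mx 0 0.
Proof. by apply/colP => i; rewrite !mxE andbT. Qed.

Lemma power_mean_lqnorm (R : realType) (q : R) n (v : n.-tuple R) :
  power_mean q v = n%:R `^ (- q^-1) * lqnorm q (col_of v).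
Proof.
rewrite /power_mean lqnorm_col_of powRM ?invr_ge0 ?powR_sum_ge0//.
by rewrite -powR_inv1// -powRrM mulN1r.
Qed.

Lemma power_mean2 (R : realType) n (v : n.-tuple R) :
  power_mean 2 v = lqnorm 2 (col_of v) / Num.sqrt n%:R.
Proof.
by rewrite power_mean_lqnorm mulrC powRN powR12_sqrt.
Qed.

Lemma cramer_rate_ge0 (R : realType) (q c : R) : 1 <= q <= 2 ->
  (0 <= cramer_rate q c)%E.
Proof.
move=> hq; rewrite /cramer_rate; case: ifP => // _.
have M0 : (mgf q 0 < +oo)%E by rewrite mgf0 ltry.
by have := Lambda_star_ge hq (c `^ q) M0; rewrite mulr0 mgfr.unlock mgf0 ln1 subrr.
Qed.

(** Cramer's theorem with exponent 2 has speed [n] and a rate vanishing only at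
    [gauss_moment 2 = 1]; at the slower speed [k n] nothing but concentration at 1 is left. *)
Lemma rho_local_ldp (R : realType) (k : nat -> nat) :
  k n @[n --> \oo] --> \oo -> much_less (fun n => (k n)%:R : R) (fun n => n%:R) ->
  local_ldp (gaussn R) (@power_mean R 2) (fun n => (k n)%:R) (chi_rate 1).
Proof.
move=> koo ksub; have h2 : 1 <= (2 : R) <= 2 by lra.
have noo : (n%:R : R) @[n --> \oo] --> +oo by exact: cvgr_idn.
have kRoo : ((k n)%:R : R) @[n --> \oo] --> +oo by move=> B /noo; exact: koo.
have := local_ldp_slower noo kRoo ksub _ (cramer_rate_gt0 h2) (cramer h2).
rewrite gauss_moment2 powR1; apply => n; exact: measurable_power_mean.
Qed.

Section projection_laws.
Context (R : realType) (q : R) (q0 : 0 < q) (n k : nat) (n0 : (0 < n)%N).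
Context (d : measure_display) (T : measurableType d) (P : probability T R).
Context (A : {mfun T >-> borel 'M[R]_(n, k)}).
Context (haar : is_haar_stiefel (distribution P A)).

Lemma measurable_scale_set (c : R) (B : set R) : measurable B ->
  measurable [set x : R | B (c * x)].
Proof.
move=> mB; rewrite -[X in measurable X]setTI.
have : measurable_fun setT (fun x : R => c * x) by exact: measurable_funM.
exact.
Qed.

Lemma mul_div_cancel (c t a b : R) : t != 0 -> a / t * (c * t * b) = c * (a * b).
Proof. by move=> t0; field. Qed.

Lemma gauss_projection_law (B : set R) : measurable B ->
  gaussn R k [set v | B (power_mean q v)] =
  (P \x gaussn R n)%E [set z | B (power_mean 2 z.2 *
    (k%:R `^ (- q^-1) * Num.sqrt n%:R * lqnorm q ((A z.1)^T *m first_vec R n)))].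
Proof.
case: n n0 A haar => // n' _ A' haar' mB.
have sn0 : Num.sqrt n'.+1%:R != 0 :> R by rewrite gt_eqF// sqrtr_gt0 ltr0n.
have mB' := measurable_scale_set (k%:R `^ (- q^-1)) mB.
have -> : [set v : k.-tuple R | B (power_mean q v)] =
    [set v : k.-tuple R | [set x | B (k%:R `^ (- q^-1) * x)] (lqnorm q (col_of v))].
  by apply/seteqP; split => v /=; rewrite power_mean_lqnorm.
rewrite (gauss_haar_law q0 haar' mB') distribution_prod; last first.
  by apply: measurable_radial_set => //; exact: measurable_col_of.
apply: (congr1 (fun S => (P \x gaussn R n'.+1)%E S)).
by apply/seteqP; split => z /=; rewrite first_vecS power_mean2 (mul_div_cancel _ _ _ sn0).
Qed.

Lemma haar_projection_law (X : {mfun T >-> borel 'cV[R]_n}) (B : set R) :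
  independent_rv P A X -> measurable B ->
  P [set w | B (k%:R `^ (- q^-1) * lqnorm q ((A w)^T *m X w))] =
  P [set w | B (lqnorm 2 (X w) / Num.sqrt n%:R *
    (k%:R `^ (- q^-1) * Num.sqrt n%:R * lqnorm q ((A w)^T *m first_vec R n)))].
Proof.
case: n n0 A haar X => // n' _ A' haar' X ind mB.
have sn0 : Num.sqrt n'.+1%:R != 0 :> R by rewrite gt_eqF// sqrtr_gt0 ltr0n.
have mB' := measurable_scale_set (k%:R `^ (- q^-1)) mB.
pose xi (x : borel 'cV[R]_n'.+1) : 'cV[R]_n'.+1 := x.
have mxi (i : 'I_n'.+1) : measurable_fun setT (fun x => xi x i 0).
  exact: measurable_coord.
have mS := measurable_tr_mul_set (k := k) q mxi mB'.
have mS' := measurable_radial_set (k := k) q mxi mB'.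
have := haar_joint_radial q0 haar' (distribution P X) mxi mB'.
rewrite -(independent_joint_law ind mS) -(independent_joint_law ind mS') => E.
apply: (etrans E); apply: (congr1 (fun S => P S)).
by apply/seteqP; split => w /=; rewrite first_vecS (mul_div_cancel _ _ _ sn0).
Qed.

End projection_laws.

(** * The three rate functions *)

Section product_rates.
Context (R : realType) (q : R) (hq : 1 <= q <= 2).
Context (J : R -> \bar R) (J0 : forall x, (0 <= J x)%E).
Context (Jneg : forall x, x < 0 -> J x = +oo%E).
Implicit Types (v w z a m c : R).

Lemma cramer_rate_le0 w : w <= 0 -> cramer_rate q w = +oo%E.
Proof.
have q0 : 0 < q by case/andP: hq => q1 _; lra.
rewrite le_eqVlt => /predU1P[->|w0]; rewrite /cramer_rate.
  by rewrite lexx powR0 ?gt_eqF// Lambda_star0.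
by rewrite leNgt w0.
Qed.

(** In each of the three regimes, the pair of lemmas [_le] and [_factor] supplies the two conditions
    on the rate in [local_ldp_prod]. *)
Lemma rate_fast_le m v w : 0 < m ->
  (rate_fast q m (v * w)%R <= chi_rate m v + cramer_rate q w)%E.
Proof.
move=> m0; rewrite /chi_rate; case: eqP => [->|_]; last first.
  by rewrite addye ?leey//; have := cramer_rate_ge0 w hq; case: cramer_rate.
rewrite add0e /rate_fast /cramer_rate pmulr_rge0//; case: ifP => // w0.
have mq : m `^ q != 0 by rewrite gt_eqF// powR_gt0.
by rewrite powRM// ?(ltW m0)// mulrC mulKf.
Qed.

Lemma rate_fast_factor m z a : 0 < m -> (rate_fast q m z < a%:E)%E ->
  exists v w, v * w = z /\ (chi_rate m v + cramer_rate q w < a%:E)%E.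
Proof.
move=> m0 za; exists m, (z / m); split; first by rewrite mulrC divfK// gt_eqF.
move: za; rewrite /chi_rate eqxx add0e /rate_fast /cramer_rate.
rewrite pmulr_lge0 ?invr_gt0//; case: ifP => // z0.
have zm : 0 <= z / m by rewrite divr_ge0// ltW.
have m1 : m != 0 by rewrite gt_eqF.
have mq : m `^ q != 0 by rewrite gt_eqF// powR_gt0.
have zq : z `^ q = (z / m) `^ q * m `^ q by rewrite -powRM ?(ltW m0)// divfK.
by rewrite zq mulfK.
Qed.

(** If [w <= 0] or [v < 0] the right-hand side is infinite; otherwise [c = w] competes in the
    infimum. *)
Lemma rate_critical_le v w :
  (rate_critical q J (v * w)%R <= J v + cramer_rate q w)%E.
Proof.
have [w0|w0] := leP w 0.
  by rewrite cramer_rate_le0// addey ?leey//; have := J0 v; case: (J v).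
have [v0|v0] := ltP v 0.
  by rewrite Jneg// addye ?leey//; have := cramer_rate_ge0 w hq; case: cramer_rate.
rewrite /rate_critical mulr_ge0 ?(ltW w0)//; apply: ereal_inf_lbound.
exists w => //=; rewrite mulfK ?gt_eqF// /cramer_rate ltW//.
by rewrite addeC.
Qed.

Lemma rate_critical_factor z a : (rate_critical q J z < a%:E)%E ->
  exists v w, v * w = z /\ (J v + cramer_rate q w < a%:E)%E.
Proof.
rewrite /rate_critical; case: ifP => // z0 /ereal_inf_lt[_ [c /= c0 <-]] ca.
exists (z / c), c; split; first by rewrite divfK// gt_eqF.
by rewrite addeC /cramer_rate ltW.
Qed.

Lemma rate_slow_le v w :
  (rate_slow q J (v * w)%R <= J v + chi_rate (gauss_moment q `^ q^-1) w)%E.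
Proof.
have c0 : 0 < gauss_moment q `^ q^-1 by rewrite powR_gt0 ?gauss_moment_gt0.
rewrite /chi_rate; case: eqP => [->|_]; last first.
  by rewrite addey ?leey//; have := J0 v; case: (J v).
rewrite adde0 /rate_slow pmulr_lge0//; have [v0|v0] := leP 0 v.
  by rewrite mulfK// gt_eqF.
by rewrite Jneg.
Qed.

Lemma rate_slow_factor z a : (rate_slow q J z < a%:E)%E ->
  exists v w, v * w = z /\
    (J v + chi_rate (gauss_moment q `^ q^-1) w < a%:E)%E.
Proof.
have c0 : 0 < gauss_moment q `^ q^-1 by rewrite powR_gt0 ?gauss_moment_gt0.
rewrite /rate_slow; case: ifP => // z0 za.
exists (z / gauss_moment q `^ q^-1), (gauss_moment q `^ q^-1).
by rewrite divfK ?gt_eqF// /chi_rate eqxx adde0.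
Qed.

End product_rates.

(** * Assembling the radius and the projected factor *)

Section projected_norm.
Context (R : realType) (q : R) (hq : 1 <= q <= 2).
Context (d : nat -> measure_display) (T : forall n, measurableType (d n)).
Context (P : forall n, probability (T n) R) (k : nat -> nat).
Context (X : forall n, {mfun T n >-> borel 'cV[R]_n}).
Context (A : forall n, {mfun T n >-> borel 'M[R]_(n, k n)}).
Context (hk : forall n, (0 < n)%N -> (1 <= k n <= n)%N).
Context (hA : forall n, (0 < n)%N -> is_haar_stiefel (distribution (P n) (A n))).
Context (hAX : forall n, (0 < n)%N -> independent_rv (P n) (A n) (X n)).
Context (hk_oo : k n @[n --> \oo] --> \oo).
Context (hk_sub : much_less (fun n => (k n)%:R : R) (fun n => n%:R)).

Let V n (w : T n) : R := lqnorm 2 (X n w) / Num.sqrt n%:R.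
Let W n (w : T n) : R :=
  (k n)%:R `^ (- q^-1) * Num.sqrt n%:R * lqnorm q ((A n w)^T *m first_vec R n).
Let Yk n (w : T n) : R := (k n)%:R `^ (- q^-1) * lqnorm q ((A n w)^T *m X n w).

Lemma near_gt0 : \forall n \near \oo, (0 < n)%N.
Proof. by exists 1%N. Qed.

Lemma k_cvgy : ((k n)%:R : R) @[n --> \oo] --> +oo.
Proof.
have noo : (n%:R : R) @[n --> \oo] --> +oo by exact: cvgr_idn.
by move=> B /noo; exact: hk_oo.
Qed.

Lemma measurable_coordX n i j : measurable_fun setT (fun w => X n w i j).
Proof. exact: (measurableT_comp (measurable_coord i j) (measurable_funPT (X n))). Qed.

Lemma measurable_coordA n i j : measurable_fun setT (fun w => A n w i j).
Proof. exact: (measurableT_comp (measurable_coord i j) (measurable_funPT (A n))). Qed.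

Lemma measurable_radius n : measurable_fun setT (@V n).
Proof.
apply: measurable_funM => //; apply: measurable_lqnorm => i.
exact: measurable_coordX.
Qed.

Lemma measurable_normA n (f : T n -> 'cV[R]_n) :
  (forall i j, measurable_fun setT (fun w => f w i j)) ->
  measurable_fun setT (fun w => lqnorm q ((A n w)^T *m f w)).
Proof.
move=> mf; apply: measurable_lqnorm => i; apply: measurable_mulmx_coord => //.
by apply: measurable_trmx_coord => i' j'; exact: measurable_coordA.
Qed.

Lemma measurable_profile n : measurable_fun setT (@W n).
Proof.
by apply: measurable_funM => //; apply: measurable_normA => i j.
Qed.

Lemma measurable_Yk n : measurable_fun setT (@Yk n).
Proof.
by apply: measurable_funM => //; apply: measurable_normA; exact: measurable_coordX.
Qed.

(** Cramer's theorem is read along [k n] and divided by [rho], the normalized length of the Gaussian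
    vector in dimension [n]. *)
Lemma profile_local_ldp : local_ldp P W (fun n => (k n)%:R) (cramer_rate q).
Proof.
have q0 : 0 < q by case/andP: hq => q1 _; lra.
have G := local_ldp_subseq hk_oo (cramer hq).
apply: (local_ldp_divide k_cvgy measurable_profile _ _
  (rho_local_ldp hk_oo hk_sub) G).
- by move=> n; exact: measurable_power_mean.
- near=> n => B mB; have n0 : (0 < n)%N by near: n; exact: near_gt0.
  exact: (gauss_projection_law q0 n0 (hA n0) mB).
Unshelve. all: by end_near. Qed.

Lemma independent_factors : \forall n \near \oo, independent_rv (P n) (@V n) (@W n).
Proof.
near=> n; have n0 : (0 < n)%N by near: n; exact: near_gt0.
pose f (a : borel 'M[R]_(n, k n)) : R :=
  (k n)%:R `^ (- q^-1) * Num.sqrt n%:R * lqnorm q (a^T *m first_vec R n).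
pose g (x : borel 'cV[R]_n) : R := lqnorm 2 (x : 'cV[R]_n) / Num.sqrt n%:R.
apply: (@independent_rv_comp _ _ _ _ _ _ _ (P n) (A n) (X n) f g (hAX n0)).
- apply: measurable_funM => //; apply: measurable_lqnorm => i.
  apply: measurable_mulmx_coord => //.
  by apply: measurable_trmx_coord; exact: measurable_coord.
- apply: measurable_funM => //; apply: measurable_lqnorm => i.
  exact: measurable_coord.
Unshelve. all: by end_near. Qed.

Lemma projected_norm_LDP (t speed : nat -> R) (IV IW I : R -> \bar R) :
  is_speed speed -> (\forall n \near \oo, t n = speed n) ->
  (forall v w : R, (I (v * w)%R <= IV v + IW w)%E) ->
  (forall z a, (I z < a%:E)%E ->
    exists v w : R, v * w = z /\ (IV v + IW w < a%:E)%E) ->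
  local_ldp P V t IV -> local_ldp P W t IW -> LDP_GRF P Yk speed I.
Proof.
move=> sp ts Ile Ige ldpV ldpW.
have q0 : 0 < q by case/andP: hq => q1 _; lra.
apply: (local_ldp_LDP_GRF sp measurable_Yk).
have ldpV' := local_ldp_eq_speed ts ldpV.
have ldpW' := local_ldp_eq_speed ts ldpW.
have := local_ldp_prod sp.2 measurable_radius measurable_profile
  independent_factors Ile Ige ldpV' ldpW'.
apply: local_ldp_congr.
near=> n => B mB; have n0 : (0 < n)%N by near: n; exact: near_gt0.
exact: esym (haar_projection_law q0 n0 (hA n0) (hAX n0) mB).
Unshelve. all: by end_near. Qed.

Lemma is_speed_min (s : nat -> R) : is_speed s ->
  is_speed (fun n => Num.min (s n) (k n)%:R).
Proof.
move=> [s0 sy]; split=> [n n0|].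
  by rewrite lt_min s0//= ltr0n; case/andP: (hk n0).
apply/cvgryPge => a; have k_y := k_cvgy.
near=> n; rewrite le_min; apply/andP; split; near: n.
- by move/cvgryPge : sy; exact.
- by move/cvgryPge : k_y; exact.
Unshelve. all: by end_near. Qed.

End projected_norm.

Lemma much_less_lt (R : realType) (a b : nat -> R) :
  b n @[n --> \oo] --> +oo -> much_less a b -> \forall n \near \oo, a n < b n.
Proof.
move=> b_y ab; have b0 := speed_gt0 b_y.
have ab1 : \forall n \near \oo, a n / b n < 1.
  exact: cvgr_lt ab _ ltr01.
by apply: filterS2 b0 ab1 => n bn; rewrite ltr_pdivrMr// mul1r.
Qed.
Theorem theorem2p12 (R : realType) (q : R) (hq : 1 <= q <= 2)
    (d : nat -> measure_display) (T : forall n, measurableType (d n))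
    (P : forall n, probability (T n) R) (k : nat -> nat)
    (X : forall n, {mfun T n >-> borel 'cV[R]_n})
    (A : forall n, {mfun T n >-> borel 'M[R]_(n, k n)})
    (s : nat -> R) (J : R -> \bar R) (m : R)
    (hk : forall n, (0 < n)%N -> (1 <= k n <= n)%N)
    (hA : forall n, (0 < n)%N -> is_haar_stiefel (distribution (P n) (A n)))
    (hAX : forall n, (0 < n)%N -> independent_rv (P n) (A n) (X n))
    (hk_oo : k n @[n --> \oo] --> \oo)
    (hk_sub : much_less (fun n => (k n)%:R : R) (fun n => n%:R))
    (hX : LDP_GRF P (fun n w => lqnorm 2 (X n w) / Num.sqrt n%:R) s J)
    (hm : 0 < m) (hJm : forall x, x != m -> (J m < J x)%E) :
  let Y n (w : T n) : R := lqnorm q ((A n w)^T *m X n w) in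
  let Yk n (w : T n) : R := (k n)%:R `^ (- q^-1) * Y n w in
  let speed n : R := Num.min (s n) (k n)%:R in
  [/\ much_less (fun n => (k n)%:R) s ->
        LDP_GRF P Yk speed (rate_fast q m),
      (forall n, (0 < n)%N -> s n = (k n)%:R) ->
        LDP_GRF P Yk speed (rate_critical q J) &
      much_less s (fun n => (k n)%:R) ->
        LDP_GRF P Yk speed (rate_slow q J)].
Proof.
move=> Y Yk speed.
have q0 : 0 < q by case/andP: hq => q1 _; lra.
have [[s_sp J0 _ _] _] := hX; have sy := s_sp.2.
have mV n := measurable_radius X (n := n).
have ldpV := LDP_GRF_local_ldp mV hX.
have ldpW := profile_local_ldp hq hA hk_oo hk_sub.
have k_y : ((k n)%:R : R) @[n --> \oo] --> +oo := k_cvgy hk_oo.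
have sp : is_speed speed := is_speed_min hk hk_oo s_sp.
(* Forced by the nonnegativity of the radius; it matches the value [+oo] of the limiting rates on
   the negative half-line. *)
have Jneg x : x < 0 -> J x = +oo%E.
  apply: (local_ldp_neg _ ldpV) => n w.
  by rewrite divr_ge0 ?lqnorm_ge0 ?sqrtr_ge0.
(* As [J m >= 0], uniqueness of the minimum gives every other point a positive cost. *)
have J_gt0 x : x != m -> (0 < J x)%E by move/hJm; exact: le_lt_trans.
have mW n := measurable_profile q A (n := n).
split.
- move=> ks; have ldpV' := local_ldp_slower sy k_y ks mV J_gt0 ldpV.
  apply: (projected_norm_LDP hq hA hAX sp _ _ _ ldpV' ldpW).
  + apply: filterS (much_less_lt sy ks) => n lt_ks.
    by rewrite /speed min_r// ltW.
  + by move=> v w; exact: rate_fast_le.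
  + by move=> z a; exact: rate_fast_factor.
- move=> sk; have nsk : \forall n \near \oo, s n = (k n)%:R by exists 1%N.
  apply: (projected_norm_LDP hq hA hAX sp _ _ _ (local_ldp_eq_speed nsk ldpV) ldpW).
  + by apply: filterS nsk => n skn; rewrite /speed skn minxx.
  + by move=> v w; exact: rate_critical_le.
  + by move=> z a; exact: rate_critical_factor.
- move=> sk; have ldpW' := local_ldp_slower k_y sy sk mW (cramer_rate_gt0 hq) ldpW.
  apply: (projected_norm_LDP hq hA hAX sp _ _ _ ldpV ldpW').
  + apply: filterS (much_less_lt k_y sk) => n lt_sk.
    by rewrite /speed min_l// ltW.
  + by move=> v w; exact: rate_slow_le.
  + by move=> z a; exact: rate_slow_factor.
Qed.
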